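(* Let $K:\mathcal{D}\to[0,\infty)$ be a map and let $\sigma_1,\sigma_2,\sigma_3$ be positive Borel measures on $\mathbb{R}^n$. Let $1<p_1,p_2,p_3<\infty$ and $\frac1{p_1}+\frac1{p_2}+\frac1{p_3}\ge 1$. The following statements are equivalent: (a) There is a constant $c_1<\infty$ such that the following trilinear embedding holds for all $f_i\in L^{p_i}(d\sigma_i)$, $i=1,2,3$: $$\sum_{Q\in\mathcal{D}}K(Q)\prod_{i=1}^3\left|\int_{Q}f_i\,d\sigma_i\right|\le c_1\prod_{i=1}^3\|f_i\|_{L^{p_i}(d\sigma_i)}<\infty.$$ (b) There is a constant $c_2<\infty$ such that for every permutation $(a,b,c)$ of $(1,2,3)$ the following holds. If $\frac1{p_a}+\frac1{p_b}\ge 1$, then for all $Q\in\mathcal{D}$, $$\left(\int_{Q}\Big(\sum_{Q'\in\mathcal{D},\,Q'\subset Q}K(Q,\sigma_c)(Q')\,\sigma_a(Q')1_{Q'}\Big)^{p_b'}\,d\sigma_b\right)^{1/p_b'}\le c_2\,\sigma_a(Q)^{1/p_a}\sigma_c(Q)^{1/p_c}<\infty$$ and $$\left(\int_{Q}\Big(\sum_{Q'\in\mathcal{D},\,Q'\subset Q}K(Q,\sigma_c)(Q')\,\sigma_b(Q')1_{Q'}\Big)^{p_a'}\,d\sigma_a\right)^{1/p_a'}\le c_2\,\sigma_b(Q)^{1/p_b}\sigma_c(Q)^{1/p_c}<\infty.$$ If $\frac1{p_a}+\frac1{p_b}<1$, then for all $Q\in\mathcal{D}$ and for $r$ defined by $\frac1r+\frac1{p_a}+\frac1{p_b}=1$,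 $$\left\|\mathcal{W}^{p_b'}_{K(Q,\sigma_c),\sigma_b}[\sigma_a]^{1/p_b'}\right\|_{L^r(d\sigma_a)}\le c_2\,\sigma_c(Q)^{1/p_c}<\infty$$ and $$\left\|\mathcal{W}^{p_a'}_{K(Q,\sigma_c),\sigma_a}[\sigma_b]^{1/p_a'}\right\|_{L^r(d\sigma_b)}\le c_2\,\sigma_c(Q)^{1/p_c}<\infty.$$ Moreover, the least possible $c_1$ and $c_2$ are equivalent.
   Context: $\mathcal{D}$ is the family of all dyadic cubes $Q=2^{-k}(m+[0,1)^n)$, $k\in\mathbb{Z}$, $m\in\mathbb{Z}^n$, in $\mathbb{R}^n$. $1_E$ is the characteristic function of the set $E$. For $1<p<\infty$, $p'=\frac{p}{p-1}$ is the dual exponent. Cubes denoted $Q,Q',R,R'$ always belong to $\mathcal{D}$. Restricted map. For a map $K:\mathcal{D}\to[0,\infty)$, a positive Borel measure $\mu$ on $\mathbb{R}^n$ and $Q\in\mathcal{D}$, the map $K(Q,\mu)$ on $\mathcal{D}$ is defined by $K(Q,\mu)(Q')=K(Q')\mu(Q')$ if $Q'\in\mathcal{D}$ and $Q'\subset Q$, and $K(Q,\mu)(Q')=0$ otherwise. Discrete Wolff's potential. Let $\mu,\nu$ be positive Borel measures on $\mathbb{R}^n$ and let $L:\mathcal{D}\to[0,\infty)$ be a map. For $R\in\mathcal{D}$ and $x\in R$ put $$\overline{L}_{\mu}(R)(x):=\frac1{\mu(R)}\sum_{R'\in\mathcal{D},\,R'\subset R}L(R')\mu(R')1_{R'}(x),$$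 and $\overline{L}_{\mu}(R)(x)=0$ when $\mu(R)=0$. For $p>1$, the discrete Wolff's potential of $\nu$ is $$\mathcal{W}^p_{L,\mu}[\nu](x):=\sum_{R\in\mathcal{D}}L(R)\mu(R)\left(\int_{R}\overline{L}_{\mu}(R)(y)\,d\nu(y)\right)^{p-1}1_{R}(x),\quad x\in\mathbb{R}^n.$$ In the theorem this is used with $L=K(Q,\sigma_c)$, for the fixed cube $Q$. ''The least possible $c_1$ and $c_2$ are equivalent'' means that each is bounded by a constant multiple of the other, where the constants do not depend on $K$ or on $\sigma_1,\sigma_2,\sigma_3$ (they may depend on $n,p_1,p_2,p_3$).
   Formalization: The positive Borel measures σ_1, σ_2, σ_3 are assumed finite on every dyadic cube; without this the equivalence fails, e.g. for σ_1 = ∞·δ_0 with the other two Lebesgue and K the indicator of one cube containing 0. *)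

(* Defs.v *)
From HB Require Import structures.
From mathcomp Require Import all_boot all_order all_algebra all_fingroup.
From mathcomp Require Import all_classical all_reals all_analysis.

Set Implicit Arguments.
Unset Strict Implicit.
Unset Printing Implicit Defensive.

Import Order.TTheory GRing.Theory Num.Theory.
Import numFieldNormedType.Exports.

Local Open Scope classical_set_scope.
Local Open Scope ring_scope.

Definition borelRn (R : realType) (n : nat) :=
  g_sigma_algebraType (@open 'rV[R]_n).

Definition dyadic_cube (R : realType) (n : nat) (k : int) (m : 'rV[int]_n) :
    set (borelRn R n) :=
  [set (2 : R) ^ (- k) *: (map_mx intr m + u)
    | u in [set u : 'rV[R]_n | forall i, 0 <= u ord0 i < 1]].

Definition dyadic (R : realType) (n : nat) : set (set (borelRn R n)) :=
  [set Q | exists k m, Q = @dyadic_cube R n k m].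

Arguments dyadic {R n}.

Definition dual_exponent (R : realType) (p : R) : R := p / (p - 1).

Local Open Scope ereal_scope.

(* A map on D is represented by a function on all
   subsets of R^n, of which only the values on D are ever used. *)
Definition restricted_map (R : realType) (n : nat) (K : set (borelRn R n) -> R)
    (Q : set (borelRn R n)) (mu : {measure set (borelRn R n) -> \bar R})
    (Q' : set (borelRn R n)) : \bar R :=
  if `[< Q' `<=` Q >] then (K Q')%:E * mu Q' else 0.

Definition dyadic_sum (R : realType) (n : nat) (L : set (borelRn R n) -> \bar R)
    (mu : {measure set (borelRn R n) -> \bar R})
    (Q : set (borelRn R n)) (x : borelRn R n) : \bar R :=
  \esum_(Q' in [set Q' | dyadic Q' /\ Q' `<=` Q])
    (L Q' * mu Q' * (\1_Q' x)%:E).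

Definition Lbar (R : realType) (n : nat) (L : set (borelRn R n) -> \bar R)
    (mu : {measure set (borelRn R n) -> \bar R})
    (Q : set (borelRn R n)) (x : borelRn R n) : \bar R :=
  if mu Q == 0 then 0 else (mu Q)^-1 * dyadic_sum L mu Q x.

Definition wolff (R : realType) (n : nat) (p : R)
    (L : set (borelRn R n) -> \bar R)
    (mu nu : {measure set (borelRn R n) -> \bar R})
    (x : borelRn R n) : \bar R :=
  \esum_(Q in dyadic)
    (L Q * mu Q * (\int[nu]_(y in Q) Lbar L mu Q y) `^ (p - 1)
      * (\1_Q x)%:E).

Definition trilinear_embedding (R : realType) (n : nat)
    (K : set (borelRn R n) -> R)
    (sigma : 'I_3 -> {measure set (borelRn R n) -> \bar R})
    (p : 'I_3 -> R) (c : R) : Prop :=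
  forall f : 'I_3 -> borelRn R n -> R,
    (forall i, f i \in Lfun (sigma i) (p i)%:E) ->
    \esum_(Q in dyadic)
       ((K Q)%:E * \prod_(i < 3) `|\int[sigma i]_(x in Q) (f i x)%:E|)
      <= c%:E * \prod_(i < 3) 'N[sigma i]_(p i)%:E[EFin \o f i] /\
    c%:E * \prod_(i < 3) 'N[sigma i]_(p i)%:E[EFin \o f i] < +oo.

Definition sawyer_testing (R : realType) (n : nat)
    (K : set (borelRn R n) -> R)
    (sa sb sc : {measure set (borelRn R n) -> \bar R})
    (pa pb pc c : R) : Prop :=
  forall Q, dyadic Q ->
    (\int[sb]_(x in Q)
        dyadic_sum (restricted_map K Q sc) sa Q x `^ (dual_exponent pb))
      `^ (dual_exponent pb)^-1
      <= c%:E * sa Q `^ pa^-1 * sc Q `^ pc^-1 /\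
    c%:E * sa Q `^ pa^-1 * sc Q `^ pc^-1 < +oo.

Definition wolff_testing (R : realType) (n : nat)
    (K : set (borelRn R n) -> R)
    (sa sb sc : {measure set (borelRn R n) -> \bar R})
    (pb pc r c : R) : Prop :=
  forall Q, dyadic Q ->
    'N[sa]_r%:E[(fun x =>
        wolff (dual_exponent pb) (restricted_map K Q sc) sb sa x
          `^ (dual_exponent pb)^-1)]
      <= c%:E * sc Q `^ pc^-1 /\
    c%:E * sc Q `^ pc^-1 < +oo.

Definition testing_conditions (R : realType) (n : nat)
    (K : set (borelRn R n) -> R)
    (sigma : 'I_3 -> {measure set (borelRn R n) -> \bar R})
    (p : 'I_3 -> R) (c2 : R) : Prop :=
  forall s : 'S_3,
    let a := s 0%R in let b := s 1%R in let c := s 2%R in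
    ((1 <= (p a)^-1 + (p b)^-1)%R ->
       sawyer_testing K (sigma a) (sigma b) (sigma c) (p a) (p b) (p c) c2 /\
       sawyer_testing K (sigma b) (sigma a) (sigma c) (p b) (p a) (p c) c2) /\
    (((p a)^-1 + (p b)^-1 < 1)%R ->
       forall r : R, (r^-1 + (p a)^-1 + (p b)^-1 = 1)%R ->
       wolff_testing K (sigma a) (sigma b) (sigma c) (p b) (p c) r c2 /\
       wolff_testing K (sigma b) (sigma a) (sigma c) (p a) (p c) r c2).

(* The least constant is taken among the nonnegative ones: when the right-hand
   sides all vanish, negative constants would be admissible too. It is +oo when
   no constant is admissible. *)
Definition least_constant (R : realType) (P : R -> Prop) : \bar R :=
  ereal_inf [set c%:E | c in [set c : R | (0 <= c)%R /\ P c]].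

(* Main.v *)
(* Integrals and sums over all dyadic cubes are monotone limits along finite
   families of cubes. For a finite family, the parts of the cubes outside the
   smaller cubes of the family are the atoms of the algebra it generates, so
   that both conditions become inequalities between finite sums over a forest,
   and it suffices to compare their constants independently of the forest.

   Sufficiency: split the cubes according to the index i which maximizes
   sigma_i(Q) times the p_i-th power of the average of f_i, and take stopping
   cubes where that average doubles. Between two generations of stopping cubes
   the average of f_i is essentially constant, and the two other functions may
   be replaced by their averages on the next stopping cubes, whose p-th powers
   are controlled by those of f_i because i is maximizing. The form reduces to
   bilinear ones with kernel K(F, sigma_i), F being a stopping cube; Carleson's
   embedding and Hoelder's inequality, in which the sum of the 1/p_i being at
   least 1 is used, sum them up. The same splitting handles the bilinear forms:
   Sawyer testing gives each piece when 1/p_a + 1/p_b >= 1, and otherwise the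
   Wolff potential enters through the equivalence, for weights lam >= 0,
     int (sum_Q lam(Q) 1_Q)^s dw
       ~ sum_Q lam(Q) w(Q) (w(Q)^-1 sum_(S <= Q) lam(S) w(S))^(s-1).

   Necessity: indicators and duality give the Sawyer conditions, and the same
   equivalence with lam weighted by a power of a maximal function gives the
   Wolff conditions. *)
Require Import Defs.
From mathcomp Require Import all_boot all_order all_algebra all_fingroup.
From mathcomp Require Import all_classical all_reals all_analysis.
From mathcomp Require Import ring lra.
From mathcomp Require Import finmap measurable_realfun.
Set Implicit Arguments.
Unset Strict Implicit.
Unset Printing Implicit Defensive.
Import Order.TTheory GRing.Theory Num.Theory.
Import numFieldNormedType.Exports.
Local Open Scope ring_scope.

(** * Inequalities for powers and finite sums *)

(** On a finite family every quantity is a finite real, which legitimates absorption: several bounds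
    end in [X <= D * X ^ (1 - t)] and are finished by dividing by a power of [X]. Truncation suits
    the Wolff potential because only the sums are cut while the denominators keep the true measure,
    so the truncated potentials increase with the family. The stopping cubes are not built by
    recursion. The largest average over the cubes above a given one is rounded down to a power of 2,
    and the stopping cubes are the maximal cubes of the positive level sets of this function. Only
    cubes of the region where the chosen index is maximizing enter the maximum, so every stopping
    cube lies in that region and the comparison of the functions is available on it. The condition
    on the sum of the [1/p_i] is used as the nesting of sequence spaces over the stopping cubes, a
    fact about counting measure; this is why Hoelder's inequality appears for exponents whose
    reciprocals add up to at least 1. When a pair of exponents falls below 1, a genuine Hoelder
    inequality with the third exponent [r] takes its place. *)

Section powR_inequalities.
Variable R : realType.
Implicit Types (a b c p q s t x y : R).

Lemma ler_powR2r a b p : 0 <= p -> 0 <= a -> a <= b -> a `^ p <= b `^ p.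
Proof.
by move=> p0 a0 ab; apply: ge0_ler_powR; rewrite ?nnegrE//; exact: le_trans ab.
Qed.

Lemma powRK a p : p != 0 -> 0 <= a -> (a `^ p) `^ p^-1 = a.
Proof. by move=> p0 a0; rewrite -powRrM mulfV// powRr1. Qed.

Lemma powRVK a p : p != 0 -> 0 <= a -> (a `^ p^-1) `^ p = a.
Proof. by move=> p0 a0; rewrite -powRrM mulVf// powRr1. Qed.

Lemma ler_powR_root a b p : 0 < p -> 0 <= a -> 0 <= b ->
  a `^ p <= b -> a <= b `^ p^-1.
Proof.
move=> p0 a0 b0 ab; rewrite -(@powRK a p) ?gt_eqF//.
by apply: ler_powR2r; rewrite ?invr_ge0 ?powR_ge0// ltW.
Qed.

Lemma ler_root_powR a b p : 0 < p -> 0 <= a -> 0 <= b ->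
  a `^ p^-1 <= b -> a <= b `^ p.
Proof.
move=> p0 a0 b0 ab; rewrite -(@powRVK a p) ?gt_eqF//.
by apply: ler_powR2r; rewrite ?powR_ge0// ltW.
Qed.

Lemma divr_powR a b p : 0 <= a -> 0 < b -> (a / b) `^ p = a `^ p / b `^ p.
Proof.
move=> a0 b0; rewrite powRM ?invr_ge0 ?(ltW b0)//; congr (_ * _).
by rewrite -powR_inv1 ?(ltW b0)// -powRrM mulN1r powRN.
Qed.

(** Tangent bound for a convex power: after expanding, it is Young's inequality for
    [b * a ^ (s - 1)] with exponents [s] and [s / (s - 1)]. *)
Lemma powR_diff_le a b s : 1 <= s -> 0 <= b -> b <= a ->
  a `^ s - b `^ s <= s * (a - b) * a `^ (s - 1).
Proof.
move=> s1 b0 ba; have a0 := le_trans b0 ba.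
have s0 : 0 < s by exact: lt_le_trans s1.
move: s1; rewrite le_eqVlt => /predU1P[<-|s1].
  by rewrite !powRr1// subrr powRr0; lra.
have s10 : 0 < s - 1 by rewrite subr_gt0.
have q0 : 0 < s / (s - 1) by rewrite divr_gt0.
have sq : s^-1 + (s / (s - 1))^-1 = 1 by rewrite invf_div; field; rewrite !gt_eqF.
have := conjugate_powR b0 (powR_ge0 a (s - 1)) s0 q0 sq.
have -> : (a `^ (s - 1)) `^ (s / (s - 1)) = a `^ s.
  by rewrite -powRrM mulrC divfK// gt_eqF.
rewrite invf_div => h.
have : s * (b * a `^ (s - 1)) <= b `^ s + a `^ s * (s - 1).
  apply: (le_trans (ler_wpM2l (ltW s0) h)).
  by rewrite mulrDr mulrCA mulfV ?gt_eqF// mulr1 mulrCA (mulrCA s) mulfV ?gt_eqF// mulr1.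
have /= := mulr_powRB1 a0 s0.
by move=> <-; nra.
Qed.

(** If [m] is the larger of the two powers, the product is at most [m ^ (p^-1 + q^-1)], and [m <= 1]
    lets the exponent drop to 1. *)
Lemma prod2_le a b p q : 0 <= a <= 1 -> 0 <= b <= 1 -> 0 < p -> 0 < q ->
  1 <= p^-1 + q^-1 -> a * b <= a `^ p + b `^ q.
Proof.
move=> /andP[a0 a1] /andP[b0 b1] p0 q0 pq.
set m := Num.max (a `^ p) (b `^ q).
have m0 : 0 <= m by rewrite le_max powR_ge0.
have m1 : m <= 1.
  have := ler_powR2r (ltW p0) a0 a1; have := ler_powR2r (ltW q0) b0 b1.
  by rewrite !powR1 /m ge_max => -> ->.
have am : a <= m `^ p^-1 by apply: ler_powR_root => //; rewrite le_max lexx.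
have bm : b <= m `^ q^-1 by apply: ler_powR_root => //; rewrite le_max lexx orbT.
apply: (@le_trans _ _ m); last by rewrite ge_max lerDl lerDr !powR_ge0.
apply: (le_trans (ler_pM a0 b0 am bm)).
have [->|mn0] := eqVneq m 0.
  by rewrite powR0 ?mul0r// invr_eq0 gt_eqF.
rewrite -powRD; last by rewrite mn0 implybT.
by rewrite -{2}(powRr1 m0) ger_powR// m1 lt0r mn0 m0.
Qed.

Lemma prod3_le a b c p q s : 0 <= a <= 1 -> 0 <= b <= 1 -> 0 <= c <= 1 ->
  0 < p -> 0 < q -> 0 < s ->
  1 <= p^-1 + q^-1 + s^-1 -> a * b * c <= a `^ p + b `^ q + c `^ s.
Proof.
move=> /andP[a0 a1] /andP[b0 b1] /andP[c0 c1] p0 q0 s0 pq.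
set m := Num.max (a `^ p) (Num.max (b `^ q) (c `^ s)).
have m0 : 0 <= m by rewrite le_max powR_ge0.
have m1 : m <= 1.
  have := ler_powR2r (ltW p0) a0 a1; have := ler_powR2r (ltW q0) b0 b1.
  have := ler_powR2r (ltW s0) c0 c1.
  by rewrite !powR1 /m !ge_max => -> -> ->.
have am : a <= m `^ p^-1 by apply: ler_powR_root => //; rewrite le_max lexx.
have bm : b <= m `^ q^-1.
  by apply: ler_powR_root => //; rewrite !le_max lexx orbT.
have cm : c <= m `^ s^-1.
  by apply: ler_powR_root => //; rewrite !le_max lexx !orbT.
apply: (@le_trans _ _ m); last first.
  have := powR_ge0 a p; have := powR_ge0 b q; have := powR_ge0 c s.
  by rewrite !ge_max => ? ? ?; apply/and3P; split; lra.
apply: (le_trans (ler_pM (mulr_ge0 a0 b0) c0 (ler_pM a0 b0 am bm) cm)).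
have [->|mn0] := eqVneq m 0.
  by rewrite (powR0 (x := s^-1)) ?mulr0// invr_eq0 gt_eqF.
rewrite -!powRD ?mn0 ?implybT//.
by rewrite -{2}(powRr1 m0) ger_powR// m1 lt0r mn0 m0.
Qed.

End powR_inequalities.

Section finite_sum_inequalities.
Variable R : realType.

Lemma hoelder_sum (I : finType) (P : pred I) (w a b : I -> R) (p q : R) :
  (forall i, 0 <= w i) -> (forall i, 0 <= a i) -> (forall i, 0 <= b i) ->
  0 < p -> 0 < q -> p^-1 + q^-1 = 1 ->
  \sum_(i | P i) w i * (a i * b i) <=
  (\sum_(i | P i) w i * a i `^ p) `^ p^-1 *
  (\sum_(i | P i) w i * b i `^ q) `^ q^-1.
Proof.
move=> w0 a0 b0 p0 q0 pq.
move EA : (\sum_(i | P i) _ * a i `^ p) => A.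
move EB : (\sum_(i | P i) _ * b i `^ q) => B.
have A0 : 0 <= A by rewrite -EA; apply: sumr_ge0 => i _; rewrite mulr_ge0 ?powR_ge0.
have B0 : 0 <= B by rewrite -EB; apply: sumr_ge0 => i _; rewrite mulr_ge0 ?powR_ge0.
have vanish (f : I -> R) r i : 0 < r -> (forall i, 0 <= f i) ->
    \sum_(i | P i) w i * f i `^ r = 0 -> P i -> w i * f i = 0.
  move=> r0 f0 /eqP; rewrite psumr_eq0; last first.
    by move=> j _; rewrite mulr_ge0 ?powR_ge0.
  move=> /allP /(_ i (mem_index_enum _)) /implyP h Pi; move: (h Pi).
  by rewrite mulf_eq0 powR_eq0 (gt_eqF r0) andbT => /orP[]/eqP->; rewrite (mul0r, mulr0).
move: A0; rewrite le_eqVlt => /predU1P[Az|A0].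
  rewrite big1 ?mulr_ge0 ?powR_ge0// => i Pi.
  by rewrite mulrA (vanish _ p)// ?mul0r// EA.
move: B0; rewrite le_eqVlt => /predU1P[Bz|B0].
  rewrite big1 ?mulr_ge0 ?powR_ge0// => i Pi.
  by rewrite mulrCA (vanish _ q)// ?mulr0// EB.
have Ap : 0 < A `^ p^-1 by exact: powR_gt0.
have Bq : 0 < B `^ q^-1 by exact: powR_gt0.
have AB : 0 < A `^ p^-1 * B `^ q^-1 by exact: mulr_gt0 Ap Bq.
rewrite -[leRHS]mulr1 -ler_pdivrMl// mulr_sumr.
apply: (@le_trans _ _ (\sum_(i | P i)
    (w i * a i `^ p / (A * p) + w i * b i `^ q / (B * q)))); last first.
  rewrite big_split/= -!mulr_suml EA EB.
  by rewrite !invfM !mulrA !divff ?gt_eqF// !mul1r pq.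
apply: ler_sum => i Pi.
have := @conjugate_powR _ (a i / A `^ p^-1) (b i / B `^ q^-1) p q.
rewrite !divr_ge0 ?powR_ge0// => /(_ isT isT p0 q0 pq).
rewrite !divr_powR// !powRVK ?gt_eqF ?(ltW A0) ?(ltW B0)// => h.
rewrite invfM.
have -> : (A `^ p^-1)^-1 * (B `^ q^-1)^-1 * (w i * (a i * b i)) =
  w i * (a i / A `^ p^-1 * (b i / B `^ q^-1)) by ring.
apply: (le_trans (ler_wpM2l (w0 i) h)).
by rewrite mulrDr !invfM !mulrA.
Qed.

(** Hoelder's inequality with exponents [1/t] and [1/(1 - t)] against the constant 1. The
    unnormalized form remains true when the weights vanish. *)
Lemma sum_powR_jensen (I : finType) (P : pred I) (w a : I -> R) (t : R) :
  (forall i, 0 <= w i) -> (forall i, 0 <= a i) -> 0 < t -> t <= 1 ->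
  \sum_(i | P i) w i * a i `^ t <=
  (\sum_(i | P i) w i) *
    ((\sum_(i | P i) w i * a i) / \sum_(i | P i) w i) `^ t.
Proof.
move=> w0 a0 t0 t1.
set W := \sum_(i | P i) w i; set A := \sum_(i | P i) w i * a i.
have W0 : 0 <= W by exact: sumr_ge0.
have A0 : 0 <= A by apply: sumr_ge0 => i _; rewrite mulr_ge0.
move: W0; rewrite le_eqVlt => /predU1P[Wz|W0].
  rewrite -Wz mul0r big1// => i Pi.
  move/esym/eqP: Wz; rewrite psumr_eq0// => /allP /(_ i (mem_index_enum _)).
  by rewrite Pi => /eqP->; rewrite mul0r.
move: t1; rewrite le_eqVlt => /predU1P[->|t1].
  rewrite powRr1 ?divr_ge0 ?(ltW W0)// mulrCA divff ?gt_eqF// mulr1.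
  by under eq_bigr do rewrite powRr1//.
have q0 : 0 < (1 - t)^-1 by rewrite invr_gt0 subr_gt0.
have pq : (t^-1)^-1 + ((1 - t)^-1)^-1 = 1 by rewrite !invrK; ring.
have ti : 0 < t^-1 by rewrite invr_gt0.
have := @hoelder_sum I P w (fun i => a i `^ t) (fun=> 1) _ _ w0
  (fun i => powR_ge0 _ _) (fun=> ler01) ti q0 pq.
under eq_bigr do rewrite mulr1.
under [in X in _ <= X -> _]eq_bigr do rewrite powRK ?gt_eqF//.
under [X in _ <= _ * X `^ _ -> _]eq_bigr do rewrite powR1 mulr1.
rewrite -/A -/W !invrK => /le_trans; apply.
rewrite divr_powR// powRB; last by rewrite gt_eqF// implybT.
by rewrite powRr1 ?(ltW W0)// mulrCA.
Qed.

(** For counting measure a single term is bounded by the whole sum, so [a i / A] and [b i / B] lie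
    in the unit interval and [prod2_le] applies termwise. The two normalized sums give the constant
    2. *)
Lemma hoelder2_seq (I : finType) (P : pred I) (a b : I -> R) (p q A B : R) :
  0 < p -> 0 < q -> 1 <= p^-1 + q^-1 -> 0 < A -> 0 < B ->
  (forall i, P i -> 0 <= a i) -> (forall i, P i -> 0 <= b i) ->
  \sum_(i | P i) a i `^ p <= A `^ p -> \sum_(i | P i) b i `^ q <= B `^ q ->
  \sum_(i | P i) a i * b i <= 2 * (A * B).
Proof.
move=> p0 q0 pq A0 B0 a0 b0 aA bB.
have le1 (f : I -> R) r F : 0 < r -> 0 < F -> (forall i, P i -> 0 <= f i) ->
    \sum_(i | P i) f i `^ r <= F `^ r -> forall i, P i -> 0 <= f i / F <= 1.
  move=> r0 F0 f0 fF i Pi; rewrite divr_ge0 ?f0 ?(ltW F0)//= ler_pdivrMr// mul1r.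
  rewrite -(@powRK _ F r) ?gt_eqF ?(ltW F0)//; apply: ler_powR_root => //.
  - exact: f0.
  - exact: powR_ge0.
  apply: le_trans fF; rewrite (bigD1 i)//= lerDl.
  by apply: sumr_ge0 => *; rewrite powR_ge0.
rewrite -ler_pdivrMr ?mulr_gt0// mulr_suml.
apply: (@le_trans _ _
  (\sum_(i | P i) (a i `^ p / A `^ p + b i `^ q / B `^ q))).
  apply: ler_sum => i Pi; rewrite invfM mulrACA.
  apply: (le_trans (prod2_le (le1 _ _ _ p0 A0 a0 aA i Pi)
    (le1 _ _ _ q0 B0 b0 bB i Pi) p0 q0 pq)).
  by rewrite !divr_powR ?a0 ?b0.
rewrite big_split/= -!mulr_suml.
have : (\sum_(i | P i) a i `^ p) / A `^ p <= 1.
  by rewrite ler_pdivrMr ?powR_gt0// mul1r.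
have : (\sum_(i | P i) b i `^ q) / B `^ q <= 1.
  by rewrite ler_pdivrMr ?powR_gt0// mul1r.
lra.
Qed.

Lemma hoelder3_seq (I : finType) (P : pred I) (a b c : I -> R)
    (p q r A B C : R) :
  0 < p -> 0 < q -> 0 < r -> 1 <= p^-1 + q^-1 + r^-1 ->
  0 < A -> 0 < B -> 0 < C ->
  (forall i, P i -> 0 <= a i) -> (forall i, P i -> 0 <= b i) ->
  (forall i, P i -> 0 <= c i) ->
  \sum_(i | P i) a i `^ p <= A `^ p -> \sum_(i | P i) b i `^ q <= B `^ q ->
  \sum_(i | P i) c i `^ r <= C `^ r ->
  \sum_(i | P i) a i * b i * c i <= 3 * (A * B * C).
Proof.
move=> p0 q0 r0 pq A0 B0 C0 a0 b0 c0 aA bB cC.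
have le1 (f : I -> R) r' F : 0 < r' -> 0 < F -> (forall i, P i -> 0 <= f i) ->
    \sum_(i | P i) f i `^ r' <= F `^ r' -> forall i, P i -> 0 <= f i / F <= 1.
  move=> r'0 F0 f0 fF i Pi.
  rewrite divr_ge0 ?f0 ?(ltW F0)//= ler_pdivrMr// mul1r.
  rewrite -(@powRK _ F r') ?gt_eqF ?(ltW F0)//; apply: ler_powR_root => //.
  - exact: f0.
  - exact: powR_ge0.
  apply: le_trans fF; rewrite (bigD1 i)//= lerDl.
  by apply: sumr_ge0 => *; rewrite powR_ge0.
rewrite -ler_pdivrMr ?mulr_gt0// mulr_suml.
apply: (@le_trans _ _ (\sum_(i | P i)
    (a i `^ p / A `^ p + b i `^ q / B `^ q + c i `^ r / C `^ r))).
  apply: ler_sum => i Pi; rewrite !invfM mulrACA (mulrACA (a i)).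
  apply: (le_trans (prod3_le (le1 _ _ _ p0 A0 a0 aA i Pi)
    (le1 _ _ _ q0 B0 b0 bB i Pi) (le1 _ _ _ r0 C0 c0 cC i Pi) p0 q0 r0 pq)).
  by rewrite !divr_powR ?a0 ?b0 ?c0.
rewrite !big_split/= -!mulr_suml.
have : (\sum_(i | P i) a i `^ p) / A `^ p <= 1.
  by rewrite ler_pdivrMr ?powR_gt0// mul1r.
have : (\sum_(i | P i) b i `^ q) / B `^ q <= 1.
  by rewrite ler_pdivrMr ?powR_gt0// mul1r.
have : (\sum_(i | P i) c i `^ r) / C `^ r <= 1.
  by rewrite ler_pdivrMr ?powR_gt0// mul1r.
lra.
Qed.

(** Induction on the set, removing the largest value: by separation all others are at most half of
    it. The constant [C] solves [1 + C * 2 ^ (- q) = C]. *)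
Lemma geometric_sum_le (I : finType) (v : I -> R) (q V : R) (A : {set I}) :
  0 < q -> (forall i, i \in A -> 0 <= v i) -> 0 <= V ->
  (forall i, i \in A -> v i <= V) ->
  (forall i j, i \in A -> j \in A -> i != j -> 2 * v i <= v j \/ 2 * v j <= v i) ->
  \sum_(i in A) v i `^ q <= (1 - 2 `^ (- q))^-1 * V `^ q.
Proof.
move=> q0.
have h1 : 0 < 1 - 2 `^ (- q) :> R.
  rewrite subr_gt0 powRN invf_lt1 ?powR_gt0//.
  have := @gt0_ltr_powR R q q0 1 2; rewrite !nnegrE powR1 => h.
  by apply: h; rewrite ?ler01 ?ler0n ?ltr1n.
have [k] := ubnP #|A|; elim: k A V => // k IH A V; rewrite ltnS => Ak v0 V0 vV sep.
have [->|[i0 i0A]] := set_0Vmem A.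
  by rewrite big_set0 mulr_ge0 ?powR_ge0// invr_ge0 ltW.
pose m := [arg max_(i > i0 in A) v i]%O.
have [mA mmax] : m \in A /\ forall j, j \in A -> v j <= v m.
  by rewrite /m; case: arg_maxP => // i iA h; split=> // j /h.
have half j : j \in A :\ m -> v j <= v m / 2.
  rewrite !inE => /andP[jm jA]; rewrite ler_pdivlMr// mulrC.
  by case: (sep j m jA mA jm) => // h; have := mmax _ jA; have := v0 _ mA; lra.
rewrite (big_setD1 m)//=.
have IHm : \sum_(i in A :\ m) v i `^ q <=
    (1 - 2 `^ (- q))^-1 * (v m / 2) `^ q.
  apply: IH => //.
  - by rewrite (cardsD1 m) mA in Ak.
  - by move=> i; rewrite !inE => /andP[_ /v0].
  - by rewrite divr_ge0// v0.
  - by move=> i j; rewrite !inE => /andP[_ iA] /andP[_ jA]; exact: sep.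
apply: (le_trans (lerD (lexx _) IHm)).
rewrite divr_powR ?v0// -powRN.
have -> : v m `^ q + (1 - 2 `^ (- q))^-1 * (v m `^ q * 2 `^ (- q)) =
    (1 - 2 `^ (- q))^-1 * v m `^ q by field; rewrite gt_eqF.
rewrite ler_wpM2l ?invr_ge0 ?(ltW h1)//.
by apply: ler_powR2r; rewrite ?v0 ?vV// ltW.
Qed.

(** Summation by parts along a chain: removing the [r]-greatest element [m] lowers the power of the
    sum by at most [s * lam m] times the total to the [s - 1]. The order is a parameter because
    chains of cubes are summed in both directions. *)
Lemma powR_sum_chain (I : finType) (r : rel I) (lam : I -> R) (s : R)
    (A : {set I}) :
  1 <= s -> (forall i, 0 <= lam i) -> transitive r -> antisymmetric r ->
  (forall i j, i \in A -> j \in A -> r i j || r j i) ->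
  (\sum_(i in A) lam i) `^ s <=
  s * \sum_(i in A) lam i * (\sum_(j in A | r j i) lam j) `^ (s - 1).
Proof.
move=> s1 lam0 rt ra.
have [k] := ubnP #|A|; elim: k A => // k IH A; rewrite ltnS => Ak tot.
have s0 : 0 < s by exact: lt_le_trans s1.
have [->|[i0 i0A]] := set_0Vmem A.
  by rewrite !big_set0 powR0 ?gt_eqF// mulr0.
pose m := [arg max_(i > i0 in A) #|[set j in A | r j i]|].
have [mA mtop] : m \in A /\ forall j, j \in A -> r j m.
  rewrite /m; case: arg_maxnP => // i iA h; split => // j jA.
  case/orP: (tot _ _ jA iA) => // ij.
  have sub : [set k in A | r k i] \subset [set k in A | r k j].
    apply/fintype.subsetP => l; rewrite !inE => /andP[-> /=] /rt; exact.
  have /eqP e : [set k in A | r k i] == [set k in A | r k j].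
    by rewrite eqEcard sub/=; exact: h.
  have : j \in [set k in A | r k j].
    by rewrite !inE jA /=; case/orP: (tot _ _ jA jA).
  by rewrite -e inE => /andP[].
have IHm : (\sum_(i in A :\ m) lam i) `^ s <=
   s * \sum_(i in A :\ m) lam i * (\sum_(j in A :\ m | r j i) lam j) `^ (s - 1).
  apply: IH; first by rewrite (cardsD1 m) mA in Ak.
  by move=> i j; rewrite !inE => /andP[_ iA] /andP[_ jA]; exact: tot.
have eqA : \sum_(j in A | r j m) lam j = \sum_(j in A) lam j.
  by apply: eq_bigl => j; case: (boolP (j \in A)) => //= /mtop->.
have eqB : \sum_(i in A :\ m) lam i * (\sum_(j in A | r j i) lam j) `^ (s - 1)
    = \sum_(i in A :\ m) lam i * (\sum_(j in A :\ m | r j i) lam j) `^ (s - 1).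
  apply: eq_bigr => i; rewrite !inE => /andP[im iA]; congr (_ * _ `^ _).
  apply: eq_bigl => j; rewrite !inE; have [->|//] := eqVneq j m.
  rewrite mA/=; apply/negbTE/negP => mi.
  by move/eqP: im; apply; apply: ra; rewrite mtop.
rewrite [X in _ <= s * X](big_setD1 m)//= eqA eqB mulrDr.
have e : \sum_(j in A) lam j = lam m + \sum_(j in A :\ m) lam j.
  by rewrite (big_setD1 m).
have := @powR_diff_le _ (\sum_(j in A) lam j) (\sum_(j in A :\ m) lam j) s s1.
rewrite sumr_ge0// e lerDr lam0 addrK => /(_ isT isT) h.
by rewrite mulrA; lra.
Qed.

(** The largest power of 2 not exceeding [z]. The value 0 at [z <= 0] will mark the cubes above
    which no average is positive. *)
Definition dyadic_floor (z : R) : R :=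
  if 0 < z then 2 `^ (Num.floor (ln z / ln 2))%:~R else 0.

Lemma dyadic_floor_ge0 z : 0 <= dyadic_floor z.
Proof. by rewrite /dyadic_floor; case: ifP => // _; exact: powR_ge0. Qed.

Lemma dyadic_floor_gt0 z : (0 < dyadic_floor z) = (0 < z).
Proof. by rewrite /dyadic_floor; case: ifP => z0; rewrite ?powR_gt0 ?ltxx. Qed.

Lemma dyadic_floor_itv z : 0 <= z -> dyadic_floor z <= z <= 2 * dyadic_floor z.
Proof.
rewrite le_eqVlt /dyadic_floor => /predU1P[<-|z0]; first by rewrite ltxx mulr0 lexx.
have l2 : 0 < ln (2 : R) by rewrite ln_gt0// ltr1n.
rewrite z0; set k := Num.floor _.
have E : z = 2 `^ (ln z / ln 2).
  by rewrite /powR gt_eqF// divfK ?gt_eqF// lnK.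
have -> : 2 * 2 `^ k%:~R = 2 `^ (k + 1)%:~R :> R.
  by rewrite intrD powRD ?pnatr_eq0 ?implybT// powRr1// mulrC.
have h1 : (1 : R) <= 2 by rewrite ler1n.
rewrite E; apply/andP; split; apply: ler_powR => //; first exact: floor_le.
exact/ltW/floorD1_gt.
Qed.

Lemma dyadic_floor_sep y z : 0 < y -> 0 < z ->
  dyadic_floor y != dyadic_floor z ->
  2 * dyadic_floor y <= dyadic_floor z \/ 2 * dyadic_floor z <= dyadic_floor y.
Proof.
rewrite /dyadic_floor => -> ->; move: (Num.floor _) (Num.floor _) => k l kl.
have h1 : (1 : R) <= 2 by rewrite ler1n.
have H (i j : int) : i < j -> 2 * 2 `^ i%:~R <= 2 `^ j%:~R :> R.
  move=> ij; have -> : 2 * 2 `^ i%:~R = 2 `^ (i + 1)%:~R :> R.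
    by rewrite intrD powRD ?pnatr_eq0 ?implybT// powRr1// mulrC.
  by rewrite ler_powR// ler_int lezD1.
by case: (ltgtP l k) kl => [/H|/H|->]; [left|right|rewrite eqxx].
Qed.

Lemma dyadic_floor_le y z : y <= z -> dyadic_floor y <= dyadic_floor z.
Proof.
move=> yz; have [y0|y0] := ltP 0 y; last first.
  by rewrite {1}/dyadic_floor ltNge y0/= dyadic_floor_ge0.
have z0 := lt_le_trans y0 yz.
have h1 : (1 : R) <= 2 by rewrite ler1n.
rewrite /dyadic_floor y0 z0 ler_powR// ler_int le_floor// ler_pM2r ?invr_gt0 ?ln_gt0 ?ltr1n//.
by rewrite ler_ln.
Qed.

End finite_sum_inequalities.

(** * Forests and stopping cubes *)

Record forest (T : finType) (le : rel T) : Prop := Forest {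
  forest_refl : reflexive le;
  forest_trans : transitive le;
  forest_anti : antisymmetric le;
  forest_laminar : forall x a b, le x a -> le x b -> le a b || le b a }.

Section forest_sums.
Variables (R : realType) (T : finType) (le : rel T).

(* An element of [T] stands both for a cube and for its atom, the part of the
   cube outside the smaller ones; [w] and [f] live on the atoms. *)
Definition mass (w : T -> R) Q := \sum_(x | le x Q) w x.
Definition integ (w f : T -> R) Q := \sum_(x | le x Q) w x * f x.
Definition avg (w f : T -> R) Q := integ w f Q / mass w Q.
Definition pnorm (w : T -> R) (p : R) (f : T -> R) := \sum_x w x * f x `^ p.

Section nonneg.
Variables (w f : T -> R).
Hypotheses (w0 : forall x, 0 <= w x) (f0 : forall x, 0 <= f x).

Lemma mass_ge0 Q : 0 <= mass w Q. Proof. exact: sumr_ge0. Qed.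

Lemma integ_ge0 Q : 0 <= integ w f Q.
Proof. by apply: sumr_ge0 => x _; rewrite mulr_ge0. Qed.

Lemma avg_ge0 Q : 0 <= avg w f Q.
Proof. by rewrite divr_ge0 ?integ_ge0 ?mass_ge0. Qed.

Lemma pnorm_ge0 p : 0 <= pnorm w p f.
Proof. by apply: sumr_ge0 => x _; rewrite mulr_ge0 ?powR_ge0. Qed.

Lemma mass_eq0 Q x : mass w Q = 0 -> le x Q -> w x = 0.
Proof.
move/eqP; rewrite psumr_eq0// => /allP /(_ x (mem_index_enum _)) /implyP h xQ.
exact/eqP/h.
Qed.

Lemma avg_mass Q : avg w f Q * mass w Q = integ w f Q.
Proof.
have [m0|m0] := eqVneq (mass w Q) 0; last by rewrite /avg divfK.
rewrite m0 mulr0 /integ big1// => x xQ.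
by rewrite (mass_eq0 m0 xQ) mul0r.
Qed.

End nonneg.

Lemma mass_pos_integral (w g : T -> R) : \sum_Q mass w Q * g Q =
  \sum_x w x * \sum_(Q | le x Q) g Q.
Proof.
under eq_bigr do rewrite mulr_suml.
rewrite (exchange_big_dep xpredT)//=.
by apply: eq_bigr => x _; rewrite mulr_sumr.
Qed.

Lemma sum_mass_cond (w g : T -> R) (P : pred T) :
  \sum_(Q | P Q) mass w Q * g Q = \sum_x w x * \sum_(Q | P Q && le x Q) g Q.
Proof.
under eq_bigr do rewrite mulr_suml.
rewrite (exchange_big_dep xpredT)//=.
by apply: eq_bigr => x _; rewrite mulr_sumr.
Qed.

Lemma sum_integ_cond (w f g : T -> R) (P : pred T) :
  \sum_(Q | P Q) integ w f Q * g Q =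
  \sum_x w x * f x * \sum_(Q | P Q && le x Q) g Q.
Proof.
under eq_bigr do rewrite mulr_suml.
rewrite (exchange_big_dep xpredT)//=.
by apply: eq_bigr => x _; rewrite mulr_sumr.
Qed.

Lemma sum_unique_le (P : pred T) (c : R) : 0 <= c ->
  (forall i j, P i -> P j -> i = j) -> \sum_(i | P i) c <= c.
Proof.
move=> c0 Pu; case: (pickP P) => [i Pi|P0]; last by rewrite big_pred0.
rewrite (big_pred1 i)// => j; apply/idP/eqP => [Pj|->//]; exact: Pu.
Qed.

Hypothesis leF : forest le.
Let lexx : reflexive le := forest_refl leF.
Let le_tr : transitive le := forest_trans leF.
Let le_as : antisymmetric le := forest_anti leF.

(** The number of elements below is strictly increasing along [le], so maximizing it selects an
    element maximal for [le]. All choices of maximal cubes are made in this way. *)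
Lemma card_down_eq Q S : le Q S ->
  (#|[pred x | le x S]| <= #|[pred x | le x Q]|)%N -> S = Q.
Proof.
move=> QS c; have sub : [pred x | le x Q] \subset [pred x | le x S].
  by apply/fintype.subsetP => x; rewrite !inE => /le_tr; exact.
have /subset_leqif_card[_ e] := sub.
have : [pred x | le x S] \subset [pred x | le x Q].
  by rewrite -e eqn_leq c subset_leq_card.
move=> /fintype.subsetP /(_ S); rewrite !inE lexx => /(_ isT) SQ.
by apply: le_as; rewrite SQ.
Qed.

Section corona.
Variables (a : T -> R) (P : pred T).

Definition maxavg Q := \big[Num.max/0]_(S | P S && le Q S) a S.

(* [lvl Q] rounds the largest [a S] with [S] above [Q] and in [P] down to a
   power of 2; the coronas are the connected pieces of its level sets. *)
Definition lvl Q := dyadic_floor (maxavg Q).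

Definition top Q :=
  [arg max_(S > Q | le Q S && (lvl S == lvl Q)) #|[pred x | le x S]|].

Definition stop F := (0 < lvl F) && (top F == F).

(** For [x] below [F] but outside its level set, this is the largest cube over [x], within [F], on
    which the level has already changed; it is the next stopping cube by [stop_child]. For other [x]
    the value is arbitrary. *)
Definition child F x :=
  [arg max_(S > x | [&& le x S, le S F & lvl S != lvl F])
    #|[pred x | le x S]|].

(** The form sees [f] only through integrals over the cubes of the corona of [F]. These do not
    change when [f] is averaged over the next stopping cubes, whereas the norms become summable over
    [F]. *)
Definition loc (w f : T -> R) F x :=
  if ~~ le x F then 0 else
  if lvl x == lvl F then f x else avg w f (child F x).

Lemma maxavg_ge0 Q : 0 <= maxavg Q.
Proof. by apply: bigmax_ge_id. Qed.

Lemma maxavg_anti Q S : le Q S -> maxavg S <= maxavg Q.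
Proof.
move=> QS; apply/bigmax_leP; split; first exact: maxavg_ge0.
move=> U /andP[PU SU]; apply: (@le_bigmax_cond _ _ _ _ U) => //.
by rewrite PU (le_tr QS).
Qed.

Lemma le_maxavg Q S : P S -> le Q S -> a S <= maxavg Q.
Proof. by move=> PS QS; apply: (@le_bigmax_cond _ _ _ _ S); rewrite ?PS. Qed.

Lemma maxavg_attained Q : 0 < maxavg Q ->
  exists S, [/\ P S, le Q S & a S = maxavg Q].
Proof.
have : maxavg Q = 0 \/ exists S, [/\ P S, le Q S & a S = maxavg Q].
  rewrite /maxavg; apply: (big_ind (fun m => m = 0 \/ exists S, [/\ P S, le Q S & a S = m])) => [|x y hx hy|S /andP[PS QS]]; first by left.
    by case: (leP x y).
  by right; exists S.
by case=> [->|//]; rewrite ltxx.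
Qed.

Lemma lvl_ge0 Q : 0 <= lvl Q. Proof. exact: dyadic_floor_ge0. Qed.

Lemma lvl_anti Q S : le Q S -> lvl S <= lvl Q.
Proof. by move=> QS; apply/dyadic_floor_le/maxavg_anti. Qed.

Lemma lvl_sep Q S : 0 < lvl Q -> 0 < lvl S -> lvl Q != lvl S ->
  2 * lvl Q <= lvl S \/ 2 * lvl S <= lvl Q.
Proof. by rewrite !dyadic_floor_gt0; exact: dyadic_floor_sep. Qed.

Lemma le_lvl Q : P Q -> a Q <= 2 * lvl Q.
Proof.
move=> PQ; apply: (le_trans (le_maxavg PQ (lexx Q))).
by have /andP[] := dyadic_floor_itv (maxavg_ge0 Q).
Qed.

Lemma topP Q : [/\ le Q (top Q), lvl (top Q) = lvl Q &
  forall S, le (top Q) S -> lvl S = lvl Q -> S = top Q].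
Proof.
rewrite /top; case: arg_maxnP => [|F /andP[QF /eqP lF] Fmax]; first by rewrite lexx/=.
split => // S FS lS; apply: card_down_eq => //; apply: Fmax.
by rewrite lS eqxx (le_tr QF).
Qed.

Lemma stop_top Q : 0 < lvl Q -> stop (top Q).
Proof.
move=> l0; have [QF lF Fmax] := topP Q; have [FF' lF' _] := topP (top Q).
by rewrite /stop lF l0/=; apply/eqP/Fmax; rewrite ?lF'.
Qed.

(** A cube [S] above [F] that attains [maxavg F] has the same level as [F], hence is [F] itself
    because [F] is maximal in its level set. *)
Lemma stopP F : stop F -> [/\ 0 < lvl F, P F & lvl F <= a F].
Proof.
move=> /andP[l0 /eqP tF]; have [_ _ Fmax] := topP F.
move: (l0); rewrite {1}/lvl dyadic_floor_gt0 => m0.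
have [S [PS FS aS]] := maxavg_attained m0.
have lS : lvl S = lvl F.
  apply/eqP; rewrite eq_le lvl_anti//=; apply: dyadic_floor_le.
  by rewrite -aS le_maxavg.
have SF : S = F by rewrite -[RHS]tF; apply: Fmax; rewrite ?tF.
split => //; first by rewrite -SF.
by rewrite -{2}SF aS; have /andP[] := dyadic_floor_itv (maxavg_ge0 F).
Qed.

(** Cubes over a common [x] are comparable, and both are maximal in the same level set. Thus the
    stopping cubes over [x] have distinct powers of 2 as levels. *)
Lemma stop_inj x F F' : stop F -> stop F' -> le x F -> le x F' ->
  lvl F = lvl F' -> F = F'.
Proof.
move=> /andP[_ /eqP tF] /andP[_ /eqP tF'] xF xF' l.
have [_ _ M] := topP F; have [_ _ M'] := topP F'; rewrite tF in M; rewrite tF' in M'.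
by case/orP: (forest_laminar leF xF xF') => h; [rewrite [RHS](M _ h)|rewrite (M' _ h)].
Qed.

Lemma top_eq x F : stop F -> le x F -> lvl x = lvl F -> top x = F.
Proof.
move=> sF xF l; have [xt lt _] := topP x; have [l0 _ _] := stopP sF.
by apply: (@stop_inj x); rewrite ?lt// stop_top// l.
Qed.

Lemma childP F x : le x F -> lvl x != lvl F ->
  [/\ le x (child F x), le (child F x) F, lvl (child F x) != lvl F &
   forall S, le (child F x) S -> le S F -> lvl S != lvl F -> S = child F x].
Proof.
move=> xF lx; rewrite /child; case: arg_maxnP => [|C /and3P[xC CF lC] Cmax].
  by rewrite lexx xF.
split => // S CS SF lS; apply: card_down_eq => //; apply: Cmax.
by rewrite lS SF (le_tr xC).
Qed.

Lemma child_eq F x y : le x F -> lvl x != lvl F -> le y (child F x) ->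
  [/\ le y F, lvl y != lvl F & child F y = child F x].
Proof.
move=> xF lx yC; have [xC CF lC Cmax] := childP xF lx.
have yF := le_tr yC CF.
have ly : lvl y != lvl F.
  have h1 := lvl_anti yC; have h2 := lvl_anti CF.
  by rewrite gt_eqF// (lt_le_trans _ h1)// lt_neqAle eq_sym lC.
have [yD DF lD Dmax] := childP yF ly; split => //.
by case/orP: (forest_laminar leF yC yD) => h; [rewrite (Cmax _ h)|rewrite [RHS](Dmax _ h)].
Qed.

(** Levels grow downwards, so the top of the child's level set cannot reach above [F]; it lies
    between the child and [F], where the child is already maximal. *)
Lemma stop_child F x : stop F -> le x F -> lvl x != lvl F -> stop (child F x).
Proof.
move=> sF xF lx; have [l0 _ _] := stopP sF.
have [xC CF lC Cmax] := childP xF lx.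
have lFC : lvl F < lvl (child F x) by rewrite lt_neqAle eq_sym lC lvl_anti.
have [Ct lt _] := topP (child F x).
rewrite /stop (lt_trans l0 lFC)/=; apply/eqP; apply: Cmax => //; rewrite ?lt//.
case/orP: (forest_laminar leF CF Ct) => // h.
by have := lvl_anti h; rewrite lt leNgt lFC.
Qed.

Section localization.
Variables (w f : T -> R).
Hypotheses (w0 : forall x, 0 <= w x) (f0 : forall x, 0 <= f x).

Lemma loc_ge0 F x : 0 <= loc w f F x.
Proof. by rewrite /loc; case: ifP => // _; case: ifP => // _; exact: avg_ge0. Qed.

(** The atoms of [Q] outside the corona of [F] are grouped by their child cubes, on each of which
    averaging keeps the integral. *)
Lemma loc_integ F Q : le Q F -> lvl Q = lvl F ->
  integ w (loc w f F) Q = integ w f Q.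
Proof.
move=> QF lQ; rewrite /integ.
rewrite (bigID (fun x => lvl x == lvl F))/= [RHS](bigID (fun x => lvl x == lvl F))/=.
congr (_ + _).
  by apply: eq_bigr => x /andP[xQ lx]; rewrite /loc lx (le_tr xQ QF).
(* The child fits inside [Q]: if it contained [Q], it would lie between two cubes of the level of
   [F] and share that level. *)
have sub x : le x Q -> lvl x != lvl F -> le (child F x) Q.
  move=> xQ lx; have [xC CF lC Cmax] := childP (le_tr xQ QF) lx.
  case/orP: (forest_laminar leF xC xQ) => // /lvl_anti h.
  have := lvl_anti CF; rewrite -lQ => h'; move: lC; rewrite -lQ.
  by rewrite eq_le h h'.
rewrite (partition_big (child F) xpredT)//= [RHS](partition_big (child F) xpredT)//=.
apply: eq_bigr => S _.
case: (pickP (fun x => (le x Q && (lvl x != lvl F)) && (child F x == S))); last first.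
  by move=> e; rewrite !big_pred0.
move=> y /andP[/andP[yQ ly] /eqP yS].
have E : (fun x => (le x Q && (lvl x != lvl F)) && (child F x == S)) =1
    (fun x => le x S).
  move=> x; apply/idP/idP => [/andP[/andP[xQ lx] /eqP<-]|xS].
    by have [] := childP (le_tr xQ QF) lx.
  rewrite -yS in xS; have [xF lx ->] := child_eq (le_tr yQ QF) ly xS.
  by rewrite lx yS eqxx (le_tr xS)//= sub.
rewrite !(eq_bigl _ _ E) -/(integ w f S) -(avg_mass _ w0) /mass mulr_sumr.
apply: eq_bigr => x xS; rewrite mulrC; congr (_ * _).
have := E x; rewrite xS => /andP[/andP[xQ lx] /eqP cx].
by rewrite /loc (le_tr xQ QF)/= (negPf lx) cx.
Qed.

(** An atom keeps the value of [f] for at most one stopping cube, which yields the norm of [f]. A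
    stopping cube [S] is the child of at most one [F]: of two comparable candidates with different
    levels, the smaller would itself be the child of the larger. *)
Lemma sum_loc_pnorm (p : R) : 0 < p ->
  \sum_(F | stop F) pnorm w p (loc w f F) <=
  pnorm w p f + \sum_(F | stop F) mass w F * avg w f F `^ p.
Proof.
move=> p0.
have split1 F : pnorm w p (loc w f F) =
    \sum_(x | le x F && (lvl x == lvl F)) w x * f x `^ p +
    \sum_(x | le x F && (lvl x != lvl F)) w x * avg w f (child F x) `^ p.
  rewrite /pnorm (bigID (fun x => le x F))/= [X in _ + X]big1 ?addr0; last first.
    by move=> x xF; rewrite /loc xF powR0 ?mulr0// gt_eqF.
  rewrite (bigID (fun x => lvl x == lvl F))/=; congr (_ + _).
    by apply: eq_bigr => x /andP[xF lx]; rewrite /loc xF lx.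
  by apply: eq_bigr => x /andP[xF lx]; rewrite /loc xF (negPf lx).
under eq_bigr do rewrite split1.
rewrite big_split/=; apply: lerD.
  rewrite (exchange_big_dep xpredT)//=; apply: ler_sum => x _.
  apply: sum_unique_le; first by rewrite mulr_ge0 ?powR_ge0.
  move=> F F' /andP[sF /andP[xF /eqP lF]] /andP[sF' /andP[xF' /eqP lF']].
  by rewrite -(top_eq sF xF lF) (top_eq sF' xF' lF').
pose ch F S := [exists x, [&& le x F, lvl x != lvl F & child F x == S]].
have step F : stop F ->
    \sum_(x | le x F && (lvl x != lvl F)) w x * avg w f (child F x) `^ p <=
    \sum_(S | ch F S) mass w S * avg w f S `^ p.
  move=> sF; rewrite (partition_big (child F) (ch F))/=; last first.
    by move=> x /andP[xF lx]; apply/existsP; exists x; rewrite xF lx eqxx.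
  apply: ler_sum => S _; rewrite mulr_suml.
  rewrite [leRHS](bigID (fun x => (le x F && (lvl x != lvl F)) && (child F x == S)))/=.
  rewrite -[leLHS]addr0; apply: lerD; last first.
    by apply: sumr_ge0 => x _; rewrite mulr_ge0 ?powR_ge0.
  rewrite le_eqVlt; apply/orP; left; apply/eqP.
  apply: eq_big => [x|x /andP[_ /eqP->]//].
  apply/idP/andP => [h|[_ ->//]]; split=> //.
  by move: h => /andP[/andP[xF lx] /eqP<-]; have [] := childP xF lx.
apply: (le_trans (ler_sum _ step)).
rewrite (exchange_big_dep stop)/=; last first.
  by move=> F S sF /existsP[x /and3P[xF lx /eqP<-]]; exact: stop_child.
apply: ler_sum => S sS; apply: sum_unique_le.
  by rewrite mulr_ge0 ?powR_ge0 ?mass_ge0.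
move=> F F' /andP[sF /existsP[x /and3P[xF lx /eqP xS]]].
move=> /andP[sF' /existsP[x' /and3P[xF' lx' /eqP xS']]].
have [_ SF lS Smax] := childP xF lx; have [_ SF' lS' Smax'] := childP xF' lx'.
rewrite xS in SF lS Smax; rewrite xS' in SF' lS' Smax'.
have [/(stop_inj sF sF' SF SF')//|ll] := eqVneq (lvl F) (lvl F').
case/orP: (forest_laminar leF SF SF') => h.
  by move: lS; rewrite (Smax' _ SF h ll) eqxx.
by move: lS'; rewrite (Smax _ SF' h) ?eqxx// eq_sym.
Qed.

End localization.

Lemma sum_stop_powR x (q : R) : 0 < q ->
  \sum_(F | stop F && le x F) lvl F `^ q <= (1 - 2 `^ (- q))^-1 * lvl x `^ q.
Proof.
move=> q0.
rewrite (eq_bigl [in [set F | stop F && le x F]]%SET) => [|F]; last by rewrite inE.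
apply: geometric_sum_le => //; try by move=> *; exact: lvl_ge0.
  by move=> F; rewrite !inE => /andP[_ /lvl_anti].
move=> F F'; rewrite !inE => /andP[sF xF] /andP[sF' xF'] FF'.
have [l0 _ _] := stopP sF; have [l0' _ _] := stopP sF'.
apply: lvl_sep => //; apply: contra FF' => /eqP l; apply/eqP.
exact: (@stop_inj x).
Qed.

End corona.

(** * Carleson embedding and the dyadic maximal inequality *)

Section carleson.
Variables (w f : T -> R) (P : pred T) (p : R).
Hypotheses (w0 : forall x, 0 <= w x) (f0 : forall x, 0 <= f x) (p1 : 1 < p).

Let a := avg w f.
Let a0 := avg_ge0 w0 f0.

Lemma sum_lvl_le_stop : \sum_x w x * lvl a P x `^ p <=
  \sum_(F | stop a P F) mass w F * lvl a P F `^ p.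
Proof.
have p0 : 0 < p by exact: lt_trans p1.
rewrite sum_mass_cond; apply: ler_sum => x _; rewrite ler_wpM2l//.
have [xt lt _] := topP a P x.
have := lvl_ge0 a P x; rewrite le_eqVlt => /predU1P[<-|l0].
  by rewrite powR0 ?gt_eqF// sumr_ge0// => *; exact: powR_ge0.
rewrite (bigD1 (top a P x))/= ?stop_top//= lt lerDl.
by apply: sumr_ge0 => *; exact: powR_ge0.
Qed.

(** The sum of the geometric series of the levels to the power [p - 1], raised to the power [p] by
    the Young inequality that absorbs the left-hand side. *)
Definition carleson_const := (1 - 2 `^ (- (p - 1)))^-1 `^ p :> R.

(* The sum is bounded by a multiple of [|f| S^(1/p')], [S] being the sum
   itself, because the levels grow geometrically along the stopping cubes. *)
Lemma carleson : \sum_(F | stop a P F) mass w F * lvl a P F `^ p <=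
  carleson_const * pnorm w p f.
Proof.
have p0 : 0 < p by exact: lt_trans p1.
have q0 : 0 < p - 1 by rewrite subr_gt0.
set S := \sum_(F | stop a P F) _; set C := (1 - 2 `^ (- (p - 1)))^-1.
have C0 : 0 <= C.
  by rewrite invr_ge0 subr_ge0 -[leRHS](powRr0 2) ler_powR ?ler1n// oppr_le0 ltW.
have h1 : S <= \sum_x w x * (C * f x * lvl a P x `^ (p - 1)).
  apply: (@le_trans _ _ (\sum_(F | stop a P F) integ w f F * lvl a P F `^ (p - 1))).
    apply: ler_sum => F sF; have [l0 _ lF] := stopP sF.
    rewrite -(avg_mass _ w0) -(mulr_powRB1 (lvl_ge0 a P F) p0) mulrA.
    by rewrite ler_wpM2r ?powR_ge0// mulrC ler_wpM2r ?mass_ge0.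
  rewrite sum_integ_cond; apply: ler_sum => x _.
  rewrite -!mulrA ler_wpM2l// mulrCA ler_wpM2l//.
  exact: sum_stop_powR.
have pc : 0 < p / (p - 1) by rewrite divr_gt0.
have pq : p^-1 + (p / (p - 1))^-1 = 1 by rewrite invf_div; field; rewrite gt_eqF.
have h2 : \sum_x w x * (C * f x * lvl a P x `^ (p - 1)) <=
    C `^ p * pnorm w p f / p + (\sum_x w x * lvl a P x `^ p) / (p / (p - 1)).
  rewrite /pnorm mulr_sumr !mulr_suml -big_split/=; apply: ler_sum => x _.
  have := conjugate_powR (mulr_ge0 C0 (f0 x)) (powR_ge0 (lvl a P x) (p - 1)) p0 pc pq.
  rewrite powRM// -powRrM (mulrC (p - 1)) divfK ?(gt_eqF q0)// => h.
  apply: (le_trans (ler_wpM2l (w0 x) h)).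
  by rewrite mulrDr !mulrA (mulrC (w x) (C `^ p)).
have h3 := sum_lvl_le_stop; rewrite -/S in h3.
have h4 : S <= C `^ p * pnorm w p f / p + S / (p / (p - 1)).
  apply: (le_trans h1); apply: (le_trans h2); rewrite lerD2l.
  by rewrite ler_wpM2r// invr_ge0 ltW.
rewrite /carleson_const -/C -(ler_pM2r (x := p^-1)) ?invr_gt0//.
have -> : S / p = S - S / (p / (p - 1)).
  by rewrite invf_div; field; rewrite gt_eqF.
lra.
Qed.

(** This is the dyadic maximal inequality, [lvl] being comparable to the maximal function of [f]
    over the cubes of [P]. *)
Lemma carleson_lvl : \sum_x w x * lvl a P x `^ p <= carleson_const * pnorm w p f.
Proof. exact: le_trans sum_lvl_le_stop carleson. Qed.

Lemma carleson_avg : \sum_(F | stop a P F) mass w F * a F `^ p <=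
  2 `^ p * carleson_const * pnorm w p f.
Proof.
have p0 : 0 < p by exact: lt_trans p1.
rewrite -mulrA; apply: (@le_trans _ _
  (2 `^ p * \sum_(F | stop a P F) mass w F * lvl a P F `^ p)); last first.
  by rewrite ler_wpM2l ?powR_ge0// carleson.
rewrite mulr_sumr; apply: ler_sum => F sF; have [_ PF _] := stopP sF.
rewrite mulrCA ler_wpM2l ?mass_ge0// -powRM ?lvl_ge0//.
by apply: ler_powR2r; [exact: ltW|exact: a0|exact: le_lvl].
Qed.

End carleson.

End forest_sums.

(** * Change of variables for Wolff potentials *)

Section dual_exponent.
Variables (R : realType) (p : R).
Hypothesis p1 : 1 < p.

Lemma dual_exponent_inv : (dual_exponent p)^-1 = 1 - p^-1.
Proof. by rewrite /dual_exponent invf_div; field; rewrite gt_eqF// (lt_trans _ p1). Qed.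

Lemma dual_exponent_gt1 : 1 < dual_exponent p.
Proof.
have p10 : 0 < p - 1 by rewrite subr_gt0.
by rewrite /dual_exponent ltr_pdivlMr// mul1r ltrBlDr ltrDl.
Qed.

Lemma dual_exponent_gt0 : 0 < dual_exponent p.
Proof. exact: lt_trans dual_exponent_gt1. Qed.

Lemma dual_exponentD : p^-1 + (dual_exponent p)^-1 = 1.
Proof. by rewrite dual_exponent_inv addrC subrK. Qed.

Lemma dual_exponentB1 : (dual_exponent p - 1) * p = dual_exponent p.
Proof.
have p10 : 0 < p - 1 by rewrite subr_gt0.
by rewrite /dual_exponent; field; rewrite gt_eqF.
Qed.

End dual_exponent.

Lemma powR_absorb (R : realType) (X D t : R) : 0 < t -> 0 <= X -> 0 <= D ->
  X <= D * X `^ (1 - t) -> X `^ t <= D.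
Proof.
move=> t0; rewrite le_eqVlt => /predU1P[<- D0 _|X0 D0].
  by rewrite powR0 ?gt_eqF.
rewrite powRB; last by rewrite (gt_eqF X0) implybT.
rewrite powRr1 ?(ltW X0)// mulrCA -{1}(mulr1 X) ler_pM2l//.
by rewrite ler_pdivlMr ?powR_gt0// mul1r.
Qed.

Section change_of_variables.
Variables (R : realType) (T : finType) (le : rel T).
Hypothesis leF : forest le.
Variables (w lam : T -> R).
Hypotheses (w0 : forall x, 0 <= w x) (lam0 : forall x, 0 <= lam x).

(** The [w]-mean over [Q] of the sum of [lam S] times the indicator of [S], for [S] inside [Q];
    [sum_below] is this reading. [cone_sum] is the full sum at an atom. *)
Definition submean Q := (\sum_(S | le S Q) lam S * mass le w S) / mass le w Q.

Definition cone_sum x := \sum_(Q | le x Q) lam Q.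

Lemma submean_ge0 Q : 0 <= submean Q.
Proof.
apply: divr_ge0; last exact: mass_ge0.
by apply: sumr_ge0 => S _; rewrite mulr_ge0 ?mass_ge0.
Qed.

Lemma cone_sum_ge0 x : 0 <= cone_sum x. Proof. exact: sumr_ge0. Qed.

Lemma sum_below Q : \sum_(S | le S Q) lam S * mass le w S =
  \sum_(x | le x Q) w x * \sum_(S | le x S && le S Q) lam S.
Proof.
under eq_bigr do rewrite mulr_sumr.
rewrite (exchange_big_dep (fun x => le x Q))/=; last first.
  by move=> S x SQ xS; exact: forest_trans SQ.
apply: eq_bigr => x xQ; rewrite mulr_sumr; apply: eq_big => [S|S _].
  by rewrite andbC.
by rewrite mulrC.
Qed.

Lemma submean_mass Q :
  submean Q * mass le w Q = \sum_(S | le S Q) lam S * mass le w S.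
Proof.
have [m0|m0] := eqVneq (mass le w Q) 0; last by rewrite /submean divfK.
rewrite m0 mulr0 sum_below big1// => x xQ.
by rewrite (mass_eq0 w0 m0 xQ) mul0r.
Qed.

(** The cubes over [x] form a chain. Summed from the smallest one, the partial sums at [Q] use only
    cubes inside [Q], as [submean] does; summed from the largest one they are [cone_sum Q], which
    does not depend on [x]. *)
Lemma cone_sum_powR_down x (s : R) : 1 <= s -> cone_sum x `^ s <=
  s * \sum_(Q | le x Q) lam Q * (\sum_(S | le x S && le S Q) lam S) `^ (s - 1).
Proof.
move=> s1.
have := @powR_sum_chain R T le lam s [set Q | le x Q]%SET s1 lam0
  (forest_trans leF) (forest_anti leF).
have E (F : T -> R) : \sum_(i in [set Q | le x Q]%SET) F i = \sum_(Q | le x Q) F Q.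
  by apply: eq_bigl => Q; rewrite inE.
rewrite !E; have h : forall i j, i \in [set Q | le x Q]%SET ->
    j \in [set Q | le x Q]%SET -> le i j || le j i.
  by move=> i j; rewrite !inE; exact: (forest_laminar leF).
move=> /(_ h) /le_trans; apply.
rewrite le_eqVlt; apply/orP; left; apply/eqP; congr (_ * _).
apply: eq_bigr => i _; congr (_ * _ `^ _).
by apply: eq_bigl => j; rewrite inE.
Qed.

Lemma cone_sum_powR_up x (s : R) : 1 <= s -> cone_sum x `^ s <=
  s * \sum_(Q | le x Q) lam Q * cone_sum Q `^ (s - 1).
Proof.
move=> s1.
have tr : transitive (fun i j => le j i).
  by move=> a b c /= h1 h2; exact: forest_trans h1.
have as' : antisymmetric (fun i j => le j i).
  by move=> a b /= h; apply: (forest_anti leF); rewrite andbC.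
have := @powR_sum_chain R T _ lam s [set Q | le x Q]%SET s1 lam0 tr as'.
have E (F : T -> R) : \sum_(i in [set Q | le x Q]%SET) F i = \sum_(Q | le x Q) F Q.
  by apply: eq_bigl => Q; rewrite inE.
rewrite !E; have h : forall i j, i \in [set Q | le x Q]%SET ->
    j \in [set Q | le x Q]%SET -> le j i || le i j.
  by move=> i j; rewrite !inE => hi hj; rewrite orbC; exact: (forest_laminar leF hi hj).
move=> /(_ h) /le_trans; apply.
rewrite le_eqVlt; apply/orP; left; apply/eqP; congr (_ * _).
apply: eq_bigr => i xi; congr (_ * _ `^ _).
apply: eq_bigl => j; rewrite inE; apply/andP/idP => [[]//|ij]; split => //.
exact: forest_trans ij.
Qed.

End change_of_variables.

Section change_of_variables_bounds.
Variable R : realType.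

(** For [s <= 2] the power [s - 1] is concave, and Jensen's inequality passes from the partial sums
    to their mean. For [s > 2] the chain is summed twice from the top, which produces one factor
    [submean] and [u ^ (s - 2)]; Hoelder's inequality then returns a power of the left-hand side,
    which is absorbed. *)
Lemma cov_upper (s : R) : 1 < s -> exists2 C : R, 0 < C &
  forall (T : finType) (le : rel T) (w lam : T -> R), forest le ->
  (forall x, 0 <= w x) -> (forall x, 0 <= lam x) ->
  \sum_x w x * cone_sum le lam x `^ s <=
  C * \sum_Q lam Q * mass le w Q * submean le w lam Q `^ (s - 1).
Proof.
move=> s1; have s0 : 0 < s by exact: lt_trans s1.
have s10 : 0 < s - 1 by rewrite subr_gt0.
have [s2|s2] := leP s 2.
  exists s => // T le w lam leF w0 lam0.
  apply: (@le_trans _ _ (\sum_x w x * (s * \sum_(Q | le x Q) lam Q *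
      (\sum_(S | le x S && le S Q) lam S) `^ (s - 1)))).
    by apply: ler_sum => x _; rewrite ler_wpM2l// cone_sum_powR_down// ltW.
  under eq_bigr do rewrite mulrCA mulr_sumr.
  rewrite -mulr_sumr ler_pM2l// (exchange_big_dep xpredT)//=.
  apply: ler_sum => Q _; rewrite -mulrA.
  under eq_bigr do rewrite mulrCA.
  rewrite -mulr_sumr ler_wpM2l// /submean sum_below//.
  by apply: sum_powR_jensen => //; [move=> x; exact: sumr_ge0|lra].
(* The factors [s] and [s - 1] come from the two summations along chains. Absorption gives [X ^
   (1/(s - 1)) <= s (s - 1) Y ^ (1/(s - 1))], whence the outer power [s - 1]. *)
have D0 : 0 < s * (s - 1) by rewrite mulr_gt0.
exists ((s * (s - 1)) `^ (s - 1)); first exact: powR_gt0.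
move=> T le w lam leF w0 lam0.
set X := \sum_x _; set Y := \sum_Q _.
pose u := cone_sum le lam; pose m := submean le w lam.
have u0 : forall x, 0 <= u x by exact: cone_sum_ge0.
have m0 : forall x, 0 <= m x by move=> x; exact: submean_ge0.
have lm0 : forall Q, 0 <= lam Q * mass le w Q by move=> Q; rewrite mulr_ge0 ?mass_ge0.
have X0 : 0 <= X by apply: sumr_ge0 => x _; rewrite mulr_ge0 ?powR_ge0.
have Y0 : 0 <= Y by apply: sumr_ge0 => x _; rewrite mulr_ge0 ?powR_ge0.
have massE (g : T -> R) : \sum_Q lam Q * mass le w Q * g Q =
    \sum_x w x * \sum_(Q | le x Q) lam Q * g Q.
  rewrite -mass_pos_integral; apply: eq_bigr => Q _.
  by rewrite mulrAC mulrC mulrA.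
have h1 : X <= s * \sum_Q lam Q * mass le w Q * u Q `^ (s - 1).
  rewrite massE mulr_sumr; apply: ler_sum => x _.
  by rewrite mulrCA ler_wpM2l// cone_sum_powR_up// ltW.
have h2 : \sum_Q lam Q * mass le w Q * u Q `^ (s - 1) <=
    (s - 1) * \sum_Q lam Q * mass le w Q * (u Q `^ (s - 2) * m Q).
  apply: (@le_trans _ _ (\sum_Q lam Q * mass le w Q *
      ((s - 1) * \sum_(S | le Q S) lam S * u S `^ (s - 2)))).
    apply: ler_sum => Q _; rewrite ler_wpM2l//.
    have -> : s - 2 = s - 1 - 1 by ring.
    by apply: cone_sum_powR_up => //; lra.
  under eq_bigr do rewrite mulrCA mulr_sumr.
  rewrite -mulr_sumr ler_pM2l// (exchange_big_dep xpredT)//=.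
  rewrite le_eqVlt; apply/orP; left; apply/eqP; apply: eq_bigr => S _.
  rewrite -mulr_suml -(submean_mass leF)// -/(m S); ring.
have h3 : \sum_Q lam Q * mass le w Q * u Q `^ (s - 1) <= X.
  rewrite massE; apply: ler_sum => x _; rewrite ler_wpM2l//.
  rewrite -(mulr_powRB1 (u0 x) s0) /u {2}/cone_sum mulr_suml.
  apply: ler_sum => Q xQ; rewrite ler_wpM2l// ler_powR2r// ?(ltW s10)//.
  rewrite /cone_sum [leRHS](bigID (le Q))/=.
  rewrite (eq_bigl (le Q)) => [|S]; last first.
    by apply/andP/idP => [[]//|QS]; split => //; exact: forest_trans QS.
  by rewrite lerDl sumr_ge0.
have ss2 : 0 < s - 2 by rewrite subr_gt0.
have e1 : 0 < (s - 1) / (s - 2) by rewrite divr_gt0.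
have e12 : ((s - 1) / (s - 2))^-1 + (s - 1)^-1 = 1.
  by rewrite invf_div; field; rewrite gt_eqF.
have := @hoelder_sum R T xpredT (fun Q => lam Q * mass le w Q)
  (fun Q => u Q `^ (s - 2)) m _ _ lm0 (fun=> powR_ge0 _ _) m0 e1 s10 e12.
under [X in _ <= X `^ _ * _ -> _]eq_bigr => Q _.
  rewrite -powRrM (mulrC (s - 2)) divfK ?gt_eqF//; over.
rewrite -/Y /= => h4.
clearbody X Y.
have h5 : X <= s * (s - 1) * Y `^ (s - 1)^-1 * X `^ (1 - (s - 1)^-1).
  apply: (le_trans h1); rewrite -mulrA -mulrA (ler_pM2l s0).
  apply: (le_trans h2); rewrite (ler_pM2l s10).
  apply: (le_trans h4); rewrite mulrC ler_wpM2l ?powR_ge0//.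
  have -> : ((s - 1) / (s - 2))^-1 = 1 - (s - 1)^-1 by exact: (canRL (addrK _) e12).
  apply: ler_powR2r => //; last first.
    by apply: sumr_ge0 => Q _; rewrite mulr_ge0 ?powR_ge0.
  by rewrite subr_ge0 invf_le1//; lra.
have is10 : 0 < (s - 1)^-1 by rewrite invr_gt0.
have := powR_absorb is10 X0 _ h5; rewrite mulr_ge0 ?powR_ge0 ?(ltW D0)// => /(_ isT) h6.
have := ler_root_powR s10 X0 _ h6; rewrite mulr_ge0 ?powR_ge0 ?(ltW D0)// => /(_ isT).
by rewrite powRM ?powR_ge0 ?(ltW D0)// powRVK// gt_eqF.
Qed.

(** Each [submean] is at most an average of [u = cone_sum], hence at most twice the rounded maximal
    function [v] of [u]. The left side is then at most the integral of [u * (2 v) ^ (s - 1)], and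
    [v] is controlled by the maximal inequality. *)
Lemma cov_lower (s : R) : 1 < s -> exists2 C : R, 0 < C &
  forall (T : finType) (le : rel T) (w lam : T -> R), forest le ->
  (forall x, 0 <= w x) -> (forall x, 0 <= lam x) ->
  \sum_Q lam Q * mass le w Q * submean le w lam Q `^ (s - 1) <=
  C * \sum_x w x * cone_sum le lam x `^ s.
Proof.
move=> s1; have s0 : 0 < s by exact: lt_trans s1.
have s10 : 0 < s - 1 by rewrite subr_gt0.
exists (1 + 2 `^ s * carleson_const s).
  by rewrite ltr_wpDr// mulr_ge0 ?powR_ge0.
move=> T le w lam leF w0 lam0.
pose u := cone_sum le lam.
have u0 : forall x, 0 <= u x by exact: cone_sum_ge0.
pose v := lvl le (avg le w u) xpredT.
have v0 x : 0 <= v x by exact: lvl_ge0.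
have mv Q : submean le w lam Q <= 2 * v Q.
  apply: (le_trans _ (le_lvl leF (avg le w u) (P := xpredT) (Q := Q) isT)).
  rewrite /submean /avg ler_wpM2r ?invr_ge0 ?mass_ge0// sum_below// /integ.
  apply: ler_sum => x xQ; rewrite ler_wpM2l// /u /cone_sum.
  rewrite [leRHS](bigID (fun S => le S Q))/= lerDl.
  by rewrite sumr_ge0.
apply: (@le_trans _ _ (\sum_x w x * (u x * (2 * v x) `^ (s - 1)))).
  rewrite (eq_bigr (fun Q => mass le w Q * (lam Q * submean le w lam Q `^ (s - 1)))); last first.
    by move=> Q _; rewrite mulrAC mulrC mulrA.
  rewrite mass_pos_integral; apply: ler_sum => x _; rewrite ler_wpM2l//.
  rewrite /u {1}/cone_sum mulr_suml; apply: ler_sum => Q xQ; rewrite ler_wpM2l//.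
  apply: ler_powR2r; rewrite ?(ltW s10) ?submean_ge0//.
  apply: (le_trans (mv Q)); rewrite ler_pM2l//.
  exact: lvl_anti.
rewrite mulrDl mul1r -mulrA.
apply: (@le_trans _ _ (\sum_x w x * u x `^ s + 2 `^ s * \sum_x w x * v x `^ s)).
  rewrite mulr_sumr -big_split/=; apply: ler_sum => x _.
  rewrite (mulrCA (2 `^ s)) -mulrDr ler_wpM2l// -powRM//.
  have v20 : 0 <= 2 * v x by rewrite mulr_ge0.
  have [h|/ltW h] := leP (u x) (2 * v x).
    rewrite -(mulr_powRB1 v20 s0); apply: (@le_trans _ _ (2 * v x * (2 * v x) `^ (s - 1))).
      by rewrite ler_wpM2r ?powR_ge0.
    by rewrite lerDr powR_ge0.
  rewrite -(mulr_powRB1 (u0 x) s0).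
  apply: (@le_trans _ _ (u x * u x `^ (s - 1))).
    by rewrite ler_wpM2l// ler_powR2r// ltW.
  by rewrite lerDl powR_ge0.
by rewrite lerD2l ler_wpM2l ?powR_ge0//; exact: carleson_lvl.
Qed.

End change_of_variables_bounds.

(** * Bilinear embedding on a forest *)

Local Opaque lvl powR.

Section corona_decomposition.
Variables (R : realType) (T : finType) (le : rel T).
Hypothesis leF : forest le.
Variables (w f : T -> R) (P : pred T).
Hypotheses (w0 : forall x, 0 <= w x) (f0 : forall x, 0 <= f x).

Let a := avg le w f.
Let v := lvl le a P.

(** A cube of level 0 has average 0 and contributes nothing; any other cube belongs to the corona of
    its [top], where the average of [f] is at most twice the level. *)
Lemma corona_sum (g : T -> R) : (forall Q, 0 <= g Q) ->
  \sum_(Q | P Q) integ le w f Q * g Q <=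
  \sum_(F | stop le a P F) 2 * v F *
    \sum_(Q | [&& P Q, le Q F & v Q == v F]) mass le w Q * g Q.
Proof.
move=> g0; have v0 x : 0 <= v x by exact: lvl_ge0.
apply: (@le_trans _ _ (\sum_(Q | P Q && (0 < v Q)) 2 * v Q * (mass le w Q * g Q))).
  rewrite [leLHS](bigID (fun Q => 0 < v Q))/= [X in _ + X]big1 ?addr0; last first.
    move=> Q /andP[PQ]; rewrite -leNgt => vQ.
    have := le_lvl leF a PQ; rewrite -/v => aQ.
    rewrite -(avg_mass le f w0) -/a.
    have := avg_ge0 le w0 f0 Q; rewrite -/a => a0.
    have -> : a Q = 0 by have := v0 Q; lra.
    by rewrite !mul0r.
  apply: ler_sum => Q /andP[PQ vQ].
  rewrite -(avg_mass le f w0) mulrA ler_wpM2r// ler_wpM2r ?mass_ge0//.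
  exact: le_lvl.
rewrite (partition_big (top le a P) (stop le a P))/=; last first.
  by move=> Q /andP[PQ vQ]; exact: stop_top.
apply: ler_sum => F sF; rewrite mulr_sumr.
rewrite le_eqVlt; apply/orP; left; apply/eqP.
have [vF _ _] := stopP leF sF.
apply: eq_big => [Q|Q /andP[_ /eqP tQ]].
  apply/idP/idP => [/andP[/andP[-> vQ] /eqP tQ]/=|/and3P[-> QF /eqP vQ]/=].
    by have [QF lF _] := topP leF a P Q; rewrite -tQ QF /v lF eqxx.
  by rewrite vQ vF (top_eq leF sF QF)// eqxx.
by have [_ lF _] := topP leF a P Q; rewrite -tQ /v lF.
Qed.

(** The maximizing choice is used here: stopping cubes of [f] lie in [P], so the averages of [f']
    produced by localization are dominated by those of [f], to which Carleson's embedding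
    applies. *)
Lemma sum_loc_le (w' f' : T -> R) (p p' : R) :
  (forall x, 0 <= w' x) -> (forall x, 0 <= f' x) -> 1 < p -> 0 < p' ->
  pnorm w p f <= 1 -> pnorm w' p' f' <= 1 ->
  (forall Q, P Q -> mass le w' Q * avg le w' f' Q `^ p' <=
    mass le w Q * a Q `^ p) ->
  \sum_(F | stop le a P F) pnorm w' p' (loc le a P w' f' F) <=
  1 + 2 `^ p * carleson_const p.
Proof.
move=> w'0 f'0 p1 p'0 N1 N2 h.
apply: (le_trans (sum_loc_pnorm leF a P f' w'0 p'0)); apply: lerD => //.
apply: (@le_trans _ _ (\sum_(F | stop le a P F) mass le w F * a F `^ p)).
  by apply: ler_sum => F sF; apply: h; have [] := stopP leF sF.
apply: (le_trans (carleson_avg leF P w0 f0 p1)).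
by rewrite ler_piMr// mulr_ge0 ?powR_ge0.
Qed.

End corona_decomposition.

Section bilinear_definitions.
Variables (R : realType) (T : finType) (le : rel T).

Definition sawyer_fin (w1 w2 L : T -> R) (p1 q2 c : R) (S : T) :=
  \sum_(x | le x S) w2 x *
     (\sum_(Q | le x Q && le Q S) L Q * mass le w1 Q) `^ q2 <=
  (c * mass le w1 S `^ p1^-1) `^ q2.

(** By Fubini, the [submean] of [L * mass w1] with respect to [w2] is the integral over [Q] of the
    averaged sum in Wolff's potential against [w1]; this is that potential at the atom [x]. *)
Definition wolff_fin (w1 w2 L : T -> R) (q2 : R) (x : T) :=
  \sum_(Q | le x Q) L Q * mass le w2 Q *
     submean le w2 (fun S => L S * mass le w1 S) Q `^ (q2 - 1).

Definition wolff_bound (w1 w2 L : T -> R) (q2 r c : R) :=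
  \sum_x w1 x * wolff_fin w1 w2 L q2 x `^ (r / q2) <= c `^ r.

Definition bilinear_bound (w1 w2 L : T -> R) (p1 p2 c : R) :=
  forall f1 f2 : T -> R, (forall x, 0 <= f1 x) -> (forall x, 0 <= f2 x) ->
  \sum_Q L Q * (integ le w1 f1 Q * integ le w2 f2 Q) <=
  c * (pnorm w1 p1 f1 `^ p1^-1 * pnorm w2 p2 f2 `^ p2^-1).

End bilinear_definitions.

Section bilinear_half.
Variable R : realType.

Lemma carleson_const_gt0 (p : R) : 1 < p -> 0 < carleson_const p.
Proof.
move=> p1; apply: powR_gt0; rewrite invr_gt0 subr_gt0 powRN invf_lt1 ?powR_gt0//.
have := @gt0_ltr_powR R (p - 1) _ 1 2; rewrite subr_gt0 !nnegrE powR1 => /(_ p1); apply.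
- exact: ler01.
- exact: ler0n.
- by rewrite ltr1n.
Qed.

(** In the corona of a stopping cube [F] of [f1], Hoelder's inequality separates the localized [f2]
    from the testing sum of [F]. What remains is a sum over [F] of two sequences, one controlled by
    Carleson's embedding in the power [p1], the other by [sum_loc_le] in the power [p2]. *)
Lemma sawyer_half (p1 p2 : R) : 1 < p1 -> 1 < p2 -> 1 <= p1^-1 + p2^-1 ->
  exists2 C : R, 0 < C &
  forall (T : finType) (le : rel T) (w1 w2 L f1 f2 : T -> R) (P : pred T) (c : R),
  forest le -> (forall x, 0 <= w1 x) -> (forall x, 0 <= w2 x) ->
  (forall x, 0 <= L x) -> (forall x, 0 <= f1 x) -> (forall x, 0 <= f2 x) ->
  0 <= c ->
  (forall S, P S -> sawyer_fin le w1 w2 L p1 (dual_exponent p2) c S) ->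
  pnorm w1 p1 f1 <= 1 -> pnorm w2 p2 f2 <= 1 ->
  (forall Q, P Q -> mass le w2 Q * avg le w2 f2 Q `^ p2 <=
    mass le w1 Q * avg le w1 f1 Q `^ p1) ->
  \sum_(Q | P Q) L Q * (integ le w1 f1 Q * integ le w2 f2 Q) <= C * c.
Proof.
move=> p1gt p2gt p12.
have p10 : 0 < p1 by exact: lt_trans p1gt.
have p20 : 0 < p2 by exact: lt_trans p2gt.
set q := dual_exponent p2.
have q0 : 0 < q by exact: dual_exponent_gt0.
have pq : p2^-1 + q^-1 = 1 by exact: dual_exponentD.
pose A := carleson_const p1 `^ p1^-1.
pose B := (1 + 2 `^ p1 * carleson_const p1) `^ p2^-1.
have K0 := carleson_const_gt0 p1gt.
have A0 : 0 < A by exact: powR_gt0.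
have BB : 0 < 1 + 2 `^ p1 * carleson_const p1.
  by rewrite addr_gt0// mulr_gt0// powR_gt0.
have B0 : 0 < B by exact: powR_gt0.
exists (2 * (2 * (A * B))); first by rewrite !mulr_gt0.
move=> T le w1 w2 L f1 f2 P c leF w10 w20 L0 f10 f20 c0 test N1 N2 dom.
pose a := avg le w1 f1; pose v := lvl le a P; pose g F := loc le a P w2 f2 F.
have g0 F x : 0 <= g F x by exact: loc_ge0.
have v0 x : 0 <= v x by exact: lvl_ge0.
rewrite (eq_bigr (fun Q => integ le w1 f1 Q * (L Q * integ le w2 f2 Q))); last first.
  by move=> Q _; rewrite mulrCA.
apply: (le_trans (corona_sum leF P w10 f10 _)).
  by move=> Q; rewrite mulr_ge0 ?integ_ge0.
rewrite -/a -/v.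
have step F : stop le a P F ->
    2 * v F * \sum_(Q | [&& P Q, le Q F & v Q == v F])
      mass le w1 Q * (L Q * integ le w2 f2 Q) <=
    2 * c * (v F * mass le w1 F `^ p1^-1 * pnorm w2 p2 (g F) `^ p2^-1).
  move=> sF; have [_ PF _] := stopP leF sF.
  have -> : 2 * c * (v F * mass le w1 F `^ p1^-1 * pnorm w2 p2 (g F) `^ p2^-1) =
    2 * v F * (pnorm w2 p2 (g F) `^ p2^-1 * (c * mass le w1 F `^ p1^-1)) by ring.
  rewrite ler_wpM2l ?mulr_ge0//.
  rewrite (eq_bigr (fun Q => integ le w2 (g F) Q * (L Q * mass le w1 Q))); last first.
    move=> Q /and3P[_ QF /eqP vQ].
    by rewrite /g (loc_integ leF)//; ring.
  rewrite sum_integ_cond.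
  pose AF x := \sum_(Q | [&& P Q, le Q F & v Q == v F] && le x Q) L Q * mass le w1 Q.
  have AF0 x : 0 <= AF x by apply: sumr_ge0 => Q _; rewrite mulr_ge0 ?mass_ge0.
  under eq_bigr do rewrite -mulrA.
  apply: (le_trans (hoelder_sum xpredT w20 (g0 F) AF0 p20 q0 pq)).
  rewrite ler_wpM2l ?powR_ge0//.
  have cm0 : 0 <= c * mass le w1 F `^ p1^-1 by rewrite mulr_ge0 ?powR_ge0.
  rewrite -(powRK (lt0r_neq0 q0) cm0).
  apply: ler_powR2r; first by rewrite invr_ge0 ltW.
    by apply: sumr_ge0 => x _; rewrite mulr_ge0 ?powR_ge0.
  apply: le_trans (test F PF).
  rewrite (bigID (fun x => le x F))/= [X in _ + X]big1 ?addr0; last first.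
    move=> x xF; rewrite /AF big_pred0 ?powR0 ?mulr0 ?gt_eqF// => Q.
    apply/negbTE; apply: contra xF => /andP[/and3P[_ QF _] xQ].
    exact: forest_trans QF.
  apply: ler_sum => x xF; rewrite ler_wpM2l//; apply: ler_powR2r => //; first exact: ltW.
  rewrite /AF [leRHS](bigID (fun Q => P Q && (v Q == v F)))/=.
  rewrite (eq_bigl (fun Q => le x Q && le Q F && (P Q && (v Q == v F)))); last first.
    by move=> Q; case: (P Q); case: (le Q F); case: (le x Q); case: (v Q == v F).
  by rewrite lerDl; apply: sumr_ge0 => Q _; rewrite mulr_ge0 ?mass_ge0.
apply: (le_trans (ler_sum _ step)); rewrite -mulr_sumr.
have -> : 2 * (2 * (A * B)) * c = 2 * c * (2 * (A * B)) by ring.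
apply: ler_wpM2l; first by rewrite mulr_ge0.
apply: (hoelder2_seq p10 p20 p12 A0 B0).
- by move=> F _; rewrite mulr_ge0 ?powR_ge0.
- by move=> F _; rewrite powR_ge0.
- rewrite powRVK ?gt_eqF ?(ltW K0)//.
  under eq_bigr => F _.
    rewrite powRM ?powR_ge0// powRVK ?mass_ge0 ?gt_eqF// mulrC; over.
  apply: (le_trans (carleson leF P w10 f10 p1gt)).
  by rewrite ler_piMr// ltW.
- rewrite powRVK ?gt_eqF ?(ltW BB)//.
  under eq_bigr => F _.
    rewrite powRVK ?pnorm_ge0 ?gt_eqF//; over.
  exact: sum_loc_le.
Qed.

(* With [lam] the part of [L * mass w1] in the corona of [F], [cov_upper] and
   the monotonicity of the levels bring the weight [v ^ q2] under the Wolff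
   potential, where it is controlled by the maximal inequality. *)
Lemma wolff_half (p1 p2 r : R) : 1 < p1 -> 1 < p2 -> 0 < r ->
  r^-1 + p1^-1 + p2^-1 = 1 ->
  exists2 C : R, 0 < C &
  forall (T : finType) (le : rel T) (w1 w2 L f1 f2 : T -> R) (P : pred T) (c : R),
  forest le -> (forall x, 0 <= w1 x) -> (forall x, 0 <= w2 x) ->
  (forall x, 0 <= L x) -> (forall x, 0 <= f1 x) -> (forall x, 0 <= f2 x) ->
  0 <= c ->
  wolff_bound le w1 w2 L (dual_exponent p2) r c ->
  pnorm w1 p1 f1 <= 1 -> pnorm w2 p2 f2 <= 1 ->
  (forall Q, P Q -> mass le w2 Q * avg le w2 f2 Q `^ p2 <=
    mass le w1 Q * avg le w1 f1 Q `^ p1) ->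
  \sum_(Q | P Q) L Q * (integ le w1 f1 Q * integ le w2 f2 Q) <= C * c.
Proof.
move=> p1gt p2gt r0 rp.
have p10 : 0 < p1 by exact: lt_trans p1gt.
have p20 : 0 < p2 by exact: lt_trans p2gt.
set q := dual_exponent p2.
have q0 : 0 < q by exact: dual_exponent_gt0.
have q1 : 1 < q by exact: dual_exponent_gt1.
have q10 : 0 < q - 1 by rewrite subr_gt0.
have pq : p2^-1 + q^-1 = 1 by exact: dual_exponentD.
have [D D0 cov] := cov_upper q1.
pose A := (D * carleson_const p1 `^ (p1 / q)^-1) `^ q^-1.
pose B := (1 + 2 `^ p1 * carleson_const p1) `^ p2^-1.
have K0 := carleson_const_gt0 p1gt.
have A0 : 0 < A by rewrite powR_gt0// mulr_gt0// powR_gt0.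
have BB : 0 < 1 + 2 `^ p1 * carleson_const p1.
  by rewrite addr_gt0// mulr_gt0// powR_gt0.
have B0 : 0 < B by exact: powR_gt0.
have e1 : 0 < p1 / q by rewrite divr_gt0.
have e2 : 0 < r / q by rewrite divr_gt0.
(* Since [1/q = 1/p1 + 1/r], the function [v ^ q] can be paired in the power [p1 / q] with the Wolff
   potential in the power [r / q]. *)
have e12 : (p1 / q)^-1 + (r / q)^-1 = 1.
  have qi : q^-1 = p1^-1 + r^-1 by lra.
  by rewrite !invf_div -mulrDr -qi mulfV// gt_eqF.
exists (2 * (A * B)); first by rewrite !mulr_gt0.
move=> T le w1 w2 L f1 f2 P c leF w10 w20 L0 f10 f20 c0 test N1 N2 dom.
pose a := avg le w1 f1; pose v := lvl le a P; pose g F := loc le a P w2 f2 F.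
have g0 F x : 0 <= g F x by exact: loc_ge0.
have v0 x : 0 <= v x by exact: lvl_ge0.
have vanti x Q : le x Q -> v Q <= v x by exact: lvl_anti.
have vtop F Q : stop le a P F -> le Q F -> v Q = v F -> top le a P Q = F.
  exact: top_eq.
have gE F Q : le Q F -> v Q = v F -> integ le w2 (g F) Q = integ le w2 f2 Q.
  exact: loc_integ.
have gN : \sum_(F | stop le a P F) pnorm w2 p2 (g F) <=
    1 + 2 `^ p1 * carleson_const p1 by exact: sum_loc_le.
have vN : \sum_x w1 x * v x `^ p1 <= carleson_const p1.
  apply: (le_trans (carleson_lvl leF P w10 f10 p1gt)).
  by rewrite ler_piMr// ltW.
pose lam Q := L Q * mass le w1 Q.
have lam0 Q : 0 <= lam Q by rewrite mulr_ge0 ?mass_ge0.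
pose y Q := submean le w2 lam Q.
have y0 Q : 0 <= y Q by exact: submean_ge0.
have yE Q : y Q = submean le w2 lam Q by [].
clearbody y.
rewrite (eq_bigr (fun Q => integ le w1 f1 Q * (L Q * integ le w2 f2 Q))); last first.
  by move=> Q _; rewrite mulrCA.
apply: (le_trans (corona_sum leF P w10 f10 _)).
  by move=> Q; rewrite mulr_ge0 ?integ_ge0.
rewrite -/a -/v; clearbody v g.
pose lamF F Q := if [&& P Q, le Q F & v Q == v F] then lam Q else 0.
have lamF0 F Q : 0 <= lamF F Q by rewrite /lamF; case: ifP.
pose AF F x := cone_sum le (lamF F) x.
have AF0 F x : 0 <= AF F x by exact: cone_sum_ge0.
have step F : stop le a P F ->
    2 * v F * \sum_(Q | [&& P Q, le Q F & v Q == v F])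
      mass le w1 Q * (L Q * integ le w2 f2 Q) =
    2 * \sum_x w2 x * (v F * AF F x * g F x).
  move=> sF; rewrite -mulrA; congr (_ * _).
  rewrite (eq_bigr (fun Q => integ le w2 (g F) Q * lam Q)); last first.
    move=> Q /and3P[_ QF /eqP vQ].
    by rewrite gE// /lam; ring.
  rewrite sum_integ_cond mulr_sumr; apply: eq_bigr => x _.
  have -> : \sum_(Q | [&& P Q, le Q F & v Q == v F] && le x Q) lam Q = AF F x.
    rewrite /AF /cone_sum big_mkcond [RHS]big_mkcond; apply: eq_bigr => Q _.
    by rewrite /lamF andbC; case: (le x Q).
  ring.
rewrite (eq_bigr _ step) -mulr_sumr -[leRHS]mulrA ler_pM2l//.
(* One Hoelder inequality over pairs of a stopping cube and an atom separates all localizations of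
   [f2] from all corona sums at once. *)
rewrite pair_big_dep/=.
apply: (le_trans (hoelder_sum (w := fun i : T * T => w2 i.2)
  (a := fun i : T * T => v i.1 * AF i.1 i.2) (b := fun i : T * T => g i.1 i.2)
  (fun i => stop le a P i.1 && true) _ _ _ q0 p20 _)) => //.
- by move=> i; rewrite mulr_ge0.
- by rewrite addrC.
rewrite mulrAC; apply: ler_pM; rewrite ?powR_ge0//; last first.
  rewrite /B; apply: ler_powR2r; first by rewrite invr_ge0 ltW.
    by apply: sumr_ge0 => i _; rewrite mulr_ge0 ?powR_ge0.
  rewrite -(pair_big_dep (stop le a P) (fun _ _ => true) (fun F x => w2 x * g F x `^ p2))/=.
  exact: gN.
rewrite -(pair_big_dep (stop le a P) (fun _ _ => true) (fun F x => w2 x * (v F * AF F x) `^ q))/=.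
pose W := wolff_fin le w1 w2 L q.
have W0 x : 0 <= W x.
  by apply: sumr_ge0 => Q _; rewrite !mulr_ge0 ?powR_ge0 ?mass_ge0.
have covF F : stop le a P F -> \sum_x w2 x * (v F * AF F x) `^ q <=
    D * \sum_(Q | le Q F && (v Q == v F)) mass le w1 Q *
      (v Q `^ q * (L Q * mass le w2 Q * y Q `^ (q - 1))).
  move=> sF.
  rewrite (eq_bigr (fun x => v F `^ q * (w2 x * AF F x `^ q))); last first.
    by move=> x _; rewrite powRM// mulrCA.
  rewrite -mulr_sumr.
  apply: (le_trans (ler_wpM2l (powR_ge0 _ _) (cov T le w2 (lamF F) leF w20 (lamF0 F)))).
  rewrite [leLHS]mulrCA (ler_pM2l D0).
  rewrite [leLHS]mulr_sumr [leRHS]big_mkcond.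
  apply: ler_sum => Q _; rewrite {1}/lamF.
  have yF : submean le w2 (lamF F) Q <= y Q.
    rewrite yE /submean ler_wpM2r ?invr_ge0 ?mass_ge0//.
    apply: ler_sum => S _; rewrite ler_wpM2r ?mass_ge0//.
    by rewrite /lamF; case: ifP.
  have Z (b m d : R) : b * (0 * m * d) = 0 by rewrite !mul0r mulr0.
  case: (boolP (P Q)) => /= [_|_]; last first.
    rewrite [leLHS]Z; case: ifP => _; last exact: lexx.
    apply: mulr_ge0; first exact: mass_ge0.
    apply: mulr_ge0; first exact: powR_ge0.
    apply: mulr_ge0; last exact: powR_ge0.
    by apply: mulr_ge0; [exact: L0|exact: mass_ge0].
  case: ifP => [/andP[QF /eqP ->]|_]; last first.
    by rewrite [leLHS]Z lexx.
  have -> : mass le w1 Q * (v F `^ q * (L Q * mass le w2 Q * y Q `^ (q - 1))) =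
     v F `^ q * (lam Q * mass le w2 Q * y Q `^ (q - 1)) by rewrite /lam; ring.
  rewrite ler_wpM2l ?powR_ge0// ler_wpM2l ?mulr_ge0 ?mass_ge0//.
  apply: ler_powR2r => //; first exact: ltW.
  exact: submean_ge0.
have mid : \sum_(F | stop le a P F) \sum_x w2 x * (v F * AF F x) `^ q <=
    D * \sum_x w1 x * (v x `^ q * W x).
  apply: (le_trans (ler_sum _ covF)); rewrite -mulr_sumr (ler_pM2l D0).
  rewrite (exchange_big_dep xpredT)//=.
  apply: (@le_trans _ _ (\sum_Q mass le w1 Q *
      (v Q `^ q * (L Q * mass le w2 Q * y Q `^ (q - 1))))).
    apply: ler_sum => Q _; apply: sum_unique_le.
      by rewrite !mulr_ge0 ?powR_ge0 ?mass_ge0.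
    move=> F F' /andP[sF /andP[QF /eqP lF]] /andP[sF' /andP[QF' /eqP lF']].
    by rewrite -(vtop _ _ sF QF lF) (vtop _ _ sF' QF' lF').
  rewrite mass_pos_integral; apply: ler_sum => x _; rewrite ler_wpM2l//.
  rewrite /W /wolff_fin [leRHS]mulr_sumr; apply: ler_sum => Q xQ.
  rewrite -yE ler_wpM2r ?mulr_ge0 ?powR_ge0 ?mass_ge0//.
  by apply: ler_powR2r; [exact: ltW|exact: v0|exact: vanti].
have hold : \sum_x w1 x * (v x `^ q * W x) <=
    carleson_const p1 `^ (p1 / q)^-1 * c `^ q.
  apply: (le_trans (hoelder_sum xpredT w10 (fun=> powR_ge0 _ _) W0 e1 e2 e12)).
  apply: ler_pM; rewrite ?powR_ge0//.
    apply: ler_powR2r; first by rewrite invr_ge0 ltW.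
      by apply: sumr_ge0 => i _; rewrite mulr_ge0 ?powR_ge0.
    under eq_bigr => x _ do rewrite -powRrM mulrCA mulfV ?gt_eqF// mulr1.
    exact: vN.
  apply: (@le_trans _ _ ((c `^ r) `^ (r / q)^-1)).
    apply: ler_powR2r => //; first by rewrite invr_ge0 ltW.
    by apply: sumr_ge0 => i _; rewrite mulr_ge0 ?powR_ge0.
  by rewrite -powRrM invf_div mulrCA mulfV ?gt_eqF// mulr1.
apply: (@le_trans _ _ ((D * (carleson_const p1 `^ (p1 / q)^-1 * c `^ q)) `^ q^-1)).
  apply: ler_powR2r; first by rewrite invr_ge0 ltW.
    by apply: sumr_ge0 => F _; apply: sumr_ge0 => i _; rewrite mulr_ge0 ?powR_ge0.
  by apply: (le_trans mid); rewrite (ler_pM2l D0).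
rewrite mulrA powRM ?powR_ge0 ?mulr_ge0 ?powR_ge0 ?(ltW D0)//.
by rewrite powRK ?gt_eqF.
Qed.

End bilinear_half.

Local Transparent lvl powR.

Section testing_definitions.
Variables (R : realType) (T : finType) (le : rel T).

(* Testing only where [L S] is positive lets the condition for the kernel
   [kernel_at K wc S] pass to [kernel_at K wc F], for [S] below [F]. *)
Definition half_test (w1 w2 L : T -> R) (p1 p2 c : R) : Prop :=
  (1 <= p1^-1 + p2^-1 -> forall S, 0 < L S ->
    sawyer_fin le w1 w2 L p1 (dual_exponent p2) c S) /\
  (p1^-1 + p2^-1 < 1 -> forall r, r^-1 + p1^-1 + p2^-1 = 1 ->
    wolff_bound le w1 w2 L (dual_exponent p2) r c).

Definition kernel_at (K wc : T -> R) (F Q : T) : R :=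
  if le Q F then K Q * mass le wc Q else 0.

(** Only one inequality of each pair is recorded: the other is the same statement for the
    permutation with its first two entries exchanged. *)
Definition half_test3 (wa wb wc K : T -> R) (pa pb pc c : R) : Prop :=
  (1 <= pa^-1 + pb^-1 -> forall S,
    sawyer_fin le wa wb (kernel_at K wc S) pa (dual_exponent pb)
      (c * mass le wc S `^ pc^-1) S) /\
  (pa^-1 + pb^-1 < 1 -> forall r, r^-1 + pa^-1 + pb^-1 = 1 -> forall S,
    wolff_bound le wa wb (kernel_at K wc S) (dual_exponent pb) r
      (c * mass le wc S `^ pc^-1)).

(** Stated through integrals so as to cover a function of norm 0, which need not vanish on atoms of
    weight 0; it is replaced by the zero function. *)
Lemma pnorm_normalize (w f : T -> R) (p : R) :
  (forall x, 0 <= w x) -> (forall x, 0 <= f x) -> 0 < p ->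
  exists g : T -> R, [/\ forall x, 0 <= g x, pnorm w p g <= 1 &
    forall Q, integ le w f Q = pnorm w p f `^ p^-1 * integ le w g Q].
Proof.
move=> w0 f0 p0; have N0 := pnorm_ge0 f w0 p.
move: (N0); rewrite le_eqVlt => /predU1P[Nz|Np].
  exists (fun=> 0); split => //.
    by rewrite /pnorm big1// => x _; rewrite powR0 ?gt_eqF// mulr0.
  move=> Q; rewrite -Nz powR0 ?invr_eq0 ?gt_eqF// mul0r /integ big1// => x _.
  move/esym/eqP: Nz; rewrite psumr_eq0; last first.
    by move=> y _; rewrite mulr_ge0 ?powR_ge0.
  move=> /allP /(_ x (mem_index_enum _)) /=.
  by rewrite mulf_eq0 powR_eq0 (gt_eqF p0) andbT => /orP[]/eqP->; rewrite ?mul0r ?mulr0.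
have Npp : 0 < pnorm w p f `^ p^-1 by rewrite powR_gt0.
exists (fun x => f x / pnorm w p f `^ p^-1); split.
- by move=> x; rewrite divr_ge0 ?powR_ge0.
- rewrite {1}/pnorm (eq_bigr (fun x => w x * f x `^ p / pnorm w p f)); last first.
    by move=> x _; rewrite divr_powR// powRVK ?gt_eqF// mulrA.
  by rewrite -mulr_suml -/(pnorm w p f) divff ?gt_eqF.
- move=> Q; rewrite /integ mulr_sumr; apply: eq_bigr => x _.
  by rewrite mulrCA [_ * (_ / _)]mulrC divfK ?gt_eqF.
Qed.

End testing_definitions.

Section bilinear.
Variable R : realType.

Lemma bilinear_half (p1 p2 : R) : 1 < p1 -> 1 < p2 -> exists2 C : R, 0 < C &
  forall (T : finType) (le : rel T) (w1 w2 L f1 f2 : T -> R) (P : pred T) (c : R),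
  forest le -> (forall x, 0 <= w1 x) -> (forall x, 0 <= w2 x) ->
  (forall x, 0 <= L x) -> (forall x, 0 <= f1 x) -> (forall x, 0 <= f2 x) ->
  0 <= c -> half_test le w1 w2 L p1 p2 c ->
  pnorm w1 p1 f1 <= 1 -> pnorm w2 p2 f2 <= 1 ->
  (forall Q, P Q -> 0 < L Q) ->
  (forall Q, P Q -> mass le w2 Q * avg le w2 f2 Q `^ p2 <=
    mass le w1 Q * avg le w1 f1 Q `^ p1) ->
  \sum_(Q | P Q) L Q * (integ le w1 f1 Q * integ le w2 f2 Q) <= C * c.
Proof.
move=> p1gt p2gt; have [p12|p12] := leP 1 (p1^-1 + p2^-1).
  have [C C0 H] := sawyer_half p1gt p2gt p12; exists C => //.
  move=> T le w1 w2 L f1 f2 P c leF w10 w20 L0 f10 f20 c0 [test _] N1 N2 LP dom.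
  by apply: H => // S /LP; exact: test.
pose r := (1 - (p1^-1 + p2^-1))^-1.
have r0 : 0 < r by rewrite invr_gt0 subr_gt0.
have rp : r^-1 + p1^-1 + p2^-1 = 1 by rewrite /r invrK; ring.
have [C C0 H] := wolff_half p1gt p2gt r0 rp; exists C => //.
move=> T le w1 w2 L f1 f2 P c leF w10 w20 L0 f10 f20 c0 [_ test] N1 N2 LP dom.
by apply: H => //; exact: test.
Qed.

(* On each cube the larger of the two quantities [mass w_i * avg f_i ^ p_i]
   decides for which function the stopping cubes are taken. *)
Lemma bilinear_embedding (p1 p2 : R) : 1 < p1 -> 1 < p2 ->
  exists2 C : R, 0 < C &
  forall (T : finType) (le : rel T) (w1 w2 L : T -> R) (c : R),
  forest le -> (forall x, 0 <= w1 x) -> (forall x, 0 <= w2 x) ->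
  (forall x, 0 <= L x) -> 0 <= c ->
  half_test le w1 w2 L p1 p2 c -> half_test le w2 w1 L p2 p1 c ->
  bilinear_bound le w1 w2 L p1 p2 (C * c).
Proof.
move=> p1gt p2gt.
have p10 : 0 < p1 by exact: lt_trans p1gt.
have p20 : 0 < p2 by exact: lt_trans p2gt.
have [C1 C10 H1] := bilinear_half p1gt p2gt.
have [C2 C20 H2] := bilinear_half p2gt p1gt.
exists (C1 + C2); first exact: addr_gt0.
move=> T le w1 w2 L c leF w10 w20 L0 c0 t12 t21 f1 f2 f10 f20.
have [g1 [g10 N1 E1]] := pnorm_normalize le w10 f10 p10.
have [g2 [g20 N2 E2]] := pnorm_normalize le w20 f20 p20.
rewrite (eq_bigr (fun Q => (pnorm w1 p1 f1 `^ p1^-1 * pnorm w2 p2 f2 `^ p2^-1) *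
   (L Q * (integ le w1 g1 Q * integ le w2 g2 Q)))); last first.
  have H (l x y u v : R) : l * (x * u * (y * v)) = x * y * (l * (u * v)) by ring.
  by move=> Q _; rewrite E1 E2; exact: H.
rewrite -mulr_sumr mulrC ler_wpM2r ?mulr_ge0 ?powR_ge0// mulrDl.
pose V1 Q := mass le w1 Q * avg le w1 g1 Q `^ p1.
pose V2 Q := mass le w2 Q * avg le w2 g2 Q `^ p2.
have X0 Q : 0 <= L Q * (integ le w1 g1 Q * integ le w2 g2 Q).
  by rewrite !mulr_ge0 ?integ_ge0.
have h1 := H1 T le w1 w2 L g1 g2 [pred Q | (0 < L Q) && (V2 Q <= V1 Q)] c
  leF w10 w20 L0 g10 g20 c0 t12 N1 N2.
have h2 := H2 T le w2 w1 L g2 g1 [pred Q | (0 < L Q) && (V1 Q <= V2 Q)] c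
  leF w20 w10 L0 g20 g10 c0 t21 N2 N1.
have {}h1 := h1 (fun Q h => proj1 (andP h)) (fun Q h => proj2 (andP h)).
have {}h2 := h2 (fun Q h => proj1 (andP h)) (fun Q h => proj2 (andP h)).
apply: le_trans (lerD h1 h2).
rewrite [X in X + _]big_mkcond [X in _ + X]big_mkcond -big_split/=.
apply: ler_sum => Q _.
rewrite (mulrC (integ le w2 g2 Q)).
have [LQ|LQ] := ltP 0 (L Q); last first.
  have -> : L Q = 0 by apply/eqP; rewrite eq_le LQ L0.
  by rewrite mul0r /= addr0.
have [V|/ltW V] := leP (V2 Q) (V1 Q); rewrite /= ?V.
  by rewrite lerDl; case: ifP.
by rewrite add0r.
Qed.

End bilinear.

(** * From bilinear embeddings to the trilinear form *)

Section trilinear.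
Variable R : realType.

Lemma kernel_at_ge0 (T : finType) (le : rel T) (K wc : T -> R) F Q :
  (forall x, 0 <= K x) -> (forall x, 0 <= wc x) -> 0 <= kernel_at le K wc F Q.
Proof. by move=> K0 w0; rewrite /kernel_at; case: ifP => // _; rewrite mulr_ge0 ?mass_ge0. Qed.

Lemma mass_mono (T : finType) (le : rel T) (w : T -> R) Q F :
  forest le -> (forall x, 0 <= w x) -> le Q F -> mass le w Q <= mass le w F.
Proof.
move=> leF w0 QF; rewrite /mass [leRHS](bigID (fun x => le x Q))/=.
rewrite (eq_bigl (fun x => le x F && le x Q)) => [|x]; last first.
  by apply/idP/andP => [xQ|[]//]; split => //; exact: forest_trans QF.
by rewrite lerDl sumr_ge0.
Qed.

(** For [S] below [F] the kernels cut at [S] and at [F] agree on the cubes inside [S], and the mass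
    of [S] is at most that of [F]. For other [S] the kernel vanishes at [S] and nothing is
    tested. *)
Lemma half_test3_kernel (T : finType) (le : rel T) (wa wb wc K : T -> R)
    (pa pb pc c : R) F :
  forest le -> (forall x, 0 <= wa x) -> (forall x, 0 <= wb x) ->
  (forall x, 0 <= wc x) -> (forall x, 0 <= K x) -> 0 <= c ->
  1 < pb -> 0 < pc ->
  half_test3 le wa wb wc K pa pb pc c ->
  half_test le wa wb (kernel_at le K wc F) pa pb (c * mass le wc F `^ pc^-1).
Proof.
move=> leF wa0 wb0 wc0 K0 c0 pb1 pc0 [saw wol]; split; last first.
  by move=> h r rE; exact: wol.
have q0 := dual_exponent_gt0 pb1.
move=> h S; rewrite {1}/kernel_at; case: ifP => [SF _|_]; last by rewrite ltxx.
have := saw h S; rewrite /sawyer_fin => /le_trans - /(_ ((c * mass le wc F `^ pc^-1 *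
  mass le wa S `^ pa^-1) `^ dual_exponent pb)) {}saw.
apply: le_trans (saw _).
  rewrite le_eqVlt; apply/orP; left; apply/eqP; apply: eq_bigr => x xS.
  congr (_ * _ `^ _); apply: eq_bigr => Q /andP[_ QS].
  by rewrite /kernel_at QS (forest_trans leF QS SF).
apply: ler_powR2r; first exact: ltW.
  by rewrite !mulr_ge0 ?powR_ge0.
rewrite ler_wpM2r ?powR_ge0// ler_wpM2l//.
by apply: ler_powR2r; rewrite ?invr_ge0 ?(ltW pc0) ?mass_ge0// mass_mono.
Qed.

(** Replacing the average of [fc] by the level leaves a factor [mass le wc Q], which together with
    [K Q] is exactly the restricted kernel at the stopping cube. In the constant, 2 is the rounding
    of the averages and 3 comes from the threefold sequence inequality. *)
Lemma trilinear_half (pa pb pc : R) : 1 < pa -> 1 < pb -> 1 < pc ->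
  1 <= pa^-1 + pb^-1 + pc^-1 -> exists2 C : R, 0 < C &
  forall (T : finType) (le : rel T) (wa wb wc K fa fb fc : T -> R) (P : pred T)
    (c : R),
  forest le -> (forall x, 0 <= wa x) -> (forall x, 0 <= wb x) ->
  (forall x, 0 <= wc x) -> (forall x, 0 <= K x) ->
  (forall x, 0 <= fa x) -> (forall x, 0 <= fb x) -> (forall x, 0 <= fc x) ->
  0 <= c ->
  (forall F, bilinear_bound le wa wb (kernel_at le K wc F) pa pb
    (c * mass le wc F `^ pc^-1)) ->
  pnorm wa pa fa <= 1 -> pnorm wb pb fb <= 1 -> pnorm wc pc fc <= 1 ->
  (forall Q, P Q -> mass le wa Q * avg le wa fa Q `^ pa <=
    mass le wc Q * avg le wc fc Q `^ pc) ->
  (forall Q, P Q -> mass le wb Q * avg le wb fb Q `^ pb <=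
    mass le wc Q * avg le wc fc Q `^ pc) ->
  \sum_(Q | P Q) K Q * (integ le wa fa Q * integ le wb fb Q * integ le wc fc Q)
    <= C * c.
Proof.
move=> pagt pbgt pcgt pabc.
have pa0 : 0 < pa by exact: lt_trans pagt.
have pb0 : 0 < pb by exact: lt_trans pbgt.
have pc0 : 0 < pc by exact: lt_trans pcgt.
have K0 := carleson_const_gt0 pcgt.
have BB : 0 < 1 + 2 `^ pc * carleson_const pc.
  by rewrite addr_gt0// mulr_gt0// powR_gt0.
pose A := (1 + 2 `^ pc * carleson_const pc) `^ pa^-1.
pose B := (1 + 2 `^ pc * carleson_const pc) `^ pb^-1.
pose D := carleson_const pc `^ pc^-1.
have A0 : 0 < A by exact: powR_gt0.
have B0 : 0 < B by exact: powR_gt0.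
have D0 : 0 < D by exact: powR_gt0.
exists (2 * (3 * (A * B * D))); first by rewrite !mulr_gt0.
move=> T le wa wb wc K fa fb fc P c leF wa0 wb0 wc0 Kp fa0 fb0 fc0 c0 bil Na Nb Nc da db.
pose a := avg le wc fc; pose v := lvl le a P.
pose ga F := loc le a P wa fa F; pose gb F := loc le a P wb fb F.
have ga0 F x : 0 <= ga F x by exact: loc_ge0.
have gb0 F x : 0 <= gb F x by exact: loc_ge0.
have v0 x : 0 <= v x by exact: lvl_ge0.
have gaE F Q : le Q F -> v Q = v F -> integ le wa (ga F) Q = integ le wa fa Q.
  exact: loc_integ.
have gbE F Q : le Q F -> v Q = v F -> integ le wb (gb F) Q = integ le wb fb Q.
  exact: loc_integ.
have gaN : \sum_(F | stop le a P F) pnorm wa pa (ga F) <=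
    1 + 2 `^ pc * carleson_const pc by exact: sum_loc_le.
have gbN : \sum_(F | stop le a P F) pnorm wb pb (gb F) <=
    1 + 2 `^ pc * carleson_const pc by exact: sum_loc_le.
have vN : \sum_(F | stop le a P F) mass le wc F * v F `^ pc <= carleson_const pc.
  apply: (le_trans (carleson leF P wc0 fc0 pcgt)).
  by rewrite ler_piMr// ltW.
rewrite (eq_bigr (fun Q => integ le wc fc Q *
    (K Q * (integ le wa fa Q * integ le wb fb Q)))); last first.
  by move=> Q _; ring.
apply: (le_trans (corona_sum leF P wc0 fc0 _)).
  by move=> Q; rewrite !mulr_ge0 ?integ_ge0.
rewrite -/a -/v; clearbody v ga gb.
have step F : stop le a P F ->
    2 * v F * \sum_(Q | [&& P Q, le Q F & v Q == v F])
      mass le wc Q * (K Q * (integ le wa fa Q * integ le wb fb Q)) <=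
    2 * c * (pnorm wa pa (ga F) `^ pa^-1 * pnorm wb pb (gb F) `^ pb^-1 *
      (v F * mass le wc F `^ pc^-1)).
  move=> sF.
  have H (d x y z t : R) : 2 * d * (x * y * (z * t)) = 2 * z * (d * t * (x * y)).
    by ring.
  rewrite [leRHS]H.
  apply: ler_wpM2l; first by rewrite mulr_ge0.
  apply: le_trans (bil F _ _ (ga0 F) (gb0 F)).
  rewrite [leRHS](bigID (fun Q => [&& P Q, le Q F & v Q == v F]))/=.
  rewrite -[leLHS]addr0; apply: lerD; last first.
    by apply: sumr_ge0 => Q _; rewrite !mulr_ge0 ?integ_ge0 ?kernel_at_ge0.
  rewrite le_eqVlt; apply/orP; left; apply/eqP.
  apply: eq_bigr => Q /and3P[_ QF /eqP vQ].
  by rewrite gaE// gbE// /kernel_at QF; ring.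
apply: (le_trans (ler_sum _ step)); rewrite -mulr_sumr.
have -> : 2 * (3 * (A * B * D)) * c = 2 * c * (3 * (A * B * D)) by ring.
apply: ler_wpM2l; first by rewrite mulr_ge0.
apply: (hoelder3_seq pa0 pb0 pc0 pabc A0 B0 D0).
- by move=> F _; exact: powR_ge0.
- by move=> F _; exact: powR_ge0.
- by move=> F _; rewrite mulr_ge0 ?powR_ge0.
- rewrite powRVK ?gt_eqF ?(ltW BB)//.
  under eq_bigr => F _.
    rewrite powRVK ?pnorm_ge0 ?gt_eqF//; over.
  exact: gaN.
- rewrite powRVK ?gt_eqF ?(ltW BB)//.
  under eq_bigr => F _.
    rewrite powRVK ?pnorm_ge0 ?gt_eqF//; over.
  exact: gbN.
- rewrite powRVK ?gt_eqF ?(ltW K0)//.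
  under eq_bigr => F _.
    rewrite powRM ?powR_ge0// powRVK ?mass_ge0 ?gt_eqF// mulrC; over.
  exact: vN.
Qed.

End trilinear.

(** * Trilinear embedding on a forest *)

Section ordinal3.
Implicit Types s : 'S_3.

Lemma big_perm3 (R : Type) (idx : R) (op : Monoid.com_law idx) s (F : 'I_3 -> R) :
  \big[op/idx]_(i < 3) F i = op (op (F (s 0)) (F (s 1))) (F (s 2)).
Proof.
rewrite (reindex_inj (@perm_inj _ s))/= !big_ord_recl big_ord0 Monoid.mulm1.
rewrite Monoid.mulmA; congr (op (op (F (s _)) (F (s _))) (F (s _))); exact/val_inj.
Qed.

Lemma perm3_last (c : 'I_3) : exists s, s 2 = c.
Proof. by exists (tperm 2 c); rewrite tpermL. Qed.

Lemma perm3_swap s : exists t : 'S_3, [/\ t 0 = s 1, t 1 = s 0 & t 2 = s 2].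
Proof.
exists (tperm (0%R : 'I_3) 1%R * s)%g; rewrite !permM tpermL tpermR tpermD//.
Qed.

Lemma perm3_distinct s : [/\ s 0 != s 2, s 1 != s 2 & s 0 != s 1].
Proof. by rewrite !(inj_eq perm_inj). Qed.

End ordinal3.

Section trilinear_finite.
Variable R : realType.
Variable p : 'I_3 -> R.
Hypotheses (p1 : forall i, 1 < p i) (psum : 1 <= \sum_(i < 3) (p i)^-1).

Let p0 i : 0 < p i. Proof. exact: lt_trans (p1 i). Qed.

Definition trilinear_fin (T : finType) (le : rel T) (K : T -> R)
    (w : 'I_3 -> T -> R) (c : R) : Prop :=
  forall f : 'I_3 -> T -> R, (forall i x, 0 <= f i x) ->
  \sum_Q K Q * \prod_(i < 3) integ le (w i) (f i) Q <=
  c * \prod_(i < 3) pnorm (w i) (p i) (f i) `^ (p i)^-1.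

Definition testing_fin (T : finType) (le : rel T) (K : T -> R)
    (w : 'I_3 -> T -> R) (c : R) : Prop :=
  forall s : 'S_3, half_test3 le (w (s 0)) (w (s 1)) (w (s 2)) K
    (p (s 0)) (p (s 1)) (p (s 2)) c.

Lemma trilinear_region (s : 'S_3) : exists2 C : R, 0 < C &
  forall (T : finType) (le : rel T) (K : T -> R) (w : 'I_3 -> T -> R) (c : R)
    (f : 'I_3 -> T -> R) (P : pred T),
  forest le -> (forall i x, 0 <= w i x) -> (forall x, 0 <= K x) -> 0 <= c ->
  testing_fin le K w c ->
  (forall i x, 0 <= f i x) -> (forall i, pnorm (w i) (p i) (f i) <= 1) ->
  (forall Q i, P Q -> mass le (w i) Q * avg le (w i) (f i) Q `^ p i <=
     mass le (w (s 2)) Q * avg le (w (s 2)) (f (s 2)) Q `^ p (s 2)) ->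
  \sum_(Q | P Q) K Q * \prod_(i < 3) integ le (w i) (f i) Q <= C * c.
Proof.
have ps : 1 <= (p (s 0))^-1 + (p (s 1))^-1 + (p (s 2))^-1.
  by move: psum; rewrite (big_perm3 _ s).
have [B B0 bil] := bilinear_embedding (p1 (s 0)) (p1 (s 1)).
have [C C0 tri] := trilinear_half (p1 (s 0)) (p1 (s 1)) (p1 (s 2)) ps.
exists (C * B); first exact: mulr_gt0.
move=> T le K w c f P leF w0 K0 c0 test f0 N dom.
under eq_bigr do rewrite (big_perm3 _ s)/=.
rewrite -mulrA; apply: tri => //; first by rewrite mulr_ge0 ?(ltW B0).
- move=> F; rewrite -mulrA; apply: bil => //.
  + by move=> Q; exact: kernel_at_ge0.
  + by rewrite mulr_ge0 ?powR_ge0.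
  + exact: half_test3_kernel.
  + have [t [t0 t1 t2]] := perm3_swap s.
    by apply: half_test3_kernel => //; have := test t; rewrite t0 t1 t2.
- by move=> Q; exact: dom.
- by move=> Q; exact: dom.
Qed.

(** The regions in which a given index is maximizing cover all cubes. They may overlap, which is
    harmless as the terms are nonnegative, and the three constants are added. *)
Theorem trilinear_fin_suff : exists2 C : R, 0 < C &
  forall (T : finType) (le : rel T) (K : T -> R) (w : 'I_3 -> T -> R) (c : R),
  forest le -> (forall i x, 0 <= w i x) -> (forall x, 0 <= K x) -> 0 <= c ->
  testing_fin le K w c -> trilinear_fin le K w (C * c).
Proof.
have : forall i : 'I_3, exists C : R, 0 < C /\
  forall (T : finType) (le : rel T) (K : T -> R) (w : 'I_3 -> T -> R) (c : R)
    (f : 'I_3 -> T -> R) (P : pred T),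
  forest le -> (forall i x, 0 <= w i x) -> (forall x, 0 <= K x) -> 0 <= c ->
  testing_fin le K w c ->
  (forall i x, 0 <= f i x) -> (forall i, pnorm (w i) (p i) (f i) <= 1) ->
  (forall Q j, P Q -> mass le (w j) Q * avg le (w j) (f j) Q `^ p j <=
     mass le (w i) Q * avg le (w i) (f i) Q `^ p i) ->
  \sum_(Q | P Q) K Q * \prod_(i < 3) integ le (w i) (f i) Q <= C * c.
  move=> i; have [s <-] := perm3_last i.
  by have [C C0 H] := trilinear_region s; exists C; split.
move=> /fin_all_exists[C HC].
have C0 i : 0 < C i by have [] := HC i.
exists (\sum_i C i).
  by rewrite (bigD1 0)//= ltr_pwDl// sumr_ge0// => i _; exact: ltW.
move=> T le K w c leF w0 K0 c0 test f f0.
have /fin_all_exists[g Hg] i := pnorm_normalize le (w0 i) (f0 i) (p0 i).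
have g0 i x : 0 <= g i x by have [] := Hg i.
have N i : pnorm (w i) (p i) (g i) <= 1 by have [] := Hg i.
have E i Q : integ le (w i) (f i) Q =
  pnorm (w i) (p i) (f i) `^ (p i)^-1 * integ le (w i) (g i) Q by have [] := Hg i.
set M := \prod_(i < 3) _ `^ _.
rewrite (eq_bigr (fun Q => M * (K Q * \prod_(i < 3) integ le (w i) (g i) Q))); last first.
  move=> Q _; rewrite mulrCA; congr (_ * _).
  by rewrite /M -big_split/=; apply: eq_bigr => i _.
rewrite -mulr_sumr mulrC ler_wpM2r//; first by apply: prodr_ge0 => i _; exact: powR_ge0.
rewrite mulr_suml.
pose V i Q := mass le (w i) Q * avg le (w i) (g i) Q `^ p i.
pose P i Q := [forall j, V j Q <= V i Q].
have X0 Q : 0 <= K Q * \prod_(i < 3) integ le (w i) (g i) Q.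
  by rewrite mulr_ge0// prodr_ge0// => i _; exact: integ_ge0.
apply: (@le_trans _ _ (\sum_i \sum_(Q | P i Q) K Q * \prod_(i < 3) integ le (w i) (g i) Q)).
  rewrite (exchange_big_dep xpredT)//=; apply: ler_sum => Q _.
  pose m := [arg max_(i > (0 : 'I_3)) V i Q]%O.
  have Pm : P m Q.
    by rewrite /m; case: arg_maxP => // i _ h; apply/forallP => j; exact: h.
  by rewrite [leRHS](bigD1 m)//= lerDl sumr_ge0.
apply: ler_sum => i _; have [_ H] := HC i.
by apply: H => // Q j /forallP/(_ j).
Qed.

End trilinear_finite.

(** * Necessity of the testing conditions on a forest *)

Section necessity.
Variable R : realType.

(** The second function is chosen extremal, [H ^ (q - 1)] with [H] the operator applied to [f]: the
    form becomes the norm [X] of [H] to the power [q], and the right side contains [X ^ (1/q2)],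
    which is absorbed. *)
Lemma bilinear_dual (T : finType) (le : rel T) (w1 w2 L : T -> R) (q1 q2 c : R)
    (f : T -> R) :
  (forall x, 0 <= w1 x) -> (forall x, 0 <= w2 x) -> (forall x, 0 <= L x) ->
  0 <= c -> 1 < q2 -> bilinear_bound le w1 w2 L q1 q2 c ->
  (forall x, 0 <= f x) ->
  \sum_x w2 x * (\sum_(Q | le x Q) L Q * integ le w1 f Q) `^ dual_exponent q2 <=
  (c * pnorm w1 q1 f `^ q1^-1) `^ dual_exponent q2.
Proof.
move=> w10 w20 L0 c0 q2gt bil f0; set q := dual_exponent q2.
have q0 : 0 < q by exact: dual_exponent_gt0.
have q20 : 0 < q2 by exact: lt_trans q2gt.
pose H x := \sum_(Q | le x Q) L Q * integ le w1 f Q.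
have H0 x : 0 <= H x by apply: sumr_ge0 => Q _; rewrite mulr_ge0 ?integ_ge0.
rewrite -/(pnorm w2 q H).
set X := pnorm w2 q H.
have X0 : 0 <= X by exact: pnorm_ge0.
have := bil f (fun x => H x `^ (q - 1)) f0 (fun=> powR_ge0 _ _).
have -> : \sum_Q L Q * (integ le w1 f Q * integ le w2 (fun x => H x `^ (q - 1)) Q) = X.
  rewrite (eq_bigr (fun Q => integ le w2 (fun x => H x `^ (q - 1)) Q *
    (L Q * integ le w1 f Q))); last by move=> Q _; rewrite mulrA mulrC.
  rewrite (sum_integ_cond le _ _ _ xpredT)/=; apply: eq_bigr => x _.
  by rewrite -/(H x) -mulrA [_ `^ _ * _]mulrC mulr_powRB1.
have -> : pnorm w2 q2 (fun x => H x `^ (q - 1)) = X.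
  by apply: eq_bigr => x _; rewrite -powRrM dual_exponentB1.
have -> : q2^-1 = 1 - q^-1 by rewrite dual_exponent_inv// subKr.
rewrite mulrA => /(powR_absorb _ X0) h.
apply: ler_root_powR => //; rewrite ?mulr_ge0 ?powR_ge0//.
by apply: h; rewrite ?invr_gt0 ?mulr_ge0 ?powR_ge0.
Qed.

Lemma sawyer_nec (T : finType) (le : rel T) (w1 w2 L : T -> R) (q1 q2 c : R) S :
  forest le ->
  (forall x, 0 <= w1 x) -> (forall x, 0 <= w2 x) -> (forall x, 0 <= L x) ->
  0 <= c -> 0 < q1 -> 1 < q2 -> bilinear_bound le w1 w2 L q1 q2 c ->
  sawyer_fin le w1 w2 L q1 (dual_exponent q2) c S.
Proof.
move=> leF w10 w20 L0 c0 q10 q2gt bil.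
pose f x : R := if le x S then 1 else 0.
have f0 x : 0 <= f x by rewrite /f; case: ifP.
have := bilinear_dual w10 w20 L0 c0 q2gt bil f0.
have -> : pnorm w1 q1 f = mass le w1 S.
  rewrite /mass big_mkcond; apply: eq_bigr => x _; rewrite /f.
  by case: ifP => _; rewrite ?powR1 ?powR0 ?gt_eqF// ?mulr1 ?mulr0.
apply: le_trans.
rewrite [leRHS](bigID (fun x => le x S))/= -[leLHS]addr0; apply: lerD; last first.
  by apply: sumr_ge0 => x _; rewrite mulr_ge0 ?powR_ge0.
have q0 := dual_exponent_gt0 q2gt.
apply: ler_sum => x xS; rewrite ler_wpM2l//; apply: ler_powR2r; first exact: ltW.
  by apply: sumr_ge0 => Q _; rewrite mulr_ge0 ?mass_ge0.
rewrite [leRHS](bigID (fun Q => le Q S))/= -[leLHS]addr0; apply: lerD; last first.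
  by apply: sumr_ge0 => Q _; rewrite mulr_ge0 ?integ_ge0.
apply: ler_sum => Q /andP[xQ QS]; rewrite ler_wpM2l//.
apply: ler_sum => y yQ.
by rewrite /f (forest_trans leF yQ QS) mulr1.
Qed.

(** Pairing [W] with its extremal function [g] gives [Z]. The averages of [g] are replaced by the
    rounded maximal function [v], written as [v^(1/s) * (v^(1/s))^(s - 1)]: one factor enters the
    weights [lam], the other the mean, since [v] grows downwards. Then [cov_lower] and duality,
    tested on [f = v^(1/s)], bound [Z] by a power of the norm of [v], hence of [Z] itself. *)
Lemma wolff_nec (q1 q2 r : R) : 1 < q1 -> 1 < q2 -> 0 < r ->
  r^-1 + q1^-1 + q2^-1 = 1 -> exists2 C : R, 1 <= C &
  forall (T : finType) (le : rel T) (w1 w2 L : T -> R) (c : R),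
  forest le -> (forall x, 0 <= w1 x) -> (forall x, 0 <= w2 x) ->
  (forall x, 0 <= L x) -> 0 <= c -> bilinear_bound le w1 w2 L q1 q2 c ->
  wolff_bound le w1 w2 L (dual_exponent q2) r (C * c).
Proof.
move=> q1gt q2gt r0 rq.
have q10 : 0 < q1 by exact: lt_trans q1gt.
have q20 : 0 < q2 by exact: lt_trans q2gt.
set s := dual_exponent q2.
have s0 : 0 < s by exact: dual_exponent_gt0.
have s1 : 1 < s by exact: dual_exponent_gt1.
have s10 : 0 < s - 1 by rewrite subr_gt0.
have si : s^-1 = q1^-1 + r^-1.
  by have := dual_exponentD q2gt; rewrite -/s; lra.
have [D D0 cov] := cov_lower s1.
pose t := q1 / s; pose t' := r / s.
have ri0 : 0 < r^-1 by rewrite invr_gt0.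
have q1i0 : 0 < q1^-1 by rewrite invr_gt0.
have t1 : 1 < t.
  by rewrite /t ltr_pdivlMr// mul1r -ltf_pV2 ?posrE// si ltrDl.
have t0 : 0 < t by exact: lt_trans t1.
have t'0 : 0 < t' by rewrite divr_gt0.
have tt' : t^-1 + t'^-1 = 1.
  by rewrite !invf_div -mulrDr -si mulfV// gt_eqF.
have t'1 : 1 < t'.
  have t'i1 : t'^-1 < 1 by rewrite -tt' ltrDr invr_gt0.
  by rewrite -[ltRHS]invrK invf_gt1 ?invr_gt0.
have K0 := carleson_const_gt0 t1.
(* The three factors come from rounding the averages of [g], from [cov_lower], and from the maximal
   inequality for [g] in the power [t = q1 / s]. *)
pose E := 2 * D * carleson_const t `^ (s / q1).
have E0 : 0 < E by rewrite !mulr_gt0// powR_gt0.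
exists (1 + E `^ s^-1); first by rewrite lerDl powR_ge0.
move=> T le w1 w2 L c leF w10 w20 L0 c0 bil.
pose lam0 Q := L Q * mass le w1 Q.
have lam00 Q : 0 <= lam0 Q by rewrite mulr_ge0 ?mass_ge0.
pose y Q := submean le w2 lam0 Q.
have y0 Q : 0 <= y Q by exact: submean_ge0.
pose W := wolff_fin le w1 w2 L s.
have WE x : W x = \sum_(Q | le x Q) L Q * mass le w2 Q * y Q `^ (s - 1) by [].
have W0 x : 0 <= W x.
  by rewrite WE; apply: sumr_ge0 => Q _; rewrite !mulr_ge0 ?powR_ge0 ?mass_ge0.
rewrite /wolff_bound -/t' -/(pnorm w1 t' W).
set Z := pnorm w1 t' W.
have Z0 : 0 <= Z by exact: pnorm_ge0.
pose g x := W x `^ (t' - 1).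
have g0 x : 0 <= g x by exact: powR_ge0.
have gN : pnorm w1 t g = Z.
  apply: eq_bigr => x _; rewrite /g -powRrM; congr (_ * _ `^ _).
  have -> : t = t' / (t' - 1).
    have /(congr1 GRing.inv) : t^-1 = (t' - 1) / t'.
      rewrite mulrBl mulfV ?gt_eqF// mul1r.
      exact: (canRL (addrK _) tt').
    by rewrite invrK invf_div.
  by rewrite mulrC divfK// gt_eqF// subr_gt0.
pose v := lvl le (avg le w1 g) xpredT.
have v0 x : 0 <= v x by exact: lvl_ge0.
have vanti x Q : le x Q -> v Q <= v x by exact: lvl_anti.
have gv Q : avg le w1 g Q <= 2 * v Q by exact: le_lvl.
have vN : pnorm w1 t v <= carleson_const t * Z.
  by rewrite -gN; exact: carleson_lvl.
clearbody v.
pose f x := v x `^ s^-1.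
have f0 x : 0 <= f x by exact: powR_ge0.
pose lam Q := lam0 Q * v Q `^ s^-1.
have lamp Q : 0 <= lam Q by rewrite mulr_ge0 ?powR_ge0.
have fN : pnorm w1 q1 f = pnorm w1 t v.
  by apply: eq_bigr => x _; rewrite /f -powRrM (mulrC s^-1).
have h1 : Z = \sum_Q integ le w1 g Q * (L Q * mass le w2 Q * y Q `^ (s - 1)).
  rewrite (sum_integ_cond le _ _ _ xpredT)/=; apply: eq_bigr => x _.
  by rewrite -WE /g -mulrA [_ `^ _ * _]mulrC mulr_powRB1.
have h2 : Z <= 2 * \sum_Q lam Q * mass le w2 Q * submean le w2 lam Q `^ (s - 1).
  rewrite h1 mulr_sumr; apply: ler_sum => Q _.
  have ys : y Q * v Q `^ s^-1 <= submean le w2 lam Q.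
    rewrite /y /submean mulrAC ler_wpM2r ?invr_ge0 ?mass_ge0// mulr_suml.
    apply: ler_sum => S SQ; rewrite /lam mulrAC ler_wpM2r ?mass_ge0// ler_wpM2l//.
    by apply: ler_powR2r; [rewrite invr_ge0 ltW|exact: v0|exact: vanti].
  have h : L Q * mass le w1 Q * mass le w2 Q * (v Q * y Q `^ (s - 1)) <=
     lam Q * mass le w2 Q * submean le w2 lam Q `^ (s - 1).
    have -> : v Q = v Q `^ s^-1 * (v Q `^ s^-1) `^ (s - 1).
      by rewrite mulr_powRB1// ?powRVK ?gt_eqF// powR_ge0.
    have J (a1 b1 c1 d1 e1 : R) : a1 * b1 * (c1 * d1 * e1) = a1 * c1 * b1 * (e1 * d1).
      by ring.
    rewrite J -powRM ?powR_ge0// /lam /lam0 ler_wpM2l//.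
      by rewrite !mulr_ge0 ?mass_ge0 ?powR_ge0.
    by apply: ler_powR2r; [exact: ltW|rewrite mulr_ge0 ?powR_ge0|].
  apply: le_trans (ler_wpM2l _ h); last by [].
  rewrite -(avg_mass le g w10).
  have J (a1 b1 c1 d1 e1 : R) : 2 * (c1 * b1 * d1 * (a1 * e1)) = 2 * a1 * b1 * (c1 * d1 * e1).
    by ring.
  rewrite [leRHS]J; apply: ler_wpM2r.
    by rewrite !mulr_ge0 ?powR_ge0 ?mass_ge0.
  by apply: ler_wpM2r; rewrite ?mass_ge0.
have h3 : \sum_Q lam Q * mass le w2 Q * submean le w2 lam Q `^ (s - 1) <=
    D * (c * pnorm w1 q1 f `^ q1^-1) `^ s.
  apply: (le_trans (cov T le w2 lam leF w20 lamp)); rewrite ler_pM2l//.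
  apply: le_trans (bilinear_dual w10 w20 L0 c0 q2gt bil f0).
  apply: ler_sum => x _; rewrite ler_wpM2l//; apply: ler_powR2r; first exact: ltW.
    exact: cone_sum_ge0.
  apply: ler_sum => Q xQ; rewrite /lam /lam0 -mulrA ler_wpM2l//.
  rewrite mulr_suml; apply: ler_sum => z zQ; rewrite ler_wpM2l//.
  by apply: ler_powR2r; [rewrite invr_ge0 ltW|exact: v0|exact: vanti].
have h4 : Z <= E * c `^ s * Z `^ (1 - t'^-1).
  apply: (le_trans h2); rewrite /E.
  have -> : 1 - t'^-1 = s / q1 by rewrite -tt' addrK invf_div.
  have J (a1 b1 c1 d1 : R) : 2 * a1 * b1 * c1 * d1 = 2 * (a1 * (c1 * (b1 * d1))) by ring.
  rewrite [leRHS]J ler_pM2l//; apply: (le_trans h3); rewrite ler_pM2l//.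
  rewrite powRM ?powR_ge0// ler_wpM2l ?powR_ge0//.
  rewrite -powRrM [q1^-1 * s]mulrC -powRM ?(ltW K0)//.
  rewrite fN; apply: ler_powR2r; [|exact: pnorm_ge0|exact: vN].
  by rewrite divr_ge0 ?(ltW s0) ?(ltW q10).
have h5 := powR_absorb _ Z0 _ h4.
have Ec0 : 0 <= E * c `^ s by rewrite mulr_ge0 ?powR_ge0 ?(ltW E0).
have {}h5 : Z `^ t'^-1 <= E * c `^ s by apply: h5; rewrite ?invr_gt0.
apply: (le_trans (ler_root_powR t'0 Z0 Ec0 h5)).
have -> : (E * c `^ s) `^ t' = (E `^ s^-1 * c) `^ r.
  rewrite /t' (mulrC r) powRrM powRM ?powR_ge0 ?(ltW E0)//.
  by rewrite powRK ?gt_eqF.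
apply: ler_powR2r; first exact: ltW.
  by rewrite mulr_ge0 ?powR_ge0.
apply: ler_wpM2r; first exact: c0.
by rewrite lerDr ler01.
Qed.

End necessity.

Section trilinear_necessity.
Variable R : realType.
Variable p : 'I_3 -> R.
Hypotheses (p1 : forall i, 1 < p i).

Let p0 i : 0 < p i. Proof. exact: lt_trans (p1 i). Qed.

(** With the indicator of [F] in the third place, the third integral over a cube inside [F] is its
    full mass, so the restricted kernel appears; the remaining cubes contribute nonnegative
    terms. *)
Lemma trilinear_bilinear (T : finType) (le : rel T) (K : T -> R)
    (w : 'I_3 -> T -> R) (c : R) (s : 'S_3) (F : T) :
  forest le -> (forall i x, 0 <= w i x) -> (forall x, 0 <= K x) -> 0 <= c ->
  trilinear_fin p le K w c ->
  bilinear_bound le (w (s 0)) (w (s 1)) (kernel_at le K (w (s 2)) F)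
    (p (s 0)) (p (s 1)) (c * mass le (w (s 2)) F `^ (p (s 2))^-1).
Proof.
move=> leF w0 K0 c0 tri f1 f2 f10 f20.
pose f3 x : R := if le x F then 1 else 0.
have f30 x : 0 <= f3 x by rewrite /f3; case: ifP.
pose f i := if i == s 2 then f3 else if i == s 0 then f1 else f2.
have f0 i x : 0 <= f i x by rewrite /f; case: ifP => // _; case: ifP.
have [n02 n12 n01] := perm3_distinct s.
have F0 : f (s 0) = f1 by rewrite /f (negPf n02) eqxx.
have F1 : f (s 1) = f2 by rewrite /f (negPf n12) eq_sym (negPf n01).
have F2 : f (s 2) = f3 by rewrite /f eqxx.
have := tri f f0; rewrite (big_perm3 _ s)/= F0 F1 F2.
have -> : pnorm (w (s 2)) (p (s 2)) f3 = mass le (w (s 2)) F.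
  rewrite /mass big_mkcond; apply: eq_bigr => x _; rewrite /f3.
  by case: ifP => _; rewrite ?powR1 ?powR0 ?gt_eqF// ?mulr1 ?mulr0.
have J (a1 b1 c1 d1 : R) : a1 * (b1 * c1 * d1) = a1 * d1 * (b1 * c1) by ring.
rewrite [X in _ <= X -> _]J; apply: le_trans; apply: ler_sum => Q _.
rewrite (big_perm3 _ s)/= F0 F1 F2 [leRHS]J.
apply: ler_wpM2r; first by rewrite mulr_ge0 ?integ_ge0.
rewrite /kernel_at; case: ifP => QF; last by rewrite mulr_ge0 ?integ_ge0.
rewrite ler_wpM2l//; apply: ler_sum => x xQ.
by rewrite /f3 (forest_trans leF xQ QF) mulr1.
Qed.

Lemma trilinear_fin_half_nec (s : 'S_3) : exists2 C : R, 1 <= C &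
  forall (T : finType) (le : rel T) (K : T -> R) (w : 'I_3 -> T -> R) (c : R),
  forest le -> (forall i x, 0 <= w i x) -> (forall x, 0 <= K x) -> 0 <= c ->
  trilinear_fin p le K w c ->
  half_test3 le (w (s 0)) (w (s 1)) (w (s 2)) K
    (p (s 0)) (p (s 1)) (p (s 2)) (C * c).
Proof.
have [h|h] := leP 1 ((p (s 0))^-1 + (p (s 1))^-1).
  exists 1 => // T le K w c leF w0 K0 c0 tri; rewrite mul1r; split; last first.
    by rewrite ltNge h.
  move=> _ S; apply: sawyer_nec => //.
  - by move=> Q; exact: kernel_at_ge0.
  - by rewrite mulr_ge0 ?powR_ge0.
  - exact: trilinear_bilinear.
pose r := (1 - ((p (s 0))^-1 + (p (s 1))^-1))^-1.
have r0 : 0 < r by rewrite invr_gt0 subr_gt0.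
have rp : r^-1 + (p (s 0))^-1 + (p (s 1))^-1 = 1 by rewrite /r invrK; ring.
have [C C1 H] := wolff_nec (p1 (s 0)) (p1 (s 1)) r0 rp.
exists C => // T le K w c leF w0 K0 c0 tri; split; first by rewrite leNgt h.
move=> _ r' r'p S; have -> : r' = r.
  by rewrite /r -[LHS]invrK; congr (_ ^-1); lra.
rewrite -mulrA; apply: H => //.
- by move=> Q; exact: kernel_at_ge0.
- by rewrite mulr_ge0 ?powR_ge0.
- exact: trilinear_bilinear.
Qed.

Lemma half_test3_mono (T : finType) (le : rel T) (wa wb wc K : T -> R)
    (pa pb pc c d : R) :
  (forall x, 0 <= wa x) -> (forall x, 0 <= wc x) ->
  1 < pa -> 1 < pb -> 0 <= c -> c <= d ->
  half_test3 le wa wb wc K pa pb pc c -> half_test3 le wa wb wc K pa pb pc d.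
Proof.
move=> wa0 wc0 pa1 pb1 c0 cd [saw wol]; split.
  move=> h S; apply: (le_trans (saw h S)).
  apply: ler_powR2r; first by rewrite ltW// dual_exponent_gt0.
    by rewrite !mulr_ge0 ?powR_ge0.
  by rewrite ler_wpM2r ?powR_ge0// ler_wpM2r ?powR_ge0.
move=> h r rE S; apply: (le_trans (wol h r rE S)).
have r0 : 0 < r by rewrite -invr_gt0; lra.
apply: ler_powR2r; first exact: ltW.
  by rewrite mulr_ge0 ?powR_ge0.
by rewrite ler_wpM2r ?powR_ge0.
Qed.

Theorem trilinear_fin_nec : exists2 C : R, 0 < C &
  forall (T : finType) (le : rel T) (K : T -> R) (w : 'I_3 -> T -> R) (c : R),
  forest le -> (forall i x, 0 <= w i x) -> (forall x, 0 <= K x) -> 0 <= c ->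
  trilinear_fin p le K w c -> testing_fin p le K w (C * c).
Proof.
have : forall s : 'S_3, exists C : R, 1 <= C /\
  forall (T : finType) (le : rel T) (K : T -> R) (w : 'I_3 -> T -> R) (c : R),
  forest le -> (forall i x, 0 <= w i x) -> (forall x, 0 <= K x) -> 0 <= c ->
  trilinear_fin p le K w c ->
  half_test3 le (w (s 0)) (w (s 1)) (w (s 2)) K
    (p (s 0)) (p (s 1)) (p (s 2)) (C * c).
  by move=> s; have [C C1 H] := trilinear_fin_half_nec s; exists C; split.
move=> /fin_all_exists[C HC].
have C0 s : 0 <= C s by apply: le_trans ler01 _; have [] := HC s.
have Cs s : C s <= \sum_s C s by rewrite (bigD1 s)//= lerDl sumr_ge0.
exists (\sum_s C s).
  apply: (lt_le_trans ltr01); apply: le_trans (Cs 1%g).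
  by have [] := HC 1%g.
move=> T le K w c leF w0 K0 c0 tri s; have [_ H] := HC s.
by apply: half_test3_mono (H _ _ _ _ _ leF w0 K0 c0 tri); rewrite ?mulr_ge0// ler_wpM2r.
Qed.

End trilinear_necessity.

(** * Dyadic cubes and their atoms *)

Local Open Scope classical_set_scope.
Local Open Scope ring_scope.

Section dyadic_cubes.
Variables (R : realType) (n : nat).

Lemma dyadic_cubeP (k : int) (m : 'rV[int]_n) (x : 'rV[R]_n) :
  @dyadic_cube R n k m x <->
  forall i, (m ord0 i)%:~R <= 2 ^ k * x ord0 i < (m ord0 i)%:~R + 1.
Proof.
have k0 : (2 : R) ^ k != 0 by rewrite expfz_neq0.
have kN : (2 : R) ^ (- k) = (2 ^ k)^-1 by rewrite invr_expz.
split=> [[u /= u01 <-] i|xm].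
  rewrite !mxE kN mulrA mulfV// mul1r; have := u01 i.
  by rewrite -lerBlDl subrr -ltrBlDl addrAC subrr add0r.
exists (2 ^ k *: x - map_mx intr m) => /=.
  move=> i; rewrite !mxE; have := xm i.
  by rewrite subr_ge0 ltrBlDl.
by rewrite addrC subrK scalerA kN mulVf// scale1r.
Qed.

Lemma dyadic_neq0 (Q : set (borelRn R n)) : dyadic Q -> Q !=set0.
Proof.
move=> [k [m ->]]; exists ((2 : R) ^ (- k) *: (map_mx intr m + 0)).
by exists 0 => // i; rewrite mxE lexx ltr01.
Qed.

Lemma dyadic_measurable (Q : set (borelRn R n)) : dyadic Q -> measurable Q.
Proof.
move=> [k [m ->]].
have cont i : continuous (fun x : 'rV[R]_n => 2 ^ k * x ord0 i).
  move=> x; apply: continuousM; first exact: cst_continuous.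
  exact: coord_continuous.
have mlt (c : R) i : @measurable _ (borelRn R n) [set x | 2 ^ k * x ord0 i < c].
  apply: sub_sigma_algebra => /=.
  change (open ((fun x : 'rV[R]_n => 2 ^ k * x ord0 i) @^-1` [set y | y < c])).
  by apply: open_comp; [move=> x _; exact: cont|exact: open_lt].
have -> : @dyadic_cube R n k m = \bigcap_(i in [set: 'I_n])
    ([set x : borelRn R n | 2 ^ k * x ord0 i < (m ord0 i)%:~R + 1] `\`
     [set x : borelRn R n | 2 ^ k * x ord0 i < (m ord0 i)%:~R]).
  apply/seteqP; split => x.
    move=> /dyadic_cubeP xm i _ /=; have /andP[h1 h2] := xm i.
    by split => //; apply/negP; rewrite -leNgt.
  move=> xm; apply/dyadic_cubeP => i; have [/= h1 /negP] := xm i I.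
  by rewrite -leNgt => ->.
apply: fin_bigcap_measurable => // i _.
by apply: measurableD; exact: mlt.
Qed.

(** In each coordinate a common point only gives strict inequalities between integers at the finer
    scale; integrality sharpens them to [m * N <= m'] and [m' + 1 <= (m + 1) * N], with [N] the
    ratio of side lengths, which is the inclusion. *)
Lemma dyadic_cube_sub (k k' : int) (m m' : 'rV[int]_n) (x : 'rV[R]_n) :
  (k <= k')%R -> @dyadic_cube R n k m x -> @dyadic_cube R n k' m' x ->
  @dyadic_cube R n k' m' `<=` @dyadic_cube R n k m.
Proof.
move=> kk' /dyadic_cubeP xm /dyadic_cubeP xm' y /dyadic_cubeP ym'.
apply/dyadic_cubeP => i; have /andP[a1 a2] := xm i.
have /andP[b1 b2] := xm' i; have /andP[c1 c2] := ym' i.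
have [j kj] : exists j : nat, k' = k + j%:Z.
  by exists `|k' - k|%N; rewrite gez0_abs ?subr_ge0//; ring.
pose N : int := 2 ^+ j.
have NE : (2 : R) ^ k' = N%:~R * 2 ^ k.
  by rewrite kj expfzDr// mulrC rmorphXn.
have N0 : 0 < (N%:~R : R) by rewrite ltr0z exprn_gt0.
move: b1 b2 c1 c2; rewrite NE -!mulrA => b1 b2 c1 c2.
have e1 : m ord0 i * N < m' ord0 i + 1.
  by rewrite -(ltr_int R) intrD intrM; nra.
have e2 : m' ord0 i < (m ord0 i + 1) * N.
  by rewrite -(ltr_int R) intrM intrD; nra.
move: e1 e2; rewrite ltzD1 -lezD1 -(ler_int R) -(ler_int R _ (_ * _)).
rewrite intrM [X in _ -> X -> _]/=; rewrite !intrM !intrD => e1 e2.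
apply/andP; split.
  by rewrite -(ler_pM2l N0); nra.
by rewrite -(ltr_pM2l N0); nra.
Qed.

Lemma dyadic_laminar (Q S : set (borelRn R n)) (x : borelRn R n) :
  dyadic Q -> dyadic S -> Q x -> S x -> Q `<=` S \/ S `<=` Q.
Proof.
move=> [k [m ->]] [k' [m' ->]] Qx Sx.
have [kk'|/ltW kk'] := leP k k'.
  by right; exact: dyadic_cube_sub Qx Sx.
by left; exact: dyadic_cube_sub Sx Qx.
Qed.

(** Indices that encode no pair yield the unit cube at the origin; repetitions are harmless since
    only surjectivity is used. *)
Definition dyadic_enum (i : nat) : set (borelRn R n) :=
  if (choice.unpickle i : option (int * 'rV[int]_n)) is Some (k, m)
  then @dyadic_cube R n k m else @dyadic_cube R n 0 0.

Lemma dyadic_enumP i : dyadic (dyadic_enum i).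
Proof.
by rewrite /dyadic_enum; case: choice.unpickle => [[k m]|]; [exists k, m|exists 0, 0].
Qed.

Lemma dyadic_enum_surj (Q : set (borelRn R n)) :
  dyadic Q -> exists i, dyadic_enum i = Q.
Proof.
move=> [k [m ->]]; exists (choice.pickle (k, m)).
by rewrite /dyadic_enum choice.pickleK.
Qed.

End dyadic_cubes.

(** Nonemptiness turns a common subcube into a common point, so that laminarity of sets gives
    laminarity of the forest. *)
Record cube_family d (X : measurableType d) (A : {fset set X}) : Prop :=
  CubeFamily {
  family_measurable : forall Q : set X, Q \in A -> measurable Q;
  family_neq0 : forall Q : set X, Q \in A -> Q !=set0;
  family_laminar : forall (Q S : set X) z, Q \in A -> S \in A -> Q z -> S z ->
    Q `<=` S \/ S `<=` Q }.

Section atoms.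
Context d (X : measurableType d) (R : realType).
Variable A : {fset set X}.
Hypothesis famA : cube_family A.
Let mA := family_measurable famA.
Let neA := family_neq0 famA.
Let lamA := family_laminar famA.
Implicit Types (Q S x y : A) (z : X).

Definition cube_le (Q S : A) : bool := `[< val Q `<=` val S >].

Lemma cube_leP Q S : reflect (val Q `<=` val S) (cube_le Q S).
Proof. exact: asboolP. Qed.

Lemma forest_cube_le : forest cube_le.
Proof.
split=> [x|y x z /cube_leP xy /cube_leP yz|x y /andP[/cube_leP xy /cube_leP yx]|x a b].
- by apply/cube_leP.
- by apply/cube_leP; exact: subset_trans yz.
- by apply/val_inj/seteqP.
- move=> /cube_leP xa /cube_leP xb; have [z xz] := neA (valP x).
  have [h|h] := lamA (valP a) (valP b) (xa _ xz) (xb _ xz).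
    by apply/orP; left; apply/cube_leP.
  by apply/orP; right; apply/cube_leP.
Qed.

(** The points for which [x] is the smallest cube of the family containing them. An atom may be
    empty or of measure 0. *)
Definition atom x : set X :=
  val x `\` \bigcup_(Q in [set Q | cube_le Q x && (Q != x)]) val Q.

Lemma atom_sub x z : atom x z -> val x z. Proof. by case. Qed.

Lemma measurable_atom x : measurable (atom x).
Proof.
apply: measurableD; first exact: mA (valP x).
apply: fin_bigcup_measurable => [|Q _]; first exact: finite_finset.
exact: mA (valP Q).
Qed.

Lemma atom_le x Q z : atom x z -> val Q z -> cube_le x Q.
Proof.
move=> [xz nz] Qz; have [h|h] := lamA (valP x) (valP Q) xz Qz.
  exact/cube_leP.
have [->|Qx] := eqVneq Q x; first by apply/cube_leP.
exfalso; apply: nz; exists Q => //=; apply/andP; split => //; exact/cube_leP.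
Qed.

Lemma atom_inj x y z : atom x z -> atom y z -> x = y.
Proof.
move=> ax ay; apply: (forest_anti forest_cube_le).
by rewrite (atom_le ax (atom_sub ay)) (atom_le ay (atom_sub ax)).
Qed.

Lemma atom_ex Q z : val Q z -> exists x, atom x z.
Proof.
move=> Qz.
pose m := [arg min_(x < Q | `[< val x z >]) #|[pred y | cube_le y x]|].
have [mz mmin] : val m z /\ forall S, val S z ->
    (#|[pred y | cube_le y m]| <= #|[pred y | cube_le y S]|)%N.
  rewrite /m; case: arg_minnP => [|x /asboolP xz h]; first exact/asboolP.
  by split=> // S Sz; apply: h; exact/asboolP.
exists m; split => // -[S /andP[Sm Sneq] Sz].
have := card_down_eq forest_cube_le Sm (mmin S Sz).
by move/eqP: Sneq => h e; apply: h.
Qed.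

Definition step (phi : A -> R) z : R := \sum_(x : A) phi x * \1_(atom x) z.

Lemma step_atom phi x z : atom x z -> step phi z = phi x.
Proof.
move=> ax; rewrite /step (bigD1 x)//= big1 ?addr0 => [|y yx].
  by rewrite indicE mem_set// mulr1.
rewrite indicE memNset ?mulr0// => ay.
by move/eqP: yx; apply; exact: atom_inj ay ax.
Qed.

Lemma step_out phi z : (forall Q, ~ val Q z) -> step phi z = 0.
Proof.
move=> out; rewrite /step big1// => y _.
by rewrite indicE memNset ?mulr0// => /atom_sub; exact: out.
Qed.

Lemma atom_cases z : (exists x, atom x z) \/ (forall Q, ~ val Q z).
Proof.
have [[Q Qz]|h] := pselect (exists Q : A, val Q z).
  by left; exact: atom_ex Qz.
by right => Q Qz; apply: h; exists Q.
Qed.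

Lemma eq_step (H : X -> R) phi :
  (forall x z, atom x z -> H z = phi x) ->
  (forall z, (forall Q, ~ val Q z) -> H z = 0) -> H = step phi.
Proof.
move=> H1 H0; apply/funext => z; have [[x xz]|out] := atom_cases z.
  by rewrite (H1 x)// (step_atom _ xz).
by rewrite H0// step_out.
Qed.

Lemma measurable_step phi : measurable_fun setT (step phi).
Proof.
apply: measurable_sum => x.
apply: measurable_funM => //.
by apply: measurable_indic; exact: measurable_atom.
Qed.

(** At a point of the atom [x], the cubes of the family containing that point are exactly those
    above [x]. Sums over cubes thereby become sums over the forest. *)
Lemma sum_indic_step (h : A -> R) z :
  \sum_Q h Q * \1_(val Q) z = step (fun x => \sum_(Q | cube_le x Q) h Q) z.
Proof.
rewrite -(@eq_step (fun z => \sum_Q h Q * \1_(val Q) z))// => {}z.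
  move=> z' xz; rewrite [RHS]big_mkcond/=; apply: eq_bigr => Q _.
  rewrite indicE; case: ifPn => [/cube_leP h1|h1].
    by rewrite mem_set ?mulr1//; apply: h1; exact: atom_sub.
  by rewrite memNset ?mulr0// => Qz; rewrite (atom_le xz Qz) in h1.
by move=> out; rewrite big1// => Q _; rewrite indicE memNset ?mulr0//; exact: out.
Qed.

Section measure.
Variable mu : {measure set X -> \bar R}.
Hypothesis fin_mu : forall Q : set X, Q \in A -> (mu Q < +oo)%E.

Definition weight x : R := fine (mu (atom x)).

Lemma weight_ge0 x : 0 <= weight x. Proof. by rewrite fine_ge0. Qed.

Lemma weightE x : mu (atom x) = (weight x)%:E.
Proof.
rewrite /weight fineK// ge0_fin_numE//; apply: le_lt_trans (fin_mu (valP x)).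
apply: le_measure; [apply/mem_set; exact: measurable_atom|
  apply/mem_set; exact: mA (valP x)|by move=> z /atom_sub].
Qed.

Lemma integral_step phi : (forall x, 0 <= phi x) ->
  (\int[mu]_z (step phi z)%:E = (\sum_x weight x * phi x)%:E)%E.
Proof.
move=> p0; rewrite /step.
under eq_integral do rewrite -sumEFin.
rewrite ge0_integral_sum//; last 2 first.
- move=> x; apply/measurable_EFinP; apply: measurable_funM => //.
  by apply: measurable_indic; exact: measurable_atom.
- by move=> x z _; rewrite lee_fin mulr_ge0// indicE.
rewrite -sumEFin; apply: eq_bigr => x _.
under eq_integral do rewrite EFinM.
rewrite ge0_integralZl//; last 2 first.
- by apply/measurable_EFinP; apply: measurable_indic; exact: measurable_atom.
- by rewrite lee_fin.
rewrite integral_indic//; last exact: measurable_atom.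
by rewrite setIT weightE -EFinM mulrC.
Qed.

Lemma integral_step_on (S : A) phi : (forall x, 0 <= phi x) ->
  (\int[mu]_(z in val S) (step phi z)%:E =
    (\sum_(x | cube_le x S) weight x * phi x)%:E)%E.
Proof.
move=> p0; rewrite integral_mkcond.
pose psi x := if cube_le x S then phi x else 0.
have -> : ((fun z => (step phi z)%:E) \_ (val S)) = (fun z => (step psi z)%:E).
  apply/funext => z; rewrite patchE; have [[x xz]|out] := atom_cases z; last first.
    by rewrite !step_out//; case: ifP.
  rewrite !(step_atom _ xz) /psi; case: ifPn => [/set_mem h|/negP h].
    by rewrite (atom_le xz h).
  case: ifPn => // /cube_leP xS; exfalso; apply: h; apply/mem_set/xS.
  exact: atom_sub.
rewrite integral_step; last by move=> x; rewrite /psi; case: ifP.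
congr (_%:E); rewrite [RHS]big_mkcond/=; apply: eq_bigr => x _.
by rewrite /psi; case: ifP => // _; rewrite mulr0.
Qed.

Lemma massE Q : mu (val Q) = (mass cube_le weight Q)%:E.
Proof.
have := @integral_step_on Q (fun=> 1) (fun=> ler01).
rewrite (eq_integral (fun=> 1%E)) => [|z].
  rewrite integral_cst ?mul1e; last exact: mA (valP Q).
  by move=> ->; congr (_%:E); apply: eq_bigr => x _; rewrite mulr1.
move=> /set_mem Qz; have [x xz] := atom_ex Qz.
by rewrite (step_atom _ xz).
Qed.

End measure.

End atoms.

(** * Exhaustion by finite families *)

Section poweR_facts.
Variable R : realType.
Implicit Types (x y : \bar R) (p : R).
Local Open Scope ereal_scope.

Lemma lee_poweR2r x y p : (0 <= p)%R -> 0 <= x -> x <= y -> x `^ p <= y `^ p.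
Proof.
move=> p0 x0 xy; apply: gt0_ler_poweR => //.
  by rewrite in_itv/= x0 leey.
by rewrite in_itv/= leey andbT (le_trans x0).
Qed.

Lemma poweRK x p : p != 0%R -> 0 <= x -> (x `^ p) `^ p^-1 = x.
Proof. by move=> p0 x0; rewrite -poweRrM mulfV// poweRe1. Qed.

Lemma poweRVK x p : p != 0%R -> 0 <= x -> (x `^ p^-1) `^ p = x.
Proof. by move=> p0 x0; rewrite -poweRrM mulVf// poweRe1. Qed.

Lemma poweR_root_le x y p : (0 < p)%R -> 0 <= x -> 0 <= y ->
  (x `^ p^-1 <= y) = (x <= y `^ p).
Proof.
move=> p0 x0 y0; apply/idP/idP => h.
  rewrite -(@poweRVK x p) ?gt_eqF//.
  by apply: lee_poweR2r; [exact: ltW|exact: poweR_ge0|].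
rewrite -(@poweRK y p) ?gt_eqF//.
by apply: lee_poweR2r => //; rewrite invr_ge0 ltW.
Qed.

(** The limit may be infinite, so the argument goes through suprema: the power and its inverse are
    both monotone and hence exchange with the supremum. *)
Lemma cvg_poweR_nd (u : (\bar R)^nat) (l : \bar R) p : (0 < p)%R ->
  (forall n, 0 <= u n) -> nondecreasing_seq u -> u @ \oo --> l ->
  (fun n => u n `^ p) @ \oo --> l `^ p.
Proof.
move=> p0 u0 ndu ul.
have ndup : nondecreasing_seq (fun n => u n `^ p).
  by move=> m n mn; apply: lee_poweR2r; rewrite ?(ltW p0)//; exact: ndu.
have lE : l = ereal_sup (range u).
  by apply: (cvg_unique _ ul); [exact: ereal_hausdorff|exact: ereal_nondecreasing_cvgn].
have l0 : 0 <= l by rewrite lE; apply: (le_trans (u0 0%N)); apply: ereal_sup_ubound; exists 0%N.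
suff <- : ereal_sup (range (fun n => u n `^ p)) = l `^ p.
  exact: ereal_nondecreasing_cvgn.
apply/eqP; rewrite eq_le; apply/andP; split.
  apply: ge_ereal_sup => _ [n _ <-]; apply: lee_poweR2r; rewrite ?(ltW p0)//.
  by rewrite lE; apply: ereal_sup_ubound; exists n.
set s := ereal_sup (range (fun n => u n `^ p)).
have s0 : 0 <= s.
  by apply: (le_trans (poweR_ge0 (u 0%N) p)); apply: ereal_sup_ubound; exists 0%N.
rewrite -(@poweRVK s p) ?gt_eqF//; apply: lee_poweR2r; rewrite ?(ltW p0)//.
rewrite lE; apply: ge_ereal_sup => _ [n _ <-].
rewrite -(@poweRK (u n) p) ?gt_eqF//; apply: lee_poweR2r.
- by rewrite invr_ge0 ltW.
- exact: poweR_ge0.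
- by apply: ereal_sup_ubound; exists n.
Qed.

End poweR_facts.

Section esum_fsets.
Context (R : realType) (T : choiceType).
Local Open Scope ereal_scope.

Lemma esum_ge_fset (D : set T) (h : T -> \bar R) (A : {fset T}) :
  (forall Q, Q \in A -> D Q) -> \sum_(Q <- A) h Q <= \esum_(Q in D) h Q.
Proof.
move=> AD; apply: esum_ge; exists [set` A].
  by split; [exact: finite_fset|move=> Q /= /AD].
by rewrite fsbig_finite//= set_fsetK.
Qed.

Lemma esum_le_fset (D : set T) (h : T -> \bar R) (B : \bar R) :
  (forall A : {fset T}, (forall Q, Q \in A -> D Q) -> \sum_(Q <- A) h Q <= B) ->
  \esum_(Q in D) h Q <= B.
Proof.
move=> H; apply: ge_ereal_sup => _ [Y [/finite_fsetP[A ->] AD] <-].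
by rewrite fsbig_finite//= set_fsetK; apply: H => Q QA; exact: AD.
Qed.

Lemma lee_sum_fset (D : set T) (h : T -> \bar R) (A B : {fset T}) :
  (forall Q, D Q -> 0 <= h Q) -> (forall Q, Q \in B -> D Q) ->
  {subset A <= B} -> \sum_(Q <- A) h Q <= \sum_(Q <- B) h Q.
Proof.
move=> h0 BD AB; apply: lee_sum_nneg_subfset; first exact: AB.
by move=> Q; rewrite !inE => /andP[_ /BD /h0].
Qed.

Definition exhausts (D : set T) (An : nat -> {fset T}) : Prop :=
  [/\ forall N Q, Q \in An N -> D Q,
      forall M N, (M <= N)%N -> {subset An M <= An N} &
      forall Q, D Q -> exists N, Q \in An N].

Lemma exhausts_sub (D : set T) (An : nat -> {fset T}) (A : {fset T}) :
  exhausts D An -> (forall Q, Q \in A -> D Q) ->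
  exists N, {subset A <= An N}.
Proof.
move=> [_ nd cov] AD.
have H (s : seq T) : (forall Q, Q \in s -> D Q) -> exists N, {subset s <= An N}.
  elim: s => [|Q s IH] sD; first by exists 0%N.
  have [|N HN] := IH; first by move=> S Ss; apply: sD; rewrite inE Ss orbT.
  have [|M HM] := cov Q; first by apply: sD; rewrite inE eqxx.
  exists (maxn M N) => S; rewrite inE => /orP[/eqP->|/HN h].
    exact: nd (leq_maxl _ _) _ HM.
  exact: nd (leq_maxr _ _) _ h.
exact: H.
Qed.

Lemma nd_exhaust (D : set T) (An : nat -> {fset T}) (h : T -> \bar R) :
  exhausts D An -> (forall Q, D Q -> 0 <= h Q) ->
  nondecreasing_seq (fun N => \sum_(Q <- An N) h Q).
Proof.
by move=> [sub nd _] h0 M N MN; apply: lee_sum_fset h0 (sub N) (nd _ _ MN).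
Qed.

Lemma cvg_exhaust (D : set T) (An : nat -> {fset T}) (h : T -> \bar R) :
  exhausts D An -> (forall Q, D Q -> 0 <= h Q) ->
  (fun N => \sum_(Q <- An N) h Q) @ \oo --> \esum_(Q in D) h Q.
Proof.
move=> ex h0; have [sub nd cov] := ex.
suff <- : ereal_sup (range (fun N => \sum_(Q <- An N) h Q)) = \esum_(Q in D) h Q.
  exact/ereal_nondecreasing_cvgn/(nd_exhaust ex h0).
apply/eqP; rewrite eq_le; apply/andP; split.
  by apply: ge_ereal_sup => _ [N _ <-]; apply: esum_ge_fset; exact: sub.
apply: esum_le_fset => A AD; have [N AN] := exhausts_sub ex AD.
apply: (le_trans (lee_sum_fset h0 (sub N) AN)).
by apply: ereal_sup_ubound; exists N.
Qed.

End esum_fsets.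

(** The cube being tested is put into every family, so that it is always an element of the forest at
    which the finite condition can be read. *)
Lemma dyadic_exhaustion (R : realType) (n : nat) (Q0 : set (borelRn R n)) :
  dyadic Q0 -> exists An : nat -> {fset (set (borelRn R n))},
    exhausts dyadic An /\ forall N, Q0 \in An N.
Proof.
move=> dQ0.
exists (fun N => [fset Q in Q0 :: [seq @dyadic_enum R n i | i <- iota 0 N]]%fset).
split; last by move=> N; rewrite !inE eqxx.
split.
- move=> N Q; rewrite !inE => /orP[/eqP->//|/mapP[i _ ->]].
  exact: dyadic_enumP.
- move=> M N MN Q; rewrite !inE => /orP[->//|/mapP[i iM ->]].
  apply/orP; right; apply/mapP; exists i => //.
  by move: iM; rewrite !mem_iota !add0n/= => /leq_trans; exact.
- move=> Q /dyadic_enum_surj[i <-]; exists i.+1.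
  rewrite in_fset in_cons; apply/orP; right; apply/mapP; exists i => //.
  by rewrite mem_iota add0n ltnS leqnn.
Qed.

Section limits_of_integrals.
Context d (X : measurableType d) (R : realType).
Variables (mu : {measure set X -> \bar R}) (D : set X).
Hypothesis mD : measurable D.
Local Open Scope ereal_scope.

Lemma integral_nd_cvg (f : nat -> X -> \bar R) (F : X -> \bar R) :
  (forall N, measurable_fun D (f N)) -> (forall N z, D z -> 0 <= f N z) ->
  (forall z, D z -> nondecreasing_seq (f ^~ z)) ->
  (forall z, D z -> f ^~ z @ \oo --> F z) ->
  (fun N => \int[mu]_(z in D) f N z) @ \oo --> \int[mu]_(z in D) F z.
Proof.
move=> mf f0 nd fF.
have := @cvg_monotone_convergence _ _ _ mu D mD f mf f0 nd.
rewrite (@eq_integral _ _ _ mu D F)// => z /set_mem Dz.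
by apply/cvg_lim => //; exact: fF.
Qed.

Lemma integral_nd_le (f : nat -> X -> \bar R) (F : X -> \bar R) (B : \bar R) :
  (forall N, measurable_fun D (f N)) -> (forall N z, D z -> 0 <= f N z) ->
  (forall z, D z -> nondecreasing_seq (f ^~ z)) ->
  (forall z, D z -> f ^~ z @ \oo --> F z) ->
  (forall N, \int[mu]_(z in D) f N z <= B) -> \int[mu]_(z in D) F z <= B.
Proof.
move=> mf f0 nd fF fB; apply: (cvge_le _ (integral_nd_cvg mf f0 nd fF)).
by apply: nearW => N; exact: fB.
Qed.

End limits_of_integrals.

(** * Testing conditions: passage between dyadic cubes and finite families *)

Section transfer.
Variables (R : realType) (n : nat).
Local Notation X := (borelRn R n).
Variable K : set X -> R.
Hypothesis K0 : forall Q, dyadic Q -> 0 <= K Q.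

Section family.
Variable A : {fset (set X)}.
Hypothesis dA : forall Q, Q \in A -> dyadic Q.

Lemma dyadic_family : cube_family A.
Proof.
split=> [Q /dA|Q /dA|Q S z /dA dQ /dA]; [exact: dyadic_measurable|
  exact: dyadic_neq0|exact: dyadic_laminar].
Qed.

Lemma family_fin (mu : {measure set X -> \bar R}) :
  (forall Q, dyadic Q -> (mu Q < +oo)%E) ->
  forall Q : set X, Q \in A -> (mu Q < +oo)%E.
Proof. by move=> h Q /dA; exact: h. Qed.

Lemma family_K0 (Q : A) : 0 <= K (val Q).
Proof. exact/K0/dA/valP. Qed.

Lemma family_massE (mu : {measure set X -> \bar R}) :
  (forall Q, dyadic Q -> (mu Q < +oo)%E) ->
  forall Q : A, mu (val Q) = (mass (@cube_le _ X A) (weight mu) Q)%:E.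
Proof.
by move=> fmu Q; apply: massE; [exact: dyadic_family|exact: family_fin].
Qed.

End family.

Local Open Scope ereal_scope.

(** The restriction to subcubes is moved from the index set into the term, so that one exhaustion of
    all dyadic cubes serves every [Q]. *)
Definition sum_term (h : set X -> \bar R) (mu : {measure set X -> \bar R})
    (Q : set X) (z : X) (Q' : set X) : \bar R :=
  if `[< Q' `<=` Q >] then h Q' * mu Q' * (\1_Q' z)%:E else 0.

Lemma dyadic_sumE h mu Q z :
  dyadic_sum h mu Q z = \esum_(Q' in dyadic) sum_term h mu Q z Q'.
Proof.
rewrite /dyadic_sum.
have -> : [set Q' : set X | dyadic Q' /\ Q' `<=` Q] = dyadic `&` [set Q' | Q' `<=` Q] by [].
rewrite esum_mkcondr; apply: eq_esum => Q' _; rewrite /sum_term.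
congr (if _ then _ else _).
Qed.

Lemma restricted_map_ge0 Q0 (mu : {measure set X -> \bar R}) Q :
  dyadic Q -> 0 <= restricted_map K Q0 mu Q.
Proof.
by move=> dQ; rewrite /restricted_map; case: ifP => // _; rewrite mule_ge0// lee_fin K0.
Qed.

Lemma sum_term_ge0 h mu Q z Q' : (forall S, dyadic S -> 0 <= h S) ->
  dyadic Q' -> 0 <= sum_term h mu Q z Q'.
Proof.
move=> h0 dQ; rewrite /sum_term; case: ifP => // _.
by rewrite !mule_ge0 ?h0// lee_fin indicE.
Qed.

Lemma restricted_map_family (A : {fset (set X)}) (mu : {measure set X -> \bar R})
    (S Q : A) : (forall Q, Q \in A -> dyadic Q) ->
  (forall Q, dyadic Q -> mu Q < +oo) ->
  restricted_map K (val S) mu (val Q) =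
  (kernel_at (@cube_le _ X A) (fun Q => K (val Q)) (weight mu) S Q)%:E.
Proof.
move=> dA fmu; rewrite /restricted_map /kernel_at /cube_le.
by case: ifP => // _; rewrite EFinM family_massE.
Qed.

Lemma sum_term_step (A : {fset (set X)}) (sc mu : {measure set X -> \bar R})
    (S0 S : A) z : (forall Q, Q \in A -> dyadic Q) ->
  (forall Q, dyadic Q -> sc Q < +oo) -> (forall Q, dyadic Q -> mu Q < +oo) ->
  \sum_(Q <- A) sum_term (restricted_map K (val S0) sc) mu (val S) z Q =
  (step (fun x : A => \sum_(Q | cube_le x Q && cube_le Q S)
    kernel_at (@cube_le _ X A) (fun Q => K (val Q)) (weight sc) S0 Q *
    mass (@cube_le _ X A) (weight mu) Q)%R z)%:E.
Proof.
move=> dA fsc fmu; rewrite big_seq_fsetE/=.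
pose hh (Q : A) : R := if cube_le Q S then
   (kernel_at (@cube_le _ X A) (fun Q => K (val Q)) (weight sc) S0 Q *
    mass (@cube_le _ X A) (weight mu) Q)%R else 0%R.
rewrite (eq_bigr (fun Q : A => (hh Q * \1_(val Q) z)%:E)); last first.
  move=> Q _; rewrite /sum_term /hh; case: ifP => h; rewrite /cube_le h ?mul0r//.
  by rewrite restricted_map_family// (family_massE dA fmu) !EFinM.
rewrite sumEFin (sum_indic_step (dyadic_family dA)).
congr (_%:E); congr (step _ z); apply/funext => x.
by rewrite [RHS]big_mkcondr/=; apply: eq_bigr.
Qed.

Lemma step_poweR (A : {fset (set X)}) (phi : A -> R) z (q : R) :
  (forall Q, Q \in A -> dyadic Q) -> (q != 0)%R ->
  (step phi z)%:E `^ q = (step (fun x => phi x `^ q)%R z)%:E.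
Proof.
move=> dA q0; rewrite poweR_EFin; congr (_%:E).
have [[x xz]|out] := atom_cases (dyadic_family dA) z.
  by rewrite !(step_atom (dyadic_family dA) _ xz).
by rewrite !step_out// powR0.
Qed.

Lemma measurable_step_term (A : {fset (set X)}) (phi : A -> R) (D : set X) :
  (forall Q, Q \in A -> dyadic Q) ->
  measurable_fun D (fun z => (step phi z)%:E).
Proof.
move=> dA; apply: measurable_funTS; apply/measurable_EFinP.
exact: (measurable_step (dyadic_family dA) phi).
Qed.

Section three_measures.
Variables sa sb sc : {measure set X -> \bar R}.
Hypotheses (fa : forall Q, dyadic Q -> sa Q < +oo)
  (fb : forall Q, dyadic Q -> sb Q < +oo) (fc : forall Q, dyadic Q -> sc Q < +oo).

Lemma measure_fineK (mu : {measure set X -> \bar R}) Q :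
  (forall Q, dyadic Q -> mu Q < +oo) -> dyadic Q -> mu Q = (fine (mu Q))%:E.
Proof. by move=> fmu dQ; rewrite fineK// ge0_fin_numE// fmu. Qed.

Local Notation le_ := (@cube_le _ X _).
Local Notation K_ := (fun Q => K (val Q)).

Section at_cube.
Variable Q0 : set X.
Hypothesis dQ0 : dyadic Q0.
Let h := restricted_map K Q0 sc.

Let h0 S : dyadic S -> 0 <= h S. Proof. exact: restricted_map_ge0. Qed.

Lemma dyadic_sum_cvg (An : nat -> {fset (set X)}) mu Q z : exhausts dyadic An ->
  (fun N => \sum_(Q' <- An N) sum_term h mu Q z Q') @ \oo --> dyadic_sum h mu Q z.
Proof.
by move=> ex; rewrite dyadic_sumE; apply: (cvg_exhaust ex) => Q' ?; exact: sum_term_ge0.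
Qed.

Lemma nd_sum_term (An : nat -> {fset (set X)}) mu Q z : exhausts dyadic An ->
  nondecreasing_seq (fun N => \sum_(Q' <- An N) sum_term h mu Q z Q').
Proof. by move=> ex; apply: (nd_exhaust ex) => Q' ?; exact: sum_term_ge0. Qed.

Lemma sum_sum_term_ge0 (A : {fset (set X)}) mu Q z : (forall Q, Q \in A -> dyadic Q) ->
  0 <= \sum_(Q' <- A) sum_term h mu Q z Q'.
Proof. by move=> dA; rewrite big_seq; apply: sume_ge0 => S /dA; exact: sum_term_ge0. Qed.

Lemma measurable_sum_term (A : {fset (set X)}) (mu : {measure set X -> \bar R})
    Q (D : set X) : (forall Q, dyadic Q -> mu Q < +oo) ->
  (forall Q, Q \in A -> dyadic Q) ->
  measurable_fun D (fun z => \sum_(Q' <- A) sum_term h mu Q z Q').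
Proof.
move=> fmu dA; rewrite (_ : (fun z => _) = fun z =>
  \sum_(S : A) (sum_term h mu Q z (val S))); last first.
  by apply/funext => z; rewrite big_seq_fsetE.
apply: emeasurable_sum => S; rewrite /sum_term.
case: `[< val S `<=` Q >]; last exact: measurable_cst.
have dS : dyadic (val S) by exact/dA/valP.
have -> : h (val S) * mu (val S) = (fine (h (val S) * mu (val S)))%:E.
  rewrite fineK// fin_numM//; last by rewrite ge0_fin_numE// fmu.
  rewrite /h /restricted_map; case: ifP => // _.
  by rewrite fin_numM// ge0_fin_numE// fc.
under eq_fun do rewrite -EFinM.
apply/measurable_EFinP; apply: measurable_funM => //.
apply: measurable_indic; exact: dyadic_measurable.
Qed.

Lemma measurable_dyadic_sum (mu : {measure set X -> \bar R}) Q (D : set X) :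
  (forall Q, dyadic Q -> mu Q < +oo) ->
  measurable_fun D (dyadic_sum h mu Q).
Proof.
move=> fmu; have [An [ex _]] := dyadic_exhaustion dQ0.
apply: (emeasurable_fun_cvg (fun N z => \sum_(Q' <- An N) sum_term h mu Q z Q')).
  by move=> N; apply: measurable_sum_term => //; have [] := ex => + _ _; exact.
by move=> z _; exact: dyadic_sum_cvg.
Qed.

Section sawyer.
Variable q : R.
Hypothesis q0 : (0 < q)%R.

Definition sawyer_phi (A : {fset (set X)}) (S : A) (x : A) : R :=
  \sum_(Q | cube_le x Q && cube_le Q S)
    kernel_at le_ K_ (weight sc) S Q * mass le_ (weight sa) Q.

Lemma integral_sawyer_fin (A : {fset (set X)}) (S : A) : val S = Q0 ->
  (forall Q, Q \in A -> dyadic Q) ->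
  \int[sb]_(z in Q0) (\sum_(Q <- A) sum_term h sa Q0 z Q) `^ q =
  (\sum_(x | cube_le x S) weight sb x * sawyer_phi S x `^ q)%:E.
Proof.
move=> SQ dA; rewrite /h -SQ.
under eq_integral do rewrite sum_term_step// step_poweR ?gt_eqF//.
apply: integral_step_on; [exact: dyadic_family|exact: family_fin|].
by move=> x; exact: powR_ge0.
Qed.

Lemma integral_sawyer_ge (A : {fset (set X)}) : (forall Q, Q \in A -> dyadic Q) ->
  \int[sb]_(z in Q0) (\sum_(Q <- A) sum_term h sa Q0 z Q) `^ q <=
  \int[sb]_(z in Q0) dyadic_sum h sa Q0 z `^ q.
Proof.
move=> dA; apply: ge0_le_integral.
- exact: dyadic_measurable.
- by move=> z _; exact: poweR_ge0.
- by apply: (measurableT_comp (measurable_poweR _)); exact: measurable_sum_term.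
- by apply: (measurableT_comp (measurable_poweR _)); exact: measurable_dyadic_sum.
- move=> z _; apply: lee_poweR2r; [exact: ltW|exact: sum_sum_term_ge0|].
  by rewrite dyadic_sumE; exact: esum_ge_fset.
Qed.

Lemma integral_sawyer_le (B : \bar R) :
  (forall A : {fset (set X)}, (forall Q, Q \in A -> dyadic Q) -> Q0 \in A ->
    \int[sb]_(z in Q0) (\sum_(Q <- A) sum_term h sa Q0 z Q) `^ q <= B) ->
  \int[sb]_(z in Q0) dyadic_sum h sa Q0 z `^ q <= B.
Proof.
move=> H; have [An [ex An0]] := dyadic_exhaustion dQ0; have [dAn nd _] := ex.
apply: (integral_nd_le (dyadic_measurable dQ0)
  (f := fun N z => (\sum_(Q <- An N) sum_term h sa Q0 z Q) `^ q)).
- move=> N; apply: (measurableT_comp (measurable_poweR _)).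
  by apply: measurable_sum_term => //; exact: dAn.
- by move=> N z _; exact: poweR_ge0.
- move=> z _ M N MN; apply: lee_poweR2r; [exact: ltW|exact/sum_sum_term_ge0/dAn|].
  exact: nd_sum_term.
- move=> z _; apply: cvg_poweR_nd => //.
  + by move=> N; exact/sum_sum_term_ge0/dAn.
  + exact: nd_sum_term.
  + exact: dyadic_sum_cvg.
- by move=> N; apply: H => //; exact: dAn.
Qed.

End sawyer.

Section wolff_transfer.
Variable q : R.
Hypothesis q1 : (1 < q)%R.

Let q10 : (0 < q - 1)%R. Proof. by rewrite subr_gt0. Qed.

Definition wolff_mean (Q : set X) : \bar R := \int[sa]_(z in Q) Lbar h sb Q z.

(** Only the sum is truncated; the denominator is the true measure of [Q]. Hence the means increase
    with [A], and on the forest of [A] they are the means [submean]. *)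
Definition wolff_mean_fin (A : {fset (set X)}) (Q : set X) : \bar R :=
  if sb Q == 0 then 0 else (sb Q)^-1 *
    \sum_(Q' <- A) (if `[< Q' `<=` Q >] then h Q' * sb Q' * sa Q' else 0).

Lemma restricted_map_fin_num Q : dyadic Q -> h Q \is a fin_num.
Proof.
move=> dQ; rewrite /h /restricted_map; case: ifP => // _.
by rewrite fin_numM// ge0_fin_numE// fc.
Qed.

Lemma fin_num_measure (mu : {measure set X -> \bar R}) Q :
  (forall Q, dyadic Q -> mu Q < +oo) -> dyadic Q -> mu Q \is a fin_num.
Proof. by move=> fmu dQ; rewrite ge0_fin_numE// fmu. Qed.

Lemma integral_sum_term (A : {fset (set X)}) Q : dyadic Q ->
  (forall Q, Q \in A -> dyadic Q) ->
  \int[sa]_(z in Q) (\sum_(Q' <- A) sum_term h sb Q z Q') =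
  \sum_(Q' <- A) (if `[< Q' `<=` Q >] then h Q' * sb Q' * sa Q' else 0).
Proof.
move=> dQ dA; rewrite big_seq_fsetE/=.
under eq_integral do rewrite big_seq_fsetE/=.
have dS (S : A) : dyadic (val S) by exact/dA/valP.
have kE (S : A) : h (val S) * sb (val S) = (fine (h (val S) * sb (val S)))%:E.
  by rewrite fineK// fin_numM ?restricted_map_fin_num ?fin_num_measure.
have mind (S : A) : measurable_fun Q (fun z => (\1_(val S) z)%:E : \bar R).
  apply/measurable_EFinP; apply: measurable_funTS.
  by apply: measurable_indic; exact: dyadic_measurable.
rewrite ge0_integral_sum; last 3 first.
- exact: dyadic_measurable.
- move=> S; rewrite /sum_term.
  case: `[< _ >]; last exact: measurable_cst.
  by rewrite (kE S); apply: measurable_funeM; exact: mind.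
- by move=> S z _; apply: sum_term_ge0; [exact: h0|exact: dS].
apply: eq_bigr => S _; rewrite /sum_term; case: asboolP => SQ; last by rewrite integral0.
have k0 : 0 <= h (val S) * sb (val S) by rewrite mule_ge0 ?h0.
rewrite kE in k0 *; rewrite ge0_integralZl//; last 2 first.
- exact: dyadic_measurable.
- exact: mind.
rewrite integral_indic; [by rewrite setIidl|exact: dyadic_measurable dQ|].
exact: dyadic_measurable (dS S).
Qed.

Lemma mean_term_ge0 Q Q' : dyadic Q' ->
  0 <= (if `[< Q' `<=` Q >] then h Q' * sb Q' * sa Q' else 0).
Proof. by move=> dQ'; case: ifP => // _; rewrite !mule_ge0 ?h0. Qed.

Lemma inve_measure_ge0 Q : 0 <= (sb Q)^-1.
Proof. by rewrite inve_ge0. Qed.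

Lemma inve_measure_fin_num Q : dyadic Q -> sb Q != 0 -> (sb Q)^-1 \is a fin_num.
Proof.
move=> dQ s0; rewrite (measure_fineK fb dQ) inver ifF//.
by apply/negP => /eqP h1; move/negP: s0; apply; rewrite (measure_fineK fb dQ) h1.
Qed.

Lemma wolff_mean_fin_ge0 (A : {fset (set X)}) Q :
  (forall Q, Q \in A -> dyadic Q) -> 0 <= wolff_mean_fin A Q.
Proof.
move=> dA; rewrite /wolff_mean_fin; case: ifP => // _.
rewrite mule_ge0 ?inve_measure_ge0// big_seq; apply: sume_ge0 => S /dA.
exact: mean_term_ge0.
Qed.

Lemma nd_wolff_mean (An : nat -> {fset (set X)}) Q : exhausts dyadic An ->
  nondecreasing_seq (fun N => wolff_mean_fin (An N) Q).
Proof.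
move=> ex M N MN; rewrite /wolff_mean_fin; case: ifP => // _.
rewrite lee_wpmul2l ?inve_measure_ge0//.
by apply: (nd_exhaust ex) => // Q' ?; exact: mean_term_ge0.
Qed.

Lemma cvg_wolff_mean (An : nat -> {fset (set X)}) Q : exhausts dyadic An ->
  dyadic Q -> (fun N => wolff_mean_fin (An N) Q) @ \oo --> wolff_mean Q.
Proof.
move=> ex dQ; rewrite /wolff_mean /wolff_mean_fin /Lbar.
have [_|s0] := eqVneq (sb Q) 0; first by rewrite integral0; exact: cvg_cst.
have [dAn _ _] := ex.
rewrite ge0_integralZl; last 4 first.
- exact: dyadic_measurable.
- exact: measurable_dyadic_sum.
- move=> z _; rewrite dyadic_sumE; apply: esum_ge0 => S dS; exact: sum_term_ge0.
- exact: inve_measure_ge0.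
apply: cvgeZl; first exact: inve_measure_fin_num.
rewrite (_ : (fun N => _) = fun N =>
    \int[sa]_(z in Q) (\sum_(Q' <- An N) sum_term h sb Q z Q')); last first.
  by apply/funext => N; rewrite integral_sum_term//; exact: dAn.
apply: integral_nd_cvg.
- exact: dyadic_measurable.
- by move=> N; apply: measurable_sum_term => //; exact: dAn.
- by move=> N z _; exact/sum_sum_term_ge0/dAn.
- by move=> z _; exact: nd_sum_term.
- by move=> z _; exact: dyadic_sum_cvg.
Qed.

Definition wolff_term (y : set X -> \bar R) (z : X) (Q : set X) : \bar R :=
  h Q * sb Q * y Q `^ (q - 1) * (\1_Q z)%:E.

Lemma wolff_term_ge0 y z Q : dyadic Q -> 0 <= wolff_term y z Q.
Proof.
by move=> dQ; rewrite /wolff_term !mule_ge0 ?h0 ?poweR_ge0.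
Qed.

Lemma le_wolff_term y y' z Q : dyadic Q -> 0 <= y Q -> y Q <= y' Q ->
  wolff_term y z Q <= wolff_term y' z Q.
Proof.
move=> dQ y0 yy; rewrite /wolff_term lee_wpmul2r ?lee_fin ?indicE//.
by rewrite lee_wpmul2l ?mule_ge0 ?h0//; apply: lee_poweR2r => //; exact: ltW.
Qed.

Lemma wolffE z : wolff q h sb sa z = \esum_(Q in dyadic) wolff_term wolff_mean z Q.
Proof. by []. Qed.

Definition wolff_sum (A : {fset (set X)}) z : \bar R :=
  \sum_(Q <- A) wolff_term (wolff_mean_fin A) z Q.

Lemma wolff_sum_ge0 (A : {fset (set X)}) z :
  (forall Q, Q \in A -> dyadic Q) -> 0 <= wolff_sum A z.
Proof.
by move=> dA; rewrite /wolff_sum big_seq; apply: sume_ge0 => S /dA; exact: wolff_term_ge0.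
Qed.

Lemma nd_wolff_sum (An : nat -> {fset (set X)}) z : exhausts dyadic An ->
  nondecreasing_seq (fun N => wolff_sum (An N) z).
Proof.
move=> ex M N MN; have [dAn nd _] := ex; rewrite /wolff_sum.
apply: (@le_trans _ _ (\sum_(Q <- An M) wolff_term (wolff_mean_fin (An N)) z Q)).
  rewrite big_seq [leRHS]big_seq; apply: lee_sum => Q /dAn dQ.
  apply: le_wolff_term => //; first exact/wolff_mean_fin_ge0/dAn.
  exact: nd_wolff_mean.
apply: (@lee_sum_fset _ _ dyadic); [|exact: dAn|exact: nd].
by move=> Q; exact: wolff_term_ge0.
Qed.

Lemma cvg_wolff_term (An : nat -> {fset (set X)}) z Q : exhausts dyadic An ->
  dyadic Q -> (fun N => wolff_term (wolff_mean_fin (An N)) z Q) @ \oo -->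
    wolff_term wolff_mean z Q.
Proof.
move=> ex dQ; have [dAn _ _] := ex; rewrite /wolff_term.
rewrite [X in _ --> X](muleC (h Q * sb Q * wolff_mean Q `^ (q - 1))).
under eq_fun do rewrite muleC.
apply: cvgeZl => //.
apply: cvgeZl; first by rewrite fin_numM ?restricted_map_fin_num ?fin_num_measure.
apply: cvg_poweR_nd => //.
- by move=> N; exact/wolff_mean_fin_ge0/dAn.
- exact: nd_wolff_mean.
- exact: cvg_wolff_mean.
Qed.

Lemma wolff_mean_fin_le (An : nat -> {fset (set X)}) N Q : exhausts dyadic An ->
  dyadic Q -> wolff_mean_fin (An N) Q <= wolff_mean Q.
Proof.
move=> ex dQ; apply: (cvge_ge _ (cvg_wolff_mean ex dQ)).
by exists N => // M /= NM; exact: nd_wolff_mean.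
Qed.

(** The family indexes the outer sum and also truncates the inner means. For the lower bound a
    finite outer family is fixed first, the means are sent to their limits, and only then is the
    outer supremum taken. *)
Lemma cvg_wolff_sum (An : nat -> {fset (set X)}) z : exhausts dyadic An ->
  (fun N => wolff_sum (An N) z) @ \oo --> wolff q h sb sa z.
Proof.
move=> ex; have [dAn nd _] := ex.
suff <- : ereal_sup (range (fun N => wolff_sum (An N) z)) = wolff q h sb sa z.
  exact/ereal_nondecreasing_cvgn/nd_wolff_sum.
apply/eqP; rewrite eq_le wolffE; apply/andP; split.
  apply: ge_ereal_sup => _ [N _ <-].
  apply: (@le_trans _ _ (\sum_(Q <- An N) wolff_term wolff_mean z Q)).
    rewrite /wolff_sum big_seq [leRHS]big_seq; apply: lee_sum => Q /dAn dQ.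
    apply: le_wolff_term => //; first exact/wolff_mean_fin_ge0/dAn.
    exact: wolff_mean_fin_le.
  by apply: esum_ge_fset; exact: dAn.
apply: esum_le_fset => A dA.
have c : (fun N => \sum_(Q : A) wolff_term (wolff_mean_fin (An N)) z (val Q)) @ \oo -->
    \sum_(Q : A) wolff_term wolff_mean z (val Q).
  apply: cvg_nnesum => Q _; last by apply: cvg_wolff_term => //; exact/dA/valP.
  by apply: nearW => N; exact/wolff_term_ge0/dA/valP.
rewrite big_seq_fsetE/=; apply: (cvge_le _ c).
have [N AN] := exhausts_sub ex dA.
exists N => // M /= NM; rewrite -(big_seq_fsetE _ _ xpredT (wolff_term _ z))/=.
apply: (@le_trans _ _ (wolff_sum (An M) z)); last by apply: ereal_sup_ubound; exists M.
apply: (@lee_sum_fset _ _ dyadic); [|exact: dAn|].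
  by move=> Q; exact: wolff_term_ge0.
by move=> Q /AN; exact: nd.
Qed.

Lemma wolff_mean_fin_mono (A B : {fset (set X)}) Q :
  (forall Q, Q \in B -> dyadic Q) -> {subset A <= B} ->
  wolff_mean_fin A Q <= wolff_mean_fin B Q.
Proof.
move=> dB AB; rewrite /wolff_mean_fin; case: ifP => // _.
rewrite lee_wpmul2l ?inve_measure_ge0//.
by apply: (@lee_sum_fset _ _ dyadic) => // Q' ?; exact: mean_term_ge0.
Qed.

Lemma wolff_sum_le (A : {fset (set X)}) z : (forall Q, Q \in A -> dyadic Q) ->
  wolff_sum A z <= wolff q h sb sa z.
Proof.
move=> dA; rewrite wolffE.
apply: (le_trans _ (esum_ge_fset (wolff_term wolff_mean z) dA)).
rewrite /wolff_sum big_seq [leRHS]big_seq; apply: lee_sum => Q QA.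
have dQ := dA _ QA; apply: le_wolff_term => //; first exact: wolff_mean_fin_ge0.
have [An [ex _]] := dyadic_exhaustion dQ0; have [dAn _ _] := ex.
have [N AN] := exhausts_sub ex dA.
apply: le_trans (wolff_mean_fin_le N ex dQ).
by apply: wolff_mean_fin_mono => //; exact: dAn.
Qed.

Section wolff_family.
Variable A : {fset (set X)}.
Hypothesis dA : forall Q, Q \in A -> dyadic Q.
Variable S : A.
Hypothesis SQ : val S = Q0.

Let L := kernel_at le_ K_ (weight sc) S.

Lemma restricted_mapE (Q : A) : h (val Q) = (L Q)%:E.
Proof. by rewrite /h -SQ restricted_map_family. Qed.

Lemma wolff_mean_finE (Q : A) : wolff_mean_fin A (val Q) =
  (submean le_ (weight sb) (fun Q' => L Q' * mass le_ (weight sa) Q')%R Q)%:E.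
Proof.
rewrite /wolff_mean_fin (family_massE dA fb) eqe /submean.
have [->|m0] := eqVneq (mass le_ (weight sb) Q) 0%R; first by rewrite invr0 mulr0.
rewrite inver (negPf m0) mulrC EFinM; congr (_ * _).
rewrite big_seq_fsetE/= [in RHS]big_mkcond/= -sumEFin; apply: eq_bigr => Q' _.
rewrite /cube_le; case: ifP => // _.
by rewrite restricted_mapE (family_massE dA fb) (family_massE dA fa) -!EFinM mulrAC.
Qed.

Lemma wolff_sum_step z : wolff_sum A z =
  (step (wolff_fin le_ (weight sa) (weight sb) L q) z)%:E.
Proof.
rewrite /wolff_sum big_seq_fsetE/=.
pose hh (Q : A) : R := (L Q * mass le_ (weight sb) Q *
  submean le_ (weight sb) (fun Q' => L Q' * mass le_ (weight sa) Q') Q `^ (q - 1))%R.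
rewrite (eq_bigr (fun Q : A => (hh Q * \1_(val Q) z)%:E)); last first.
  move=> Q _; rewrite /wolff_term wolff_mean_finE restricted_mapE.
  by rewrite (family_massE dA fb) poweR_EFin -!EFinM.
by rewrite sumEFin (sum_indic_step (dyadic_family dA)).
Qed.

Lemma integral_wolff_sum (t : R) : (t != 0)%R ->
  \int[sa]_z wolff_sum A z `^ t =
  (\sum_x weight sa x * wolff_fin le_ (weight sa) (weight sb) L q x `^ t)%:E.
Proof.
move=> t0; under eq_integral do rewrite wolff_sum_step step_poweR//.
apply: integral_step; [exact: dyadic_family|exact: family_fin|].
by move=> x; exact: powR_ge0.
Qed.

Lemma measurable_wolff_sum (t : R) (D : set X) :
  measurable_fun D (fun z => wolff_sum A z `^ t).
Proof.
apply: (measurableT_comp (measurable_poweR _)).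
rewrite (_ : wolff_sum A = fun z => (step (wolff_fin le_ (weight sa) (weight sb) L q) z)%:E).
  exact: measurable_step_term.
by apply/funext => z; exact: wolff_sum_step.
Qed.

End wolff_family.

Lemma measurable_wolff_powR (t : R) (D : set X) :
  measurable_fun D (fun z => wolff q h sb sa z `^ t).
Proof.
apply: (measurableT_comp (measurable_poweR _)).
have [An [ex An0]] := dyadic_exhaustion dQ0; have [dAn _ _] := ex.
apply: (emeasurable_fun_cvg (fun N => wolff_sum (An N))); last first.
  by move=> z _; exact: cvg_wolff_sum.
move=> N; have : measurable_fun D (fun z => wolff_sum (An N) z `^ 1).
  exact: (measurable_wolff_sum (dAn N) (S := [` An0 N]%fset)).
by apply: eq_measurable_fun => z _; rewrite poweRe1// wolff_sum_ge0//; exact: dAn.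
Qed.

Lemma integral_wolff_ge (A : {fset (set X)}) (t : R) : (0 < t)%R ->
  (forall Q, Q \in A -> dyadic Q) -> Q0 \in A ->
  \int[sa]_z wolff_sum A z `^ t <= \int[sa]_z wolff q h sb sa z `^ t.
Proof.
move=> t0 dA AQ0; apply: ge0_le_integral => //.
- by move=> z _; exact: poweR_ge0.
- exact: (measurable_wolff_sum dA (S := [` AQ0]%fset)).
- exact: measurable_wolff_powR.
- move=> z _; apply: lee_poweR2r; [exact: ltW|exact: wolff_sum_ge0|exact: wolff_sum_le].
Qed.

Lemma integral_wolff_le (t : R) (B : \bar R) : (0 < t)%R ->
  (forall A : {fset (set X)}, (forall Q, Q \in A -> dyadic Q) -> Q0 \in A ->
    \int[sa]_z wolff_sum A z `^ t <= B) ->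
  \int[sa]_z wolff q h sb sa z `^ t <= B.
Proof.
move=> t0 H; have [An [ex An0]] := dyadic_exhaustion dQ0; have [dAn nd _] := ex.
apply: (integral_nd_le measurableT (f := fun N z => wolff_sum (An N) z `^ t)).
- by move=> N; exact: (measurable_wolff_sum (dAn N) (S := [` An0 N]%fset)).
- by move=> N z _; exact: poweR_ge0.
- move=> z _ M N MN; apply: lee_poweR2r; [exact: ltW|exact/wolff_sum_ge0/dAn|].
  exact: nd_wolff_sum.
- move=> z _; apply: cvg_poweR_nd => //.
  + by move=> N; exact/wolff_sum_ge0/dAn.
  + exact: nd_wolff_sum.
  + exact: cvg_wolff_sum.
- by move=> N; apply: H => //; exact: dAn.
Qed.

Lemma Lnorm_wolff (r : R) : (0 < r)%R ->
  'N[sa]_r%:E[(fun z => wolff q h sb sa z `^ q^-1)] =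
  (\int[sa]_z wolff q h sb sa z `^ (r / q)) `^ r^-1.
Proof.
move=> r0; rewrite unlock /Lnorm; congr (_ `^ _); apply: eq_integral => z _.
by rewrite gee0_abs ?poweR_ge0// -poweRrM mulrC.
Qed.

End wolff_transfer.

End at_cube.

Section testing_transfer.
Variables (pa pb pc c : R).
Hypotheses (c0 : (0 <= c)%R) (pb1 : (1 < pb)%R).

Let boundE (A : {fset (set X)}) (S : A) (t : R) :
  (forall Q, Q \in A -> dyadic Q) -> (c%:E * sc (val S) `^ pc^-1) `^ t =
  ((c * mass le_ (weight sc) S `^ pc^-1) `^ t)%:E.
Proof. by move=> dA; rewrite (family_massE dA fc). Qed.

Let bound2E (A : {fset (set X)}) (S : A) (t : R) :
  (forall Q, Q \in A -> dyadic Q) ->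
  (c%:E * sa (val S) `^ pa^-1 * sc (val S) `^ pc^-1) `^ t =
  ((c * mass le_ (weight sc) S `^ pc^-1 * mass le_ (weight sa) S `^ pa^-1) `^ t)%:E.
Proof.
move=> dA; rewrite (family_massE dA fa) (family_massE dA fc).
by rewrite (mulrAC c).
Qed.

Lemma sawyer_to_fin (A : {fset (set X)}) (S : A) :
  (forall Q, Q \in A -> dyadic Q) ->
  sawyer_testing K sa sb sc pa pb pc c ->
  sawyer_fin le_ (weight sa) (weight sb) (kernel_at le_ K_ (weight sc) S) pa
    (dual_exponent pb) (c * mass le_ (weight sc) S `^ pc^-1) S.
Proof.
move=> dA test; have dS : dyadic (val S) by exact/dA/valP.
have q0 := dual_exponent_gt0 pb1.
have [] := test _ dS.
have I0 : 0 <= \int[sb]_(z in val S)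
    dyadic_sum (restricted_map K (val S) sc) sa (val S) z `^ dual_exponent pb.
  by apply: integral_ge0 => z _; exact: poweR_ge0.
have B0 : 0 <= c%:E * sa (val S) `^ pa^-1 * sc (val S) `^ pc^-1.
  by rewrite !mule_ge0 ?poweR_ge0 ?lee_fin.
rewrite poweR_root_le// => h _.
have := le_trans (integral_sawyer_ge dS q0 dA) h.
rewrite (integral_sawyer_fin q0 (erefl (val S)))//.
by rewrite bound2E// lee_fin.
Qed.

Lemma sawyer_of_fin :
  (forall A : {fset (set X)}, (forall Q, Q \in A -> dyadic Q) -> forall S : A,
    sawyer_fin le_ (weight sa) (weight sb) (kernel_at le_ K_ (weight sc) S) pa
      (dual_exponent pb) (c * mass le_ (weight sc) S `^ pc^-1) S) ->
  sawyer_testing K sa sb sc pa pb pc c.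
Proof.
move=> H Q dQ; have q0 := dual_exponent_gt0 pb1.
have I0 : 0 <= \int[sb]_(z in Q)
    dyadic_sum (restricted_map K Q sc) sa Q z `^ dual_exponent pb.
  by apply: integral_ge0 => z _; exact: poweR_ge0.
have B0 : 0 <= c%:E * sa Q `^ pa^-1 * sc Q `^ pc^-1.
  by rewrite !mule_ge0 ?poweR_ge0 ?lee_fin.
split; last by rewrite (measure_fineK fa dQ) (measure_fineK fc dQ) !poweR_EFin -!EFinM ltry.
rewrite poweR_root_le//; apply: integral_sawyer_le => // A dA QA.
pose S := [` QA]%fset.
rewrite (integral_sawyer_fin q0 (S := S))//.
have -> : Q = val S by [].
by rewrite bound2E// lee_fin; exact: (H A dA S).
Qed.

Variable r : R.
Hypothesis r0 : (0 < r)%R.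

Let rq0 : (0 < r / dual_exponent pb)%R.
Proof. by rewrite divr_gt0// dual_exponent_gt0. Qed.

Lemma wolff_to_fin (A : {fset (set X)}) (S : A) :
  (forall Q, Q \in A -> dyadic Q) ->
  wolff_testing K sa sb sc pb pc r c ->
  wolff_bound le_ (weight sa) (weight sb) (kernel_at le_ K_ (weight sc) S)
    (dual_exponent pb) r (c * mass le_ (weight sc) S `^ pc^-1).
Proof.
move=> dA test; have dS : dyadic (val S) by exact/dA/valP.
have q1 := dual_exponent_gt1 pb1.
have [] := test _ dS; rewrite Lnorm_wolff//.
have B0 : 0 <= c%:E * sc (val S) `^ pc^-1 by rewrite mule_ge0 ?poweR_ge0 ?lee_fin.
rewrite poweR_root_le//; last by apply: integral_ge0 => z _; exact: poweR_ge0.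
move=> h _.
have := le_trans (integral_wolff_ge dS q1 rq0 dA (valP S)) h.
rewrite (integral_wolff_sum _ dA (erefl (val S)))// ?gt_eqF//.
by rewrite boundE// lee_fin.
Qed.

Lemma wolff_of_fin :
  (forall A : {fset (set X)}, (forall Q, Q \in A -> dyadic Q) -> forall S : A,
    wolff_bound le_ (weight sa) (weight sb) (kernel_at le_ K_ (weight sc) S)
      (dual_exponent pb) r (c * mass le_ (weight sc) S `^ pc^-1)) ->
  wolff_testing K sa sb sc pb pc r c.
Proof.
move=> H Q dQ; have q1 := dual_exponent_gt1 pb1.
have B0 : 0 <= c%:E * sc Q `^ pc^-1 by rewrite mule_ge0 ?poweR_ge0 ?lee_fin.
split; last by rewrite (measure_fineK fc dQ) !poweR_EFin -!EFinM ltry.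
rewrite Lnorm_wolff//.
rewrite poweR_root_le//; last by apply: integral_ge0 => z _; exact: poweR_ge0.
apply: integral_wolff_le => // A dA QA.
pose S := [` QA]%fset.
rewrite (integral_wolff_sum _ dA (S := S))// ?gt_eqF//.
have -> : Q = val S by [].
rewrite boundE// lee_fin.
exact: (H A dA S).
Qed.

End testing_transfer.

End three_measures.

End transfer.

(** * Averaging functions over atoms *)

Section jensen.
Context d (X : measurableType d) (R : realType).
Variables (mu : {measure set X -> \bar R}) (E : set X) (f : X -> R) (p m J : R).
Hypotheses (mE : measurable E) (mf : measurable_fun E f) (p1 : 1 < p).
Hypotheses (Em : mu E = m%:E) (EJ : (\int[mu]_(z in E) (`|f z| `^ p)%:E = J%:E)%E).

Let mnorm : measurable_fun E (fun z => `|f z|%:E).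
Proof. by apply/measurable_EFinP; exact: measurableT_comp. Qed.

Let mpow : measurable_fun E (fun z => (`|f z| `^ p)%:E).
Proof.
apply/measurable_EFinP; apply: (measurableT_comp (measurable_powR p)).
exact: measurableT_comp.
Qed.

(** Young's inequality for [|f|] against [t ^ (p - 1)], integrated. The choice [t = 1] shows that
    [|f|] is integrable on [E], and [t] equal to the mean of [|f|] gives Jensen's inequality. *)
Lemma young_integral t : 0 <= t ->
  ((t `^ (p - 1))%:E * \int[mu]_(z in E) `|f z|%:E <=
   (p^-1 * J + (1 - p^-1) * t `^ p * m)%:E)%E.
Proof.
move=> t0; have p0 : 0 < p by exact: lt_trans p1.
have q0 : 0 < 1 - p^-1 by rewrite subr_gt0 invf_lt1.
rewrite -ge0_integralZl//; last by rewrite lee_fin powR_ge0.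
apply: (@le_trans _ _
  (\int[mu]_(z in E) ((p^-1)%:E * (`|f z| `^ p)%:E + ((1 - p^-1) * t `^ p)%:E))%E).
  apply: ge0_le_integral => //.
  - by move=> z _; rewrite -EFinM lee_fin mulr_ge0// powR_ge0.
  - by apply: emeasurable_funM.
  - by apply: emeasurable_funD => //; exact: emeasurable_funM.
  - move=> z _; rewrite -!EFinM -EFinD lee_fin.
    have := @conjugate_powR R `|f z| (t `^ (p - 1)) p (1 - p^-1)^-1 (normr_ge0 _)
      (powR_ge0 _ _) p0.
    rewrite invr_gt0 invrK => /(_ q0) H.
    rewrite mulrC (le_trans (H _))//; first by rewrite addrC subrK.
    rewrite -powRrM (_ : (p - 1) * (1 - p^-1)^-1 = p); last first.
      have p00 : p != 0 by rewrite gt_eqF.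
      have p10 : p - 1 != 0 by rewrite gt_eqF// subr_gt0.
      by rewrite (_ : 1 - p^-1 = (p - 1) / p) ?invf_div ?mulrA; field.
    by rewrite mulrC (mulrC (t `^ p)).
rewrite ge0_integralD//; last 3 first.
- by move=> z _; rewrite -EFinM lee_fin mulr_ge0 ?powR_ge0// invr_ge0 ltW.
- by apply: emeasurable_funM.
- by move=> z _; rewrite lee_fin mulr_ge0 ?powR_ge0// ltW.
rewrite ge0_integralZl//; last by rewrite lee_fin invr_ge0 ltW.
by rewrite EJ integral_cst// Em -!EFinM -EFinD.
Qed.

Lemma fine_integral_norm : (\int[mu]_(z in E) `|f z|%:E)%E \is a fin_num.
Proof.
rewrite ge0_fin_numE; last by apply: integral_ge0 => z _; rewrite lee_fin.
have := young_integral ler01; rewrite powR1 mul1e => /le_lt_trans; apply.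
by rewrite ltry.
Qed.

Lemma mean_powR_le : m * (fine (\int[mu]_(z in E) `|f z|%:E)%E / m) `^ p <= J.
Proof.
have p0 : 0 < p by exact: lt_trans p1.
have m0 : 0 <= m by rewrite -lee_fin -Em.
have I0 : (0 <= \int[mu]_(z in E) `|f z|%:E)%E.
  by apply: integral_ge0 => z _; rewrite lee_fin.
set I := fine _; have I00 : 0 <= I by exact: fine_ge0.
have [mz|mz] := eqVneq m 0.
  rewrite mz mul0r -lee_fin -EJ; apply: integral_ge0 => z _.
  by rewrite lee_fin powR_ge0.
have mgt : 0 < m by rewrite lt_def mz.
have t0 : 0 <= I / m by rewrite divr_ge0.
have := young_integral t0.
rewrite -(fineK fine_integral_norm) -/I -EFinM lee_fin.
have -> : (I / m) `^ (p - 1) * I = m * (I / m) `^ p.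
  rewrite -(mulr_powRB1 t0 p0); have := mulfV mz.
  by move: ((I / m) `^ (p - 1)) (m^-1) => a b h; rewrite -[LHS]mul1r -h; ring.
have : 0 < p^-1 by rewrite invr_gt0.
move: ((I / m) `^ p) (p^-1) => a b b0 h; rewrite -(ler_pM2l b0); lra.
Qed.

End jensen.

Section atoms_of_functions.
Context d (X : measurableType d) (R : realType).
Variable A : {fset set X}.
Hypothesis famA : cube_family A.
Variable mu : {measure set X -> \bar R}.
Hypothesis fin_mu : forall Q : set X, Q \in A -> (mu Q < +oo)%E.

Lemma trivIset_atom (s : seq A) : trivIset [set` s] (@atom d X A).
Proof. by move=> x y _ _ [z [xz yz]]; exact: (atom_inj famA xz yz). Qed.

Lemma cube_atoms (Q : A) :
  val Q = \big[setU/set0]_(x <- [seq x <- index_enum A | cube_le x Q]) atom x.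
Proof.
rewrite -bigcup_seq; apply/seteqP; split=> z.
  move=> Qz; have [x xz] := atom_ex famA Qz; exists x => //=.
  by rewrite mem_filter mem_index_enum andbT; exact: (atom_le famA xz Qz).
move=> [x /=]; rewrite mem_filter => /andP[/cube_leP xQ _] /atom_sub; exact: xQ.
Qed.

Lemma integral_cube_atoms (g : X -> \bar R) (Q : A) :
  measurable_fun setT g -> (forall z, (0 <= g z)%E) ->
  (\int[mu]_(z in val Q) g z = \sum_(x | cube_le x Q) \int[mu]_(z in atom x) g z)%E.
Proof.
move=> mg g0; rewrite -[RHS]big_filter [in LHS]cube_atoms ge0_integral_bigsetU//.
- by move=> x; exact: measurable_atom.
- exact/filter_uniq/index_enum_uniq.
- exact: trivIset_atom.
- exact: measurable_funTS.
Qed.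

Lemma sum_integral_atoms (g : X -> \bar R) :
  measurable_fun setT g -> (forall z, (0 <= g z)%E) ->
  (\sum_(x : A) \int[mu]_(z in atom x) g z <= \int[mu]_z g z)%E.
Proof.
move=> mg g0; rewrite -(@ge0_integral_bigsetU _ _ _ mu _ (@atom d X A))//; last 4 first.
- by move=> x; exact: measurable_atom.
- exact: index_enum_uniq.
- exact: trivIset_atom.
- exact: measurable_funTS.
apply: ge0_subset_integral => //; apply: bigsetU_measurable => x _.
exact: measurable_atom.
Qed.

Section atom_mean.
Variables (f : X -> R) (p : R).
Hypotheses (p1 : 1 < p) (fL : f \in Lfun mu p%:E).

(** The conditional expectation of [|f|] on the atoms: its integrals over the cubes dominate those
    of [f], and its norm does not exceed that of [f]. On an atom of weight 0 it is 0. *)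
Definition atom_mean (x : A) : R :=
  fine (\int[mu]_(z in atom x) `|f z|%:E)%E / weight mu x.

Lemma Lfun_measurable : measurable_fun setT f.
Proof. by move: fL => /andP[/set_mem]. Qed.

Let mnorm : measurable_fun setT (fun z => `|f z|%:E).
Proof. apply/measurable_EFinP; apply: measurableT_comp => //; exact: Lfun_measurable. Qed.

Let mpow : measurable_fun setT (fun z => (`|f z| `^ p)%:E).
Proof.
apply/measurable_EFinP; apply: (measurableT_comp (measurable_powR p)).
apply: measurableT_comp => //; exact: Lfun_measurable.
Qed.

Let N := 'N[mu]_p%:E[EFin \o f]%E.

Lemma Lfun_norm_fin_num : N \is a fin_num.
Proof. by rewrite ge0_fin_numE ?Lnorm_ge0//; move: fL => /andP[_ /set_mem]. Qed.

Lemma Lfun_integral_powR : (\int[mu]_z (`|f z| `^ p)%:E)%E = (fine N `^ p)%:E.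
Proof.
have p0 : p != 0 by rewrite gt_eqF// (lt_trans ltr01).
have := poweR_Lnorm mu (EFin \o f) p0; rewrite -/N => H.
by rewrite -poweR_EFin (fineK Lfun_norm_fin_num) H; apply: eq_integral.
Qed.

Lemma atom_integral_powR (x : A) : exists2 J : R, 0 <= J &
  (\int[mu]_(z in atom x) (`|f z| `^ p)%:E = J%:E)%E.
Proof.
have J0 : (0 <= \int[mu]_(z in atom x) (`|f z| `^ p)%:E)%E.
  by apply: integral_ge0 => z _; rewrite lee_fin powR_ge0.
exists (fine (\int[mu]_(z in atom x) (`|f z| `^ p)%:E)%E); first exact: fine_ge0.
rewrite fineK// ge0_fin_numE//.
apply: (@le_lt_trans _ _ (\int[mu]_z (`|f z| `^ p)%:E)%E).
  by apply: ge0_subset_integral => //; exact: measurable_atom.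
by rewrite Lfun_integral_powR ltry.
Qed.

Lemma atom_mean_ge0 x : 0 <= atom_mean x.
Proof.
rewrite divr_ge0 ?weight_ge0// fine_ge0//; apply: integral_ge0 => z _.
by rewrite lee_fin.
Qed.

Lemma weight_atom_mean x :
  (weight mu x * atom_mean x)%:E = (\int[mu]_(z in atom x) `|f z|%:E)%E.
Proof.
have [J J0 EJ] := atom_integral_powR x.
have mfx : measurable_fun (atom x) f by exact/measurable_funTS/Lfun_measurable.
have fin := fine_integral_norm (measurable_atom famA x) mfx p1 (weightE famA fin_mu x) EJ.
rewrite /atom_mean; have [w0|w0] := eqVneq (weight mu x) 0; last first.
  by rewrite mulrCA mulfV// mulr1 fineK.
rewrite w0 mul0r; apply/esym/null_set_integral => //.
- exact: measurable_atom.
- exact: measurable_funTS.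
- by rewrite (weightE famA fin_mu) w0.
Qed.

Lemma integral_norm_le (Q : A) : (`|\int[mu]_(z in val Q) (f z)%:E| <=
  (integ (@cube_le _ X A) (weight mu) atom_mean Q)%:E)%E.
Proof.
apply: (le_trans (le_abse_integral _ _ _)).
- exact: family_measurable famA _ (valP Q).
- by apply/measurable_EFinP/measurable_funTS/Lfun_measurable.
rewrite (integral_cube_atoms Q mnorm)// /integ -sumEFin.
by apply: lee_sum => x _; rewrite weight_atom_mean.
Qed.

Lemma pnorm_atom_mean : pnorm (weight mu) p atom_mean `^ p^-1 <= fine N.
Proof.
have p0 : 0 < p by exact: lt_trans p1.
have N0 : 0 <= fine N by rewrite fine_ge0// Lnorm_ge0.
rewrite -(@powRK _ (fine N) p) ?gt_eqF//; apply: ler_powR2r.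
- by rewrite invr_ge0 ltW.
- by apply: sumr_ge0 => x _; rewrite mulr_ge0 ?weight_ge0 ?powR_ge0.
rewrite -lee_fin -Lfun_integral_powR.
apply: le_trans (sum_integral_atoms mpow _); last first.
  by move=> z; rewrite lee_fin powR_ge0.
rewrite /pnorm -sumEFin; apply: lee_sum => x _.
have [J J0 EJ] := atom_integral_powR x.
have mfx : measurable_fun (atom x) f by exact/measurable_funTS/Lfun_measurable.
rewrite EJ lee_fin.
exact: (mean_powR_le (measurable_atom famA x) mfx p1 (weightE famA fin_mu x) EJ).
Qed.

End atom_mean.

Section step_function.
Variables (phi : A -> R) (p : R).
Hypotheses (p1 : 1 < p) (phi0 : forall x, 0 <= phi x).

Lemma Lnorm_step : ('N[mu]_p%:E[EFin \o step phi] =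
  (pnorm (weight mu) p phi `^ p^-1)%:E)%E.
Proof.
have p0 : p != 0 by rewrite gt_eqF// (lt_trans ltr01).
rewrite unlock /Lnorm -poweR_EFin; congr (_ `^ _)%E.
rewrite /pnorm -(integral_step famA fin_mu); last by move=> x; exact: powR_ge0.
apply: eq_integral => z _ /=; rewrite -/(_ `^ _)%R; congr (_%:E).
have [[x xz]|out] := atom_cases famA z.
  by rewrite !(step_atom famA _ xz) ger0_norm.
by rewrite !step_out// normr0 powR0.
Qed.

Lemma step_Lfun : step phi \in Lfun mu p%:E.
Proof.
apply/andP; split; apply/mem_set => /=.
  exact: measurable_step famA phi.
by rewrite /finite_norm Lnorm_step ltry.
Qed.

End step_function.

End atoms_of_functions.

(** * Equivalence with the finite statements *)

Lemma lee_prod (R : realDomainType) (I : Type) (s : seq I) (P : pred I)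
    (F G : I -> \bar R) : (forall i, P i -> 0 <= F i <= G i)%E ->
  (\prod_(i <- s | P i) F i <= \prod_(i <- s | P i) G i)%E.
Proof.
move=> FG.
suff /andP[] : (0 <= \prod_(i <- s | P i) F i <= \prod_(i <- s | P i) G i)%E by [].
elim/big_ind2 : _ => //= [|x1 x2 y1 y2 /andP[x10 x12] /andP[y10 y12]].
  by rewrite lee01 lexx.
by rewrite mule_ge0// lee_pmul.
Qed.

Lemma least_constant_le (R : realType) (P Q : R -> Prop) (C : R) : 0 < C ->
  (forall c, 0 <= c -> P c -> Q (C * c)) ->
  (least_constant Q <= C%:E * least_constant P)%E.
Proof.
move=> C0 PQ; rewrite -lee_pdivrMl//; apply/ereal_infP => _ [c [c0 Pc] <-].
rewrite lee_pdivrMl// -EFinM; apply: ereal_inf_lbound; exists (C * c) => //.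
by split; [rewrite mulr_ge0// ltW|exact: PQ].
Qed.

Section finite_reduction.
Variables (R : realType) (n : nat).
Local Notation X := (borelRn R n).
Variables (K : set X -> R) (sigma : 'I_3 -> {measure set X -> \bar R}).
Variable p : 'I_3 -> R.
Hypotheses (K0 : forall Q, dyadic Q -> 0 <= K Q)
  (fsigma : forall i Q, dyadic Q -> (sigma i Q < +oo)%E)
  (p_gt1 : forall i, 1 < p i).

Local Notation le_ := (@cube_le _ X _).
Local Notation trilinear_on A c :=
  (trilinear_fin p (@cube_le _ X A) (fun Q => K (val Q)) (fun i => weight (sigma i)) c).
Local Notation testing_on A c :=
  (testing_fin p (@cube_le _ X A) (fun Q => K (val Q)) (fun i => weight (sigma i)) c).

Lemma testing_to_fin (c : R) (A : {fset set X}) : 0 <= c ->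
  (forall Q, Q \in A -> dyadic Q) -> testing_conditions K sigma p c ->
  testing_on A c.
Proof.
move=> c0 dA test s; have [saw wol] := test s; split.
  by move=> le1 S; apply: (sawyer_to_fin K0 (fsigma _) (fsigma _) (fsigma _) c0 (p_gt1 _) _ dA); have [] := saw le1.
(* Positivity of [r] is not part of its definition; it follows from the two reciprocals adding up to
   less than 1. *)
move=> lt1 r rE S; have r0 : 0 < r by rewrite -invr_gt0; move: rE lt1; lra.
apply: (wolff_to_fin K0 (fsigma _) (fsigma _) (fsigma _) c0 (p_gt1 _) r0 _ dA).
by have [] := wol lt1 r rE.
Qed.

(** The second inequality of each pair is the first one for the permutation [t], which exchanges the
    first two entries of [s]. *)
Lemma testing_of_fin (c : R) : 0 <= c ->
  (forall A : {fset set X}, (forall Q, Q \in A -> dyadic Q) -> testing_on A c) ->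
  testing_conditions K sigma p c.
Proof.
move=> c0 H s /=; have [t [t0 t1 t2]] := perm3_swap s.
split=> [le1|lt1 r rE].
  split; apply: (sawyer_of_fin K0 (fsigma _) (fsigma _) (fsigma _) c0 (p_gt1 _)) => A dA S.
    by have [+ _] := H A dA s; apply.
  have := H A dA t; rewrite t0 t1 t2 => -[+ _]; apply.
  by rewrite addrC.
have r0 : 0 < r by rewrite -invr_gt0; move: rE lt1; lra.
split; apply: (wolff_of_fin K0 (fsigma _) (fsigma _) (fsigma _) c0 (p_gt1 _) r0) => A dA S.
  by have [_] := H A dA s; apply.
have := H A dA t; rewrite t0 t1 t2 => -[_]; apply; first by rewrite addrC.
by rewrite addrAC.
Qed.

(** The embedding is tested on functions constant on atoms, whose norms and integrals over cubes of
    [A] are the finite sums; the cubes outside [A] are dropped. *)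
Lemma trilinear_to_fin (c : R) (A : {fset set X}) :
  (forall Q, Q \in A -> dyadic Q) -> trilinear_embedding K sigma p c ->
  trilinear_on A c.
Proof.
move=> dA emb phi phi0; have famA := dyadic_family dA.
have finA i := family_fin dA (fsigma i).
have [i|] := emb (fun i => step (phi i)); first exact: (step_Lfun famA (finA i) (p_gt1 i) (phi0 i)).
under eq_bigr => i _ do rewrite (Lnorm_step famA (finA i) (p_gt1 i) (phi0 i)).
rewrite prodEFin -EFinM => h _.
rewrite -lee_fin; apply: le_trans h.
apply: (@le_trans _ _ _ _ _ _ (esum_ge_fset _ dA)).
rewrite big_seq_fsetE/= -sumEFin; apply: lee_sum => Q _.
under [in leRHS]eq_bigr => i _.
  rewrite (integral_step_on famA (finA i) Q (phi0 i)).
  rewrite gee0_abs; last first.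
    by rewrite lee_fin; apply: sumr_ge0 => x _; rewrite mulr_ge0 ?weight_ge0.
  over.
by rewrite prodEFin -EFinM.
Qed.

Lemma trilinear_of_fin (c : R) : 0 <= c ->
  (forall A : {fset set X}, (forall Q, Q \in A -> dyadic Q) -> trilinear_on A c) ->
  trilinear_embedding K sigma p c.
Proof.
move=> c0 H f fL.
have NE : (\prod_(i < 3) 'N[sigma i]_(p i)%:E[EFin \o f i] =
   (\prod_(i < 3) fine 'N[sigma i]_(p i)%:E[EFin \o f i])%:E)%E.
  by rewrite -prodEFin; apply: eq_bigr => i _; rewrite fineK// (Lfun_norm_fin_num (fL i)).
rewrite NE -EFinM; split; last by rewrite ltry.
apply: esum_le_fset => A dA; have famA := dyadic_family dA.
have finA i := family_fin dA (fsigma i).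
pose phi i (x : A) := atom_mean (sigma i) (f i) x.
have phi0 i x : 0 <= phi i x by exact: atom_mean_ge0.
apply: (@le_trans _ _
  (\sum_(Q : A) K (val Q) * \prod_(i < 3) integ le_ (weight (sigma i)) (phi i) Q)%:E).
  rewrite big_seq_fsetE/= -sumEFin; apply: lee_sum => Q _.
  rewrite EFinM -prodEFin lee_wpmul2l ?lee_fin ?(family_K0 K0 dA)//.
  apply: lee_prod => i _; rewrite abse_ge0/=.
  exact: (integral_norm_le famA (finA i) (p_gt1 i) (fL i)).
rewrite lee_fin; apply: (le_trans (H A dA phi phi0)).
rewrite ler_wpM2l//; apply: ler_prod => i _; rewrite powR_ge0/=.
exact: (pnorm_atom_mean famA (finA i) (p_gt1 i) (fL i)).
Qed.

Lemma trilinear_embedding_mono (c c' : R) : c <= c' ->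
  trilinear_embedding K sigma p c -> trilinear_embedding K sigma p c'.
Proof.
move=> cc' emb f fL; have [h _] := emb f fL.
have N0 : (0 <= \prod_(i < 3) 'N[sigma i]_(p i)%:E[EFin \o f i])%E.
  by apply: prode_ge0 => i _; exact: Lnorm_ge0.
split; first by apply: (le_trans h); rewrite lee_wpmul2r ?lee_fin.
rewrite ltey_eq fin_numM// prode_fin_num// => i _.
exact: (Lfun_norm_fin_num (fL i)).
Qed.

Let measure_poweR_fin_num i Q (t : R) : dyadic Q -> (sigma i Q `^ t)%E \is a fin_num.
Proof. by move=> dQ; rewrite (measure_fineK (fsigma i) dQ) poweR_EFin. Qed.

Lemma testing_conditions_mono (c c' : R) : c <= c' ->
  testing_conditions K sigma p c -> testing_conditions K sigma p c'.
Proof.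
move=> cc' test s /=.
have saw a b d : sawyer_testing K (sigma a) (sigma b) (sigma d) (p a) (p b) (p d) c ->
    sawyer_testing K (sigma a) (sigma b) (sigma d) (p a) (p b) (p d) c'.
  move=> h Q dQ; have [hQ _] := h Q dQ; split.
    by apply: (le_trans hQ); rewrite !lee_wpmul2r ?poweR_ge0.
  by rewrite ltey_eq !fin_numM ?measure_poweR_fin_num.
have wol a b d r : wolff_testing K (sigma a) (sigma b) (sigma d) (p b) (p d) r c ->
    wolff_testing K (sigma a) (sigma b) (sigma d) (p b) (p d) r c'.
  move=> h Q dQ; have [hQ _] := h Q dQ; split.
    by apply: (le_trans hQ); rewrite lee_wpmul2r ?poweR_ge0.
  by rewrite ltey_eq fin_numM ?measure_poweR_fin_num.
have [h1 h2] := test s; split.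
  by move=> /h1[/saw ? /saw ?].
by move=> /h2 h r /h[/wol ? /wol ?].
Qed.

End finite_reduction.

Theorem theorem1p3 (R : realType) (n : nat) (n_gt0 : (0 < n)%N)
    (p : 'I_3 -> R) (p_gt1 : forall i, 1 < p i)
    (p_sum : 1 <= \sum_(i < 3) (p i)^-1) :
  exists2 C : R, 0 < C &
    forall (K : set (borelRn R n) -> R)
      (sigma : 'I_3 -> {measure set (borelRn R n) -> \bar R}),
      (forall Q, dyadic Q -> 0 <= K Q) ->
      (forall i Q, dyadic Q -> (sigma i Q < +oo)%E) ->
      ((exists c1 : R, trilinear_embedding K sigma p c1) <->
       (exists c2 : R, testing_conditions K sigma p c2)) /\
      (least_constant (trilinear_embedding K sigma p) <=
         C%:E * least_constant (testing_conditions K sigma p))%E /\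
      (least_constant (testing_conditions K sigma p) <=
         C%:E * least_constant (trilinear_embedding K sigma p))%E.
Proof.
have [C1 C10 suff_] := trilinear_fin_suff p_gt1 p_sum.
have [C2 C20 nec_] := trilinear_fin_nec p_gt1.
exists (C1 + C2); first by rewrite addr_gt0.
move=> K sigma K0 fsigma.
have famA := dyadic_family.
have suff1 c : 0 <= c -> testing_conditions K sigma p c ->
    trilinear_embedding K sigma p ((C1 + C2) * c).
  move=> c0 test.
  apply: (@trilinear_embedding_mono _ _ _ _ _ (C1 * c)).
    by rewrite ler_wpM2r// lerDl ltW.
  apply: trilinear_of_fin => //; first by rewrite mulr_ge0// ltW.
  move=> A dA; apply: suff_ => //.
  - exact/forest_cube_le/famA.
  - by move=> i x; exact: weight_ge0.
  - by move=> Q; exact: family_K0.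
  - exact: testing_to_fin.
have nec1 c : 0 <= c -> trilinear_embedding K sigma p c ->
    testing_conditions K sigma p ((C1 + C2) * c).
  move=> c0 tri.
  apply: (@testing_conditions_mono _ _ _ _ _ fsigma (C2 * c)).
    by rewrite ler_wpM2r// lerDr ltW.
  apply: testing_of_fin => //; first by rewrite mulr_ge0// ltW.
  move=> A dA; apply: nec_ => //.
  - exact/forest_cube_le/famA.
  - by move=> i x; exact: weight_ge0.
  - by move=> Q; exact: family_K0.
  - exact: trilinear_to_fin.
split; last by split; apply: least_constant_le => //; rewrite addr_gt0.
(* An admissible constant could be negative when the right-hand sides vanish; it is raised to its
   positive part before the quantitative implications are applied. *)
split=> -[c Hc]; exists ((C1 + C2) * Num.max c 0).
  apply: nec1; first by rewrite le_max lexx orbT.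
  by apply: trilinear_embedding_mono Hc => //; rewrite le_max lexx.
apply: suff1; first by rewrite le_max lexx orbT.
by apply: testing_conditions_mono Hc => //; rewrite le_max lexx.
Qed.
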